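(* Let $n\ge 2$, $p$ a prime, $b_n\in\mathbb{Z}_p^\times$, and let \begin{align*} V_n(\mathbb{Z}_p)_{a_n = b_n} &= \{x^n + a_1 x^{n - 1} + \ldots + a_n \in \mathbb{Z}_p[x] : a_n = b_n\},\\ V_n(\mathbb{Z}_p)_{p \nmid a_n} &= \{x^n + a_1 x^{n - 1} + \ldots + a_n \in \mathbb{Z}_p[x] : p \nmid a_n\}. \end{align*} For odd $p$ and $b\in\mathbb{F}_p^\times$ let \[ \kappa_{n, p}(b) = \frac{1}{p - 1} \sum_{\chi \in \widehat{\mathbb{F}_p^{\times}} \setminus \{1\}} \chi(b)^{-1} \sum_{c \in \mathbb{F}_p^{\times}} \chi(c)^n, \] which equals $\gcd(n, p - 1) - 1$ if $b$ is an $n$th power in $\mathbb{F}_p^\times$ and $-1$ otherwise. Write $V = V_n(\mathbb{Z}_p)_{a_n = b_n}$ and $V' = V_n(\mathbb{Z}_p)_{p \nmid a_n}$. (i) If $p = 2$, then $P_1^{\mathrm{sqf}}(V) = 0$, $P^{\max}(V) = P^{\max}(V')$ and $P_0^{\mathrm{sqf}}(V) = P_0^{\mathrm{sqf}}(V')$. (ii) If $p$ is odd and $2 \nmid n$, then $P^{\max}(V) = P^{\max}(V')$, $P_0^{\mathrm{sqf}}(V) = P_0^{\mathrm{sqf}}(V')$, and \[ P_1^{\mathrm{sqf}}(V) = P_1^{\mathrm{sqf}}(V') - \frac{p - 1}{p^n} \kappa_{n, p}(\overline{b_n}). \] (iii) If $p$ is odd and $2 \mid n$, then \begin{align*} P^{\max}(V)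 &= P^{\max}(V') - \frac{1}{p^{3n/2 - 1}} \left(\frac{b_n}{p}\right), \\ P_0^{\mathrm{sqf}}(V) &= P_0^{\mathrm{sqf}}(V') - \frac{1}{p^{n - 1}} \left(\frac{b_n}{p}\right), \\ P_1^{\mathrm{sqf}}(V) &= P_1^{\mathrm{sqf}}(V') + \frac{p - 1}{p^n} \kappa_{n, p}(\overline{b_n}) - \frac{(p - 1)^2}{p^n} \left(\frac{n}{2} - 1\right) \left(\frac{b_n}{p}\right). \end{align*}
   Context: $V_n(\mathbb{Z}_p)$ is the set of monic degree-$n$ polynomials over $\mathbb{Z}_p$; subsets defined by fixing $k$ coefficients and congruence conditions on others are identified with subsets of $\mathbb{Z}_p^{n-k}$ with Haar measure. Densities are ratios of measures: $P_0^{\mathrm{sqf}}$ is the density of $f$ with $p\nmid\mathrm{Disc}(f)$, $P_1^{\mathrm{sqf}}$ the density of $f$ with $v_p(\mathrm{Disc}(f))=1$, and $P^{\max}$ the density of $f$ with $\mathbb{Z}_p[x]/(f(x))$ the maximal order of $\mathbb{Q}_p[x]/(f(x))$. $\overline{b_n}$ is the reduction of $b_n$ mod $p$, $\left(\frac{b_n}{p}\right)$ is the Legendre symbol of $b_n$ mod $p$, and $\widehat{\mathbb{F}_p^\times}$ is the character group of the multiplicative group $\mathbb{F}_p^\times$ with $1$ the trivial character. *)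

(* Defs.v *)
From HB Require Import structures.
From mathcomp Require Import all_boot all_order all_algebra all_fingroup.
From mathcomp Require Import all_field all_character qpoly.
From mathcomp Require Import all_classical all_reals all_analysis.
From mathcomp Require Import ring.

Set Implicit Arguments.
Unset Strict Implicit.
Unset Printing Implicit Defensive.

Import Order.TTheory GRing.Theory Num.Theory.

Local Open Scope classical_set_scope.
Local Open Scope ring_scope.

(* Z_p is the inverse limit of the Z / p^k: [residue x k] is the representative
   in [0, p^k) of the class of x mod p^k. *)
Record padic_int (p : nat) (p_pr : prime p) := PadicInt {
  residue : nat -> nat;
  residueS : forall k, residue k = (residue k.+1 %% p ^ k)%N }.

HB.instance Definition _ p (p_pr : prime p) :=
  gen_eqMixin (padic_int p_pr).
HB.instance Definition _ p (p_pr : prime p) :=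
  gen_choiceMixin (padic_int p_pr).

Section PadicRing.
Variables (p : nat) (p_pr : prime p).
Local Notation Z_p := (padic_int p_pr).
Implicit Types x y z : Z_p.

Lemma padicP x y : (forall k, residue x k = residue y k) <-> x = y.
Proof.
split=> [|-> //]; case: x y => [x xS] [y yS] /= /funext exy.
by rewrite exy in xS *; congr PadicInt; exact: Prop_irrelevance.
Qed.

Lemma expp_gt0 k : (0 < p ^ k)%N.
Proof. by rewrite expn_gt0 prime_gt0. Qed.

Lemma residue_mod x k : (residue x k %% p ^ k)%N = residue x k.
Proof. by rewrite residueS modn_mod. Qed.

Lemma residue_lt x k : (residue x k < p ^ k)%N.
Proof. by rewrite residueS ltn_mod expp_gt0. Qed.

Lemma residue_le x k l : (k <= l)%N -> (residue x l %% p ^ k)%N = residue x k.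
Proof.
move=> /subnK <-; elim: (l - k)%N => [|m IHm]; first exact: residue_mod.
rewrite -{}[RHS]IHm [in RHS]residueS addSn modn_dvdm //.
by rewrite dvdn_exp2l // leq_addl.
Qed.

Lemma trunc_subproof (u : nat -> nat)
    (uS : forall k, u k = u k.+1 %[mod p ^ k]) k :
  (u k %% p ^ k = (u k.+1 %% p ^ k.+1) %% p ^ k)%N.
Proof. by rewrite modn_dvdm ?dvdn_exp2l. Qed.

Definition padic_of (u : nat -> nat)
    (uS : forall k, u k = u k.+1 %[mod p ^ k]) : Z_p :=
  PadicInt p_pr (trunc_subproof uS).

Lemma const_subproof (m k : nat) : m = m %[mod p ^ k].
Proof. by []. Qed.

Lemma add_subproof x y k :
  (residue x k + residue y k = residue x k.+1 + residue y k.+1 %[mod p ^ k])%N.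
Proof. by rewrite (residueS x) (residueS y) modnDm. Qed.

Lemma opp_subproof x k :
  (p ^ k - residue x k = p ^ k.+1 - residue x k.+1 %[mod p ^ k])%N.
Proof.
apply/eqP; rewrite -(eqn_modDr (residue x k.+1)).
rewrite subnK; last exact/ltnW/residue_lt.
rewrite -modnDmr -residueS subnK; last exact/ltnW/residue_lt.
by rewrite modnn expnS modnMl.
Qed.

Lemma mul_subproof x y k :
  (residue x k * residue y k = residue x k.+1 * residue y k.+1 %[mod p ^ k])%N.
Proof. by rewrite (residueS x) (residueS y) modnMm. Qed.

Definition padic0 := padic_of (const_subproof 0).
Definition padic1 := padic_of (const_subproof 1).
Definition padic_add x y := padic_of (add_subproof x y).
Definition padic_opp x := padic_of (opp_subproof x).
Definition padic_mul x y := padic_of (mul_subproof x y).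

Fact padic_addA : associative padic_add.
Proof. by move=> x y z; apply/padicP => k /=; rewrite modnDml modnDmr addnA. Qed.
Fact padic_addC : commutative padic_add.
Proof. by move=> x y; apply/padicP => k /=; rewrite addnC. Qed.
Fact padic_add0 : left_id padic0 padic_add.
Proof. by move=> x; apply/padicP => k /=; rewrite modnDml add0n residue_mod. Qed.
Fact padic_addN : left_inverse padic0 padic_opp padic_add.
Proof.
move=> x; apply/padicP => k /=.
by rewrite modnDml subnK ?modnn ?mod0n //; exact/ltnW/residue_lt.
Qed.

HB.instance Definition _ := GRing.isZmodule.Build Z_p
  padic_addA padic_addC padic_add0 padic_addN.

Fact padic_mulA : associative padic_mul.
Proof. by move=> x y z; apply/padicP => k /=; rewrite modnMml modnMmr mulnA. Qed.
Fact padic_mulC : commutative padic_mul.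
Proof. by move=> x y; apply/padicP => k /=; rewrite mulnC. Qed.
Fact padic_mul1 : left_id padic1 padic_mul.
Proof. by move=> x; apply/padicP => k /=; rewrite modnMml mul1n residue_mod. Qed.
Fact padic_mulDl : left_distributive padic_mul padic_add.
Proof.
by move=> x y z; apply/padicP => k /=; rewrite modnMml modnDmr modnDml mulnDl.
Qed.
Fact padic1_neq0 : padic1 != padic0.
Proof.
apply/eqP => /padicP /(_ 1%N) /=.
by rewrite mod0n expn1 modn_small ?prime_gt1.
Qed.

HB.instance Definition _ := GRing.Zmodule_isComNzRing.Build Z_p
  padic_mulA padic_mulC padic_mul1 padic_mulDl padic1_neq0.

Definition padic_unit : pred Z_p := fun x => `[< exists y, y * x = 1 >].
Definition padic_inv x : Z_p :=
  if pselect (exists y, y * x = 1) is left ex then projT1 (cid ex) else x.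

Fact padic_mulV : {in padic_unit, left_inverse 1 padic_inv *%R}.
Proof.
move=> x /asboolP ux; rewrite /padic_inv.
by case: pselect => // ex; case: cid.
Qed.
Fact padic_unitP x y : y * x = 1 -> padic_unit x.
Proof. by move=> yx; apply/asboolP; exists y. Qed.
Fact padic_inv_out : {in [predC padic_unit], padic_inv =1 id}.
Proof.
move=> x /negP nux; rewrite /padic_inv; case: pselect => // ex.
by case: nux; exact/asboolP.
Qed.

HB.instance Definition _ := GRing.ComNzRing_hasMulInverse.Build Z_p
  padic_mulV padic_unitP padic_inv_out.

Fact padic_idomain : GRing.integral_domain_axiom Z_p.
Proof.
move=> x y xy0; case: eqVneq => //= x0; case: eqVneq => //= y0; exfalso.
have nz z : z != 0 -> exists k, residue z k != 0%N.
  move=> z0; apply: contrapT => /forallNP zk; move/eqP: z0; apply.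
  by apply/padicP => k; rewrite [RHS]mod0n; apply/eqP/negPn/negP/zk.
have lbd z k l : residue z k != 0%N -> (k <= l)%N ->
    (0 < residue z l)%N && (logn p (residue z l) < k)%N.
  move=> zk kl; have Nd : ~~ (p ^ k %| residue z l)%N.
    by rewrite /dvdn residue_le.
  have z_gt0 : (0 < residue z l)%N.
    by rewrite lt0n; apply: contra Nd => /eqP ->; rewrite dvdn0.
  by rewrite z_gt0 ltnNge -pfactor_dvdn.
have [i xi] := nz _ x0; have [j yj] := nz _ y0.
have /andP[xp xl] := lbd _ _ _ xi (leq_addr j i).
have /andP[yp yl] := lbd _ _ _ yj (leq_addl i j).
have /padicP/(_ (i + j)%N) /= := xy0; rewrite mod0n => /eqP.
rewrite -/(dvdn _ _) pfactor_dvdn ?muln_gt0 ?xp // lognM //.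
by rewrite leqNgt -addnS leq_add // ltnW.
Qed.

HB.instance Definition _ :=
  GRing.ComUnitRing_isIntegral.Build Z_p padic_idomain.

HB.instance Definition _ := isPointed.Build Z_p 0.

(** The p-adic topology: the balls around [x] are the classes mod p^k. *)

Definition padic_ball x k : set Z_p := [set y | residue y k = residue x k].

Definition padic_open (U : set Z_p) : Prop :=
  forall x, U x -> exists k, padic_ball x k `<=` U.

Fact padic_openT : padic_open setT.
Proof. by move=> x _; exists 0%N. Qed.

Lemma padic_ball_le x k l : (k <= l)%N -> padic_ball x l `<=` padic_ball x k.
Proof. move=> kl y; rewrite /padic_ball /= => yx.
by rewrite -(residue_le y kl) yx residue_le. Qed.

Fact padic_openI U V : padic_open U -> padic_open V -> padic_open (U `&` V).
Proof.
move=> Uo Vo x [/Uo[k kU] /Vo[l lV]]; exists (maxn k l) => y xy; split.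
  exact/kU/padic_ball_le/xy/leq_maxl.
exact/lV/padic_ball_le/xy/leq_maxr.
Qed.

Fact padic_open_bigU (I : Type) (f : I -> set Z_p) :
  (forall i, padic_open (f i)) -> padic_open (\bigcup_i f i).
Proof.
by move=> fo x [i _ /fo[k kf]]; exists k => y /kf fy; exists i.
Qed.

HB.instance Definition _ := isOpenTopological.Build Z_p
  padic_openT padic_openI padic_open_bigU.

Definition reduction x : 'F_p := (residue x 1)%:R.

Lemma Fp_nat_expn1 m : (m %% p ^ 1)%:R = m%:R :> 'F_p.
Proof. by rewrite expn1 Fp_nat_mod. Qed.

Fact reduction_is_zmod_morphism : zmod_morphism reduction.
Proof.
move=> x y; apply/eqP; rewrite -subr_eq0 opprB addrA -[_ + reduction y]addrC.
apply/eqP.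
rewrite /reduction /= Fp_nat_expn1 natrD Fp_nat_expn1 natrB; last first.
  exact/ltnW/residue_lt.
by rewrite expn1 pchar_Fp_0 // sub0r; ring.
Qed.

HB.instance Definition _ := GRing.isZmodMorphism.Build Z_p 'F_p reduction
  reduction_is_zmod_morphism.

Fact reduction_is_monoid_morphism : monoid_morphism reduction.
Proof.
split=> [|x y]; first by rewrite /reduction /= Fp_nat_expn1.
by rewrite /reduction /= Fp_nat_expn1 natrM.
Qed.

HB.instance Definition _ := GRing.isMonoidMorphism.Build Z_p 'F_p reduction
  reduction_is_monoid_morphism.

Definition unit_reduction x (xU : x \is a GRing.unit) : {unit 'F_p} :=
  FinRing.unit 'F_p (rmorph_unit reduction xU).

Definition padic_dvd x y : Prop := exists z, y = x * z.

(* v_p(x) = k *)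
Definition padic_val_eq x (k : nat) : Prop :=
  padic_dvd (p%:R ^+ k) x /\ ~ padic_dvd (p%:R ^+ k.+1) x.

End PadicRing.

(* For monic f this is the usual discriminant (-1)^(n(n-1)/2) Res(f, f'). *)
Definition disc (A : comNzRingType) (f : {poly A}) : A :=
  (-1) ^+ 'C((size f).-1, 2) * resultant f f^`().

Section Orders.
Variables (p : nat) (p_pr : prime p).
Local Notation Z_p := (padic_int p_pr).
Local Notation Q_p := {fraction Z_p}.

Definition toQp (c : Z_p) : Q_p := FracField.tofrac c.

(* The Q_p-algebra Q_p[x]/(f), for f monic of positive degree. *)
Definition poly_alg (f : {poly Z_p}) := {poly %/ (map_poly toQp f)}.

(* An order is a subring that is a finitely generated Z_p-module spanning the
   algebra over Q_p. *)
Definition is_order (A : lalgType Q_p) (O : set A) : Prop :=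
  [/\ O 1,
      forall x y, O x -> O y -> O (x - y),
      forall x y, O x -> O y -> O (x * y) &
      exists m (s : 'I_m -> A),
        (forall x, O x <->
           exists c : 'I_m -> Z_p, x = \sum_(i < m) toQp (c i) *: s i) /\
        (forall x, exists c : 'I_m -> Q_p, x = \sum_(i < m) c i *: s i)].

Definition is_maximal_order (A : lalgType Q_p) (O : set A) : Prop :=
  is_order O /\ forall O' : set A, is_order O' -> O `<=` O' -> O' = O.

(* Z_p[x]/(f), as a subring of Q_p[x]/(f). *)
Definition monogenic_order (f : {poly Z_p}) : set (poly_alg f) :=
  [set in_qpoly (map_poly toQp f) (map_poly toQp g) | g in [set: {poly Z_p}]].

End Orders.

Section HaarDefinition.
Variables (p : nat) (p_pr : prime p).
Local Notation Z_p := (padic_int p_pr).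

(* Z_p^m with its Borel sigma-algebra. *)
Definition padic_space (m : nat) :=
  g_sigma_algebraType [set U : set 'rV[Z_p]_m | open U].

HB.instance Definition _ m := Measurable.on (padic_space m).

Definition is_haar (R : realType) (m : nat)
    (mu : probability (padic_space m) R) : Prop :=
  forall (a : 'rV[Z_p]_m) (A : set (padic_space m)), measurable A ->
    mu [set a + x | x in A] = mu A.

End HaarDefinition.

(** A Haar measure on Z_p^m: the image of the Lebesgue measure on [0, 1[ under
    the map given by base-p^m expansions. *)

Section HaarExistence.
Variables (p : nat) (p_pr : prime p) (m : nat).
Local Notation Z_p := (padic_int p_pr).
Implicit Types (x y a : 'rV[Z_p]_m) (U : set 'rV[Z_p]_m).

Definition vball x k : set 'rV[Z_p]_m :=
  [set y | forall j, residue (y 0 j) k = residue (x 0 j) k].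

Lemma open_padic_ball (z : Z_p) k : padic_open (padic_ball z k).
Proof. by move=> t zt; exists k => u; rewrite /padic_ball/= => ->. Qed.

Lemma open_vballP U : open U <-> forall x, U x -> exists k, vball x k `<=` U.
Proof.
rewrite openE; split=> UU x Ux.
  have [P Px PU] := UU _ Ux.
  have Pk j : exists k, padic_ball (x 0 j) k `<=` P 0 j.
    have := Px 0 j; rewrite nbhsE => -[B [Bo Bx] BP].
    have [k kB] := (Bo : padic_open B) _ Bx.
    by exists k; apply: subset_trans BP.
  have /choice[K KP] := Pk.
  exists (\max_j K j)%N => y xy; apply: PU => i j; rewrite ord1.
  apply: KP; apply: (@padic_ball_le _ _ _ _ (\max_j K j)%N).
    exact: (leq_bigmax j).
  exact: xy.
have [k kU] := UU _ Ux; exists (fun i j => padic_ball (x i j) k).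
  move=> i j; rewrite nbhsE; exists (padic_ball (x i j) k) => //.
  by split=> //; exact: open_padic_ball.
by move=> y /= xy; apply: kU => j; exact: xy.
Qed.

Lemma vball_le x k l : (k <= l)%N -> vball x l `<=` vball x k.
Proof. by move=> kl y xy j; exact: (padic_ball_le kl (xy j)). Qed.

Lemma vball_eq x y k : vball x k y -> vball x k = vball y k.
Proof.
by move=> xy; apply/seteqP; split=> z xz j; rewrite xz -?xy// xy.
Qed.

Lemma open_vball x k : open (vball x k).
Proof. by apply/open_vballP => y /vball_eq ->; exists k. Qed.

(* [digits k t j] is the j-th coordinate mod p^k of the vector encoded by the
   base-p^m digits of t, m base-p digits per base-p^m digit. *)
Local Notation q := (p ^ m)%N.
Fixpoint digits (k t : nat) (j : nat) : nat :=
  if k is k'.+1 then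
    (digits k' (t %/ q) j + ((t %/ p ^ j) %% p) * p ^ k')%N
  else 0%N.

Let p_gt0 : (0 < p)%N := prime_gt0 p_pr.
Let q_gt0 : (0 < q)%N. Proof. by rewrite expn_gt0 p_gt0. Qed.

Lemma digits_lt k t j : (digits k t j < p ^ k)%N.
Proof.
elim: k t => [|k IHk] t //=.
have := IHk (t %/ q)%N; have : ((t %/ p ^ j) %% p < p)%N by rewrite ltn_mod.
move: (_ %% p)%N (digits _ _ _) => a b ap bp.
rewrite expnS -[X in (_ < X * _)%N](prednK p_gt0) mulSn -addSn leq_add //.
by rewrite leq_mul2r -ltnS prednK // ap orbT.
Qed.

Lemma modn_digits n (t u : nat) :
  (forall j, (j < n)%N -> (t %/ p ^ j) %% p = (u %/ p ^ j) %% p)%N ->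
  (t = u %[mod p ^ n])%N.
Proof.
elim: n => [|n IHn] tu; first by rewrite !modn1.
have e s : (s %% p ^ n.+1 = (s %/ p ^ n) %% p * p ^ n + s %% p ^ n)%N.
  rewrite {1}(divn_eq s (p ^ n)) {1}(divn_eq (s %/ p ^ n) p) mulnDl -mulnA.
  rewrite -expnS -addnA modnMDl modn_small // expnS.
  rewrite -[X in (_ < X * _)%N](prednK p_gt0) mulSn addnC -addSn leq_add //.
    by rewrite ltn_mod expn_gt0 p_gt0.
  by rewrite leq_mul2r -ltnS prednK // ltn_mod p_gt0 orbT.
rewrite !e tu // IHn // => j jn; apply: tu; exact: ltnW.
Qed.

Lemma digits_inj k t u : (t < q ^ k)%N -> (u < q ^ k)%N ->
  (forall j, (j < m)%N -> digits k t j = digits k u j) -> t = u.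
Proof.
elim: k t u => [|k IHk] t u; first by rewrite expn0 !ltnS !leqn0 => /eqP-> /eqP->.
rewrite expnSr => tq uq tu.
have pk_gt0 : (0 < p ^ k)%N by rewrite expn_gt0 p_gt0.
have tq' : (t %/ q < q ^ k)%N by rewrite ltn_divLR.
have uq' : (u %/ q < q ^ k)%N by rewrite ltn_divLR.
have split j : (j < m)%N -> digits k (t %/ q) j = digits k (u %/ q) j /\
    ((t %/ p ^ j) %% p = (u %/ p ^ j) %% p)%N.
  move=> /tu /= eqd; split.
    have /(congr1 (fun z => (z %% p ^ k)%N)) := eqd.
    rewrite /= addnC modnMDl modn_small ?digits_lt //.
    by rewrite addnC modnMDl modn_small ?digits_lt.
  have /(congr1 (fun z => (z %/ p ^ k)%N)) := eqd.
  rewrite /= addnC divnMDl // (divn_small (digits_lt _ _ _)) addn0.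
  by rewrite addnC divnMDl // (divn_small (digits_lt _ _ _)) addn0.
have ediv : (t %/ q = u %/ q)%N.
  by apply: IHk => // j /split[].
rewrite (divn_eq t q) (divn_eq u q) ediv (@modn_digits m t u) //.
by move=> j /split[].
Qed.

Lemma digits_surj k y :
  exists2 t, (t < q ^ k)%N & forall j, residue (y 0 j) k = digits k t j.
Proof.
pose f (t : 'I_(q ^ k)) := [ffun j : 'I_m => Ordinal (digits_lt k t j)].
have finj : injective f.
  move=> t u /ffunP ftu; apply/val_inj.
  apply: (@digits_inj k _ _ (ltn_ord t) (ltn_ord u)) => j jm.
  by have := ftu (Ordinal jm); rewrite !ffunE => /(congr1 val).
have /inj_card_bij[|g _ gK] := finj.
  by rewrite card_ffun !card_ord -!expnM mulnC.
exists (g [ffun j => Ordinal (residue_lt (y 0 j) k)]) => // j.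
have /ffunP/(_ j) := gK [ffun j => Ordinal (residue_lt (y 0 j) k)].
by rewrite /f !ffunE => /(congr1 val) /= ->.
Qed.

Variable R : realType.
Implicit Types r : R.

Lemma truncn_div r : (Num.trunc (r * q%:R) %/ q)%N = Num.trunc r.
Proof.
have [r0|r0] := ltP r 0.
  have -> : Num.trunc r = 0%N.
    by apply/eqP; rewrite -leqn0 truncn_le_nat (lt_trans r0).
  rewrite (_ : Num.trunc _ = 0%N) ?div0n //.
  apply/eqP; rewrite -leqn0 truncn_le_nat (@lt_trans _ _ 0) //.
  by rewrite nmulr_rlt0 // ltr0n.
apply/esym/eqP; rewrite truncn_eq //.
have q0 : 0 < q%:R :> R by rewrite ltr0n.
have /truncn_itv/andP[l1 l2] : 0 <= r * q%:R by rewrite mulr_ge0.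
rewrite -(ler_pM2r q0) -(ltr_pM2r q0) -!natrM; apply/andP; split.
  by apply: le_trans l1; rewrite ler_nat leq_divM.
by apply: lt_le_trans l2 _; rewrite ler_nat ltn_ceil.
Qed.

Definition level k r : nat := Num.trunc (r * (q ^ k)%:R).

Lemma levelS k r : (level k.+1 r %/ q)%N = level k r.
Proof. by rewrite /level expnSr natrM mulrA truncn_div. Qed.

Lemma coherent r (j : 'I_m) k :
  (digits k (level k r) j = digits k.+1 (level k.+1 r) j %[mod p ^ k])%N.
Proof. by rewrite /= levelS addnC modnMDl. Qed.

Definition expansion r : padic_space p_pr m :=
  \row_j padic_of p_pr (coherent r j).

Lemma residue_expansion r j k :
  residue (expansion r 0 j) k = digits k (level k r) j.
Proof. by rewrite mxE /= modn_small // digits_lt. Qed.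

Lemma measurable_level k t : measurable [set r : R | level k r = t].
Proof.
have qk : 0 < (q ^ k)%:R :> R by rewrite ltr0n expn_gt0 q_gt0.
have le n : measurable [set r : R | (level k r <= n)%N].
  rewrite (_ : [set _ | _] = `]-oo, (n.+1%:R / (q ^ k)%:R)[%classic) //.
  by apply/seteqP; split=> r; rewrite /= in_itv/= /level truncn_le_nat
    ltr_pdivlMr.
case: t => [|t].
  by rewrite (_ : [set _ | _] = [set r : R | (level k r <= 0)%N]) //;
    apply/seteqP; split=> r /=; [move=> ->|rewrite leqn0 => /eqP].
rewrite (_ : [set _ | _] = [set r : R | (level k r <= t.+1)%N] `\`
    [set r : R | (level k r <= t)%N]); first exact: measurableD.
apply/seteqP; split=> r /=; first by move=> ->; rewrite leqnn ltnn.
by move=> [le1 /negP]; rewrite -ltnNge => le2; apply/eqP; rewrite eqn_leq le1.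
Qed.

Lemma measurable_expansion : measurable_fun [set: R] expansion.
Proof.
apply: (@measurability _ _ _ (padic_space p_pr m) [set: R] expansion
  [set U : set 'rV[Z_p]_m | open U]) => //.
move=> _ [U oU <-]; rewrite setTI.
pose B k t : set R := if `[< forall y,
  (forall j, residue (y 0 j) k = digits k t j) -> U y >]
  then [set r | level k r = t] else set0.
rewrite (_ : _ @^-1` _ = \bigcup_k \bigcup_t B k t).
  apply: bigcupT_measurable => k; apply: bigcupT_measurable => t.
  by rewrite /B; case: asboolP => _ //; exact: measurable_level.
apply/seteqP; split=> [r /= Ur|r [k _ [t _]]].
  have [k kU] := (open_vballP U).1 oU _ Ur.
  exists k => //; exists (level k r) => //; rewrite /B asboolT //.
  by move=> y yr; apply: kU => j; rewrite yr residue_expansion.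
rewrite /B; case: asboolP => // tU /= rt; apply: tU => j.
by rewrite residue_expansion rt.
Qed.

Let D : set R := `[0, 1[%classic.
Let mD : measurable D. Proof. exact: measurable_itv. Qed.

Definition haar0 (A : set (padic_space p_pr m)) : \bar R :=
  mrestr lebesgue_measure mD (expansion @^-1` A).

Let mexpansion A : measurable A -> measurable (expansion @^-1` A).
Proof. by move=> mA; rewrite -[X in measurable X]setTI; apply: measurable_expansion. Qed.

Let haar0_0 : haar0 set0 = 0%E.
Proof. by rewrite /haar0 preimage_set0 measure0. Qed.

Let haar0_ge0 A : (0 <= haar0 A)%E.
Proof. exact: measure_ge0. Qed.

Let haar0_sigma_additive : semi_sigma_additive haar0.
Proof.
move=> F mF tF mUF; rewrite /haar0 preimage_bigcup.
apply: measure_semi_sigma_additive.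
- by move=> n; exact: mexpansion.
- apply/trivIsetP => /= i j _ _ ij; rewrite -preimage_setI.
  by move/trivIsetP : tF => /(_ _ _ _ _ ij) ->//; rewrite preimage_set0.
- by rewrite -preimage_bigcup; exact: mexpansion.
Qed.

HB.instance Definition _ := isMeasure.Build _ _ _ haar0
  haar0_0 haar0_ge0 haar0_sigma_additive.

Lemma haar0_ball x k : haar0 (vball x k) = ((q ^ k)%:R^-1)%:E.
Proof.
have qk : 0 < (q ^ k)%:R :> R by rewrite ltr0n expn_gt0 q_gt0.
have [t tq xt] := digits_surj k x.
rewrite /haar0 /mrestr (_ : _ `&` _ =
    `[t%:R / (q ^ k)%:R, t.+1%:R / (q ^ k)%:R[%classic); last first.
  apply/seteqP; split=> r; rewrite /D /= !in_itv /= ler_pdivrMr// ltr_pdivlMr//.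
    move=> [xr /andP[r0 r1]].
    have lq : (level k r < q ^ k)%N.
      by rewrite truncn_lt_nat ?mulr_ge0// gtr_pMl.
    rewrite -truncn_eq ?mulr_ge0//; apply/eqP.
    apply: (@digits_inj k) => // j jm.
    by have := xr (Ordinal jm); rewrite residue_expansion xt.
  move=> tr; have /andP[t1 t2] := tr.
  have r0 : 0 <= r by rewrite -(pmulr_lge0 _ qk) (le_trans _ t1).
  split; last first.
    rewrite r0 -(ltr_pM2r qk) mul1r (lt_le_trans t2)//.
    by rewrite ler_nat.
  move=> j; rewrite residue_expansion xt; congr digits; apply/eqP.
  by rewrite truncn_eq // mulr_ge0.
rewrite lebesgue_measure_itv /= lte_fin ltr_pM2r ?invr_gt0// ltr_nat leqnn.
by rewrite -EFinB -mulrBl -natrB// subSnn mul1r.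
Qed.

Lemma vball0 x : vball x 0 = setT.
Proof.
apply/seteqP; split=> // y _ j.
have := residue_lt (y 0 j) 0; have := residue_lt (x 0 j) 0.
by rewrite expn0 !ltnS !leqn0 => /eqP-> /eqP->.
Qed.

Let haar0_setT : haar0 setT = 1%E.
Proof. by rewrite -(vball0 0) haar0_ball expn0 invr1. Qed.

HB.instance Definition _ := Measure_isProbability.Build _ _ _ haar0 haar0_setT.

Definition vballs : set (set (padic_space p_pr m)) :=
  [set A | A = set0 \/ exists x k, A = vball x k].

Lemma vballs_setI : setI_closed vballs.
Proof.
move=> A B [->|[x [k ->]]]; first by rewrite set0I; left.
move=> [->|[y [l ->]]]; first by rewrite setI0; left.
have [->|/set0P[z [xz yz]]] := eqVneq (vball x k `&` vball y l) set0.
  by left.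
right; rewrite (vball_eq xz) (vball_eq yz); exists z.
have [kl|/ltnW lk] := leqP k l.
  by exists l; rewrite setIC; apply/setIidl/vball_le.
by exists k; apply/setIidl/vball_le.
Qed.

Lemma measurable_vballs :
  @measurable _ (padic_space p_pr m) = <<s vballs >>.
Proof.
apply/seteqP; split.
  apply: smallest_sub; first exact: smallest_sigma_algebra.
  move=> U /= oU.
  pose B k (t : nat) : set 'rV[Z_p]_m :=
    [set y | vball y k `<=` U /\ forall j : 'I_m, residue (y 0 j) k = digits k t j].
  have -> : U = \bigcup_k \bigcup_t B k t.
    apply/seteqP; split=> [y Uy|y [k _ [t _ [yU _]]]]; last exact: yU.
    have [k yU] := (open_vballP U).1 oU _ Uy.
    have [t _ yt] := digits_surj k y.
    by exists k => //; exists t.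
  apply: sigma_algebra_bigcup => k; apply: sigma_algebra_bigcup => t.
  apply: sub_sigma_algebra.
  have [->|/set0P[y [yU yt]]] := eqVneq (B k t) set0; first by left.
  right; exists y, k; apply/seteqP; split=> z; first by move=> [_ zt] j; rewrite zt yt.
  move=> yz; split; first by rewrite -(vball_eq yz).
  by move=> j; rewrite yz yt.
apply: smallest_sub; first exact: smallest_sigma_algebra.
move=> _ [->|[x [k ->]]]; first exact: measurable0.
by apply: sub_sigma_algebra; exact: open_vball.
Qed.

Lemma translateE a (A : set 'rV[Z_p]_m) :
  [set a + x | x in A] = (fun y => y - a) @^-1` A.
Proof.
apply/seteqP; split=> [_ [x Ax <-]|y /= Ay]; first by rewrite /= addrC addKr.
by exists (y - a) => //; rewrite addrC subrK.
Qed.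


Lemma residue_subP (z t : Z_p) k :
  residue (z - t) k = 0%N <-> residue z k = residue t k.
Proof.
have H (u v w : Z_p) : residue u k = residue v k ->
    residue (u + w) k = residue (v + w) k by move=> /= ->.
split=> [zt|/(H _ _ (- t)) ->]; last by rewrite subrr /= mod0n.
have /(H _ _ t) : residue (z - t) k = residue (0 : Z_p) k by rewrite zt /= mod0n.
by rewrite subrK add0r.
Qed.

Lemma vball_translate x a k :
  (fun y => y - a) @^-1` vball x k = vball (x + a) k.
Proof.
apply/seteqP; split=> y /= yx j; apply/residue_subP.
  by have /residue_subP := yx j; rewrite !mxE opprD addrA addrAC.
by have /residue_subP := yx j; rewrite !mxE opprD addrA [y 0 j - _ - _]addrAC.
Qed.

Lemma measurable_translate a :
  measurable_fun [set: padic_space p_pr m]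
    ((fun y => y - a) : padic_space p_pr m -> padic_space p_pr m).
Proof.
apply: (@measurability _ _ _ (padic_space p_pr m) _ _ vballs).
  exact: measurable_vballs.
move=> _ [A vA <-]; rewrite setTI measurable_vballs; apply: sub_sigma_algebra.
case: vA => [->|[x [k ->]]]; first by rewrite preimage_set0; left.
by right; exists (x + a), k; exact: vball_translate.
Qed.

Lemma haar0_haar : is_haar haar0.
Proof.
move=> a A mA; rewrite translateE.
pose m2 : {measure set (padic_space p_pr m) -> \bar R} :=
  measure_function_pushforward__canonical__measure_function_Measure
    haar0 (measurable_translate a).
apply/esym; apply: (@measure_unique _ _ _ vballs (fun=> setT)
  measurable_vballs vballs_setI _ _ haar0 m2) => //.
- by move=> _; right; exists 0, 0%N; rewrite vball0.
- exact: bigcup_const.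
- move=> B vB; rewrite /m2 /= /pushforward.
  case: vB => [->|[x [k ->]]]; first by rewrite preimage_set0.
  by rewrite vball_translate !haar0_ball.
- by move=> _; rewrite [X in (X < _)%E]haar0_setT ltry.
Qed.

End HaarExistence.

Lemma haar_exists (R : realType) (p : nat) (p_pr : prime p) (m : nat) :
  exists mu : probability (padic_space p_pr m) R, is_haar mu.
Proof. by exists (haar0 R); exact: haar0_haar. Qed.


Section Density.
Variables (p : nat) (p_pr : prime p).
Local Notation Z_p := (padic_int p_pr).

(* V_n(Z_p)_{a_n = b} and V_n(Z_p)_{p does not divide a_n}; a_i is
   the coefficient of 'X^(n - i). *)
Definition V_fixed (n : nat) (b : Z_p) : set {poly Z_p} :=
  [set f | [/\ f \is monic, size f = n.+1 & f`_0 = b]].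

Definition V_unit (n : nat) : set {poly Z_p} :=
  [set f | [/\ f \is monic, size f = n.+1 & ~ padic_dvd p%:R f`_0]].

(* The identifications of V_n(Z_p)_{a_n = b} with Z_p^(n-1), and of V_n(Z_p)
   with Z_p^n, through the coefficients (a_1, a_2, ...). *)
Definition fixed_poly (n : nat) (b : Z_p) (a : 'rV[Z_p]_n.-1) : {poly Z_p} :=
  'X^n + \sum_(i < n.-1) a 0 i *: 'X^(n - i.+1) + b%:P.

Definition monic_poly (n : nat) (a : 'rV[Z_p]_n) : {poly Z_p} :=
  'X^n + \sum_(i < n) a 0 i *: 'X^(n - i.+1).

(* The density of [E] in [V], measured in the coordinates [chart]. *)
Definition density (R : realType) (m : nat)
    (mu : probability (padic_space p_pr m) R)
    (chart : 'rV[Z_p]_m -> {poly Z_p}) (V E : set {poly Z_p}) : R :=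
  fine (mu (chart @^-1` (V `&` E))) / fine (mu (chart @^-1` V)).

Definition sqf0_set : set {poly Z_p} := [set f | ~ padic_dvd p%:R (disc f)].
Definition sqf1_set : set {poly Z_p} := [set f | padic_val_eq (disc f) 1].
Definition max_set : set {poly Z_p} :=
  [set f | is_maximal_order (@monogenic_order _ p_pr f)].

End Density.

Arguments V_unit {p} p_pr n.
Arguments V_fixed {p p_pr} n b.
Arguments fixed_poly {p p_pr} n b a.
Arguments monic_poly {p} p_pr n a.
Arguments sqf0_set {p} p_pr.
Arguments sqf1_set {p} p_pr.
Arguments max_set {p} p_pr.

Definition legendre (p : nat) (a : 'F_p) : int :=
  if a == 0 then 0 else if [exists c : 'F_p, a == c ^+ 2] then 1 else -1.

(* The characters of F_p^* are the linear characters of the group {unit 'F_p};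
   the trivial one is 'chi_0.  As kappa is rational, [ratr (getCrat kappa)] is
   its value in any field of characteristic 0. *)
Definition kappa (n p : nat) (b : {unit 'F_p}) : algC :=
  (p%:R - 1)^-1 *
  \sum_(i : Iirr [set: {unit 'F_p}]%G | (i != 0) && ('chi_i \is a linear_char))
    ('chi_i b)^-1 * \sum_(c : {unit 'F_p}) 'chi_i c ^+ n.

(* Main.v *)
(** Write [f = f0 + p h] modulo [p^2], with digits [f0] and [h] over [F_p].  All
three conditions depend on the pair [(f0, h)] only:
- [p] does not divide [Disc f] iff [f0] is squarefree;
- by Dedekind's criterion, [Z_p[x]/(f)] is maximal iff [f] lies in no
  [(p, g)^2] with [g] irreducible over [F_p], that is, iff there is no [g] such
  that [g^2] divides [f0] and [g] divides [h + e], where [e] is determined by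
  [f0] and [g];
- modulo [p] the Sylvester matrix of [f] and [f'] has corank
  [deg (gcd f0 f0')], and [v_p (Disc f) = 1] iff [p] is odd,
  [f0 = (x + a)^2 m] with [m] squarefree and [m (- a) <> 0], and [f] is not in
  [(p, x + a)^2].
The densities are thus numbers of pairs [(f0, h)] with prescribed constant terms.

These are computed by Moebius inversion over the sets of irreducible
polynomials.  A monic [d] of degree [k] with [d(0) <> 0] divides the same number
[q^(m-1-k)] of monic polynomials of degree [m > k] for each nonzero constant
term; hence the sum of [mu d] over the monic [d] of degree [k > 0] with a given
nonzero constant term is [-1], and only the [d] with [d^2 = f0] see the constant
term [b] of [f0]: they contribute [- #{c | c^2 = b}].  For the double roots
[- a], removing the condition [m (- a) <> 0] one factor at a time leaves an
alternating sum of such counts, whose last term is [#{a | a^n = b}]. *)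

Require Import Defs.
From mathcomp Require Import all_boot all_order all_algebra all_fingroup.
From mathcomp Require Import all_solvable all_field all_character qpoly.
From mathcomp Require Import ring zify.

Set Implicit Arguments.
Unset Strict Implicit.
Unset Printing Implicit Defensive.

Import Order.TTheory GRing.Theory Num.Theory.
Local Open Scope ring_scope.

(** The counts are never evaluated completely. For each condition and every nonzero [b0], the number
    of pairs with constant terms [b0], [b1] has the form [C + w1 * root_count n b0 + w2 * root_count
    2 b0], where [C] is only shown to exist. Passing from [V] to [V'] averages over the nonzero
    [b0], and every root count has mean 1 there; so [C] cancels and only the centred counts remain.
    By orthogonality of characters [root_count n b0 - 1] is kappa, for odd [p] the number
    [root_count 2 b0 - 1] is the Legendre symbol, and both vanish when [p = 2]. The obstacle in the
    sieve for maximality is that the digit [e] depends on [g], so that being bad at two primes is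
    not visibly the same as being bad at their product. It is the same because the [e] of a product
    agrees, modulo each factor, with the [e] of that factor. Once [d] and [f0] are fixed, the
    condition on [h] is a single residue class modulo [d], and its size does not depend on [f0]. *)

Lemma sum_sign_subsets (T : finType) (A : {set T}) :
  \sum_(S : {set T} | S \subset A) (-1) ^+ #|S| = (A == set0)%:R :> int.
Proof.
(* Expanding this product by distributivity yields one signed term for each subset of [A]. *)
have -> : (A == set0)%:R = \prod_(i : T) ((- (i \in A)%:R) + 1) :> int.
  case: eqVneq => [->|/set0Pn[i iA]].
    by rewrite big1 // => i _; rewrite inE oppr0 add0r.
  by rewrite (bigD1 i) //= iA addNr mul0r.
rewrite bigA_distr big_mkcond; apply: eq_bigr => S _.
rewrite (bigID (mem S)) /= [X in _ * X]big1 ?mulr1; last first.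
  by move=> i /negbTE ->.
under eq_bigr => i iS do rewrite iS.
case: ifPn => [/subsetP SA|/subsetPn[i iS iA]].
  rewrite (eq_bigr (fun=> -1)) ?prodr_const // => i iS.
  by rewrite (SA i iS).
by rewrite (bigD1 i) //= (negbTE iA) oppr0 mul0r.
Qed.

Lemma card_bij (T T' : finType) (P : pred T) (P' : pred T')
    (f : T -> T') (g : T' -> T) :
  (forall x, P x -> P' (f x) /\ g (f x) = x) ->
  (forall y, P' y -> P (g y) /\ f (g y) = y) -> #|P| = #|P'|.
Proof.
move=> fP gP; rewrite -(card_in_imset (f := f) (D := P)); last first.
  by move=> x y /fP[_ xK] /fP[_ yK] xy; rewrite -xK -yK xy.
apply: eq_card => y; apply/imsetP/idP => [[x /fP[Px _] -> //]|/gP[Py yK]].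
by exists (g y).
Qed.

(** * Counting polynomials over a finite field *)

Section Counting.
Variables (F : finFieldType) (N : nat).
Local Notation B := {poly_N F}.
Local Notation q := #|F|.

(** As [d] has nonzero constant term it is coprime to ['X], so the two conditions form one residue
    class modulo ['X * d], of degree [k.+1 <= m]. Its elements of size at most [m] are
    [r + 'X * d * v] with [v] of size at most [m.-1 - k]. *)
Lemma count_cong (m k : nat) (d e : {poly F}) (c : F) :
  (k < m)%N -> (m <= N)%N -> size d = k.+1 -> d`_0 != 0 ->
  #|[pred h : B | [&& (size h <= m)%N, h`_0 == c & d %| (h : {poly F}) + e]]| = (q ^
    (m.-1 - k))%N.
Proof.
move=> km mN sd d0.
have dn0 : d != 0 by apply: contraNneq d0 => ->; rewrite coef0.
pose e' : {poly F} := (- e) %% d.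
have se' : (size e' <= k)%N by rewrite -ltnS -sd ltn_modp.
(* The remainder [e'] satisfies the congruence; adding a multiple of [d] corrects its constant
   term. *)
pose r : {poly F} := e' + ((c - e'`_0) / d`_0) *: d.
have r0 : r`_0 = c by rewrite coefD coefZ divfK // addrC subrK.
have sr : (size r <= k.+1)%N.
  apply: leq_trans (size_polyD _ _) _; rewrite geq_max (leqW se') /=.
  by apply: leq_trans (size_scale_leq _ _) _; rewrite sd.
have dr : d %| r + e.
  rewrite /r addrAC; apply: dvdp_add; last by rewrite -mul_polyC dvdp_mull.
  have E : - e = (- e) %/ d * d + e' by exact: divp_eq.
  have -> : e = - ((- e) %/ d * d + e') by rewrite -E opprK.
  rewrite addrC opprD -addrA addNr addr0 -mulNr; exact: dvdp_mull.
have Xd : coprimep 'X d.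
  by rewrite coprimep_sym coprimepX /root horner_coef0.
have sXd : size ('X * d) = k.+2 by rewrite mulrC size_mulX // sd.
have Xdn0 : 'X * d != 0 by rewrite mulf_neq0 // polyX_eq0.
have szv (v : {poly_(m.-1 - k) F}) : (size (r + 'X * d * v)%R <= m)%N.
  apply: leq_trans (size_polyD _ _) _; rewrite geq_max (leq_trans sr) //=.
  apply: leq_trans (size_polyMleq _ _) _; rewrite sXd.
  have := size_npoly v; move: (size v) => s; lia.
pose phi (v : {poly_(m.-1 - k) F}) : B := npolyp N (r + 'X * d * v).
have phiE v : phi v = r + 'X * d * v :> {poly F}.
  by rewrite /phi /= npolypK // (leq_trans (szv v)).
have phi_inj : injective phi.
  move=> v w /(congr1 (@polyn _ _)); rewrite !phiE => /addrI /(mulfI Xdn0) vw.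
  exact/val_inj.
rewrite -card_npoly -(card_codom phi_inj); apply: eq_card => h.
rewrite inE; apply/and3P/codomP => [[sh /eqP h0 dh]|[v ->]]; last first.
  rewrite phiE szv; split=> //.
    by rewrite coefD r0 -mulrA coefXM /= addr0.
  by rewrite addrAC dvdp_add // -mulrA dvdp_mull // dvdp_mulr.
have : 'X * d %| (h : {poly F}) - r.
  rewrite Gauss_dvdp //; apply/andP; split.
    by rewrite -[X in X %| _]subr0 -polyC0 dvdp_XsubCl /root horner_coef0 coefB h0 r0
      subrr.
  have -> : (h : {poly F}) - r = ((h : {poly F}) + e) - (r + e) by ring.
  by rewrite dvdp_sub.
move=> /dvdpP[v vE]; have sv : (size v <= m.-1 - k)%N.
  have [->|v0] := eqVneq v 0; first by rewrite size_poly0.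
  have : (size (v * ('X * d))%R <= m)%N.
    rewrite -vE (leq_trans (size_polyD _ _)) // geq_max sh size_polyN.
    exact: leq_trans sr _.
  rewrite size_mul // sXd; move: (size v) => s; lia.
exists (NPoly sv); apply: val_inj; rewrite /= phiE /= mulrC -vE.
by rewrite addrC subrK.
Qed.

Definition npoly_count (P : pred {poly F}) : nat :=
  #|[pred f : B | P (f : {poly F})]|.

Lemma eq_count (P P' : pred {poly F}) :
  (forall f : {poly F}, (size f <= N)%N -> P f = P' f) -> npoly_count P = npoly_count P'.
Proof. by move=> PP'; apply: eq_card => f; rewrite !inE PP' ?size_npoly. Qed.

Lemma count_bij (P P' : pred {poly F}) (f g : {poly F} -> {poly F}) :
  (forall x : {poly F}, P x -> (size x <= N)%N -> [/\ P' (f x), (size (f x) <= N)%N & g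
    (f x) = x]) ->
  (forall x : {poly F}, P' x -> (size x <= N)%N -> [/\ P (g x), (size (g x) <= N)%N & f
    (g x) = x]) ->
  npoly_count P = npoly_count P'.
Proof.
move=> fP gP; apply: (card_bij (f := fun x : B => npolyp N (f x))
  (g := fun x : B => npolyp N (g x))) => x; rewrite /= ?inE.
  move=> /fP/(_ (size_npoly _))[Pf sf gf]; split; first by rewrite ?inE /= npolypK.
  by apply: val_inj; rewrite /= !npolypK // gf // size_npoly.
move=> /gP/(_ (size_npoly _))[Pf sf gf]; split; first by rewrite ?inE /= npolypK.
by apply: val_inj; rewrite /= !npolypK // gf // size_npoly.
Qed.

Definition mon (m : nat) (c : F) : pred {poly F} :=
  fun f => [&& f \is monic, size f == m.+1 & f`_0 == c].

Lemma dvd_coef0 (d f : {poly F}) : d %| f -> d`_0 = 0 -> f`_0 = 0.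
Proof. by move=> /dvdpP[g ->] d0; rewrite coef0M d0 mulr0. Qed.

(** For [k < m], removing the leading term of [f] leaves a solution of the congruence of
    [count_cong] with [e = 'X^m]. For [k = m] the only candidate is [d] itself, and this is the one
    case where [c] and the constant term of [d] are compared. *)
Lemma count_mon_dvd (m : nat) (c : F) (d : {poly F}) :
  c != 0 -> d \is monic -> (m < N)%N -> let k := (size d).-1 in
  npoly_count (fun f => mon m c f && (d %| f)) =
    ((d`_0 != 0)%R * (if (k < m)%N then q ^ (m.-1 - k)
                    else (k == m) && (d`_0 == c)%R))%N.
Proof.
move=> c0 dm mN k; have sd : size d = k.+1.
  by rewrite prednK // lt0n size_poly_eq0 monic_neq0.
have [d0|d0] := eqVneq; first rewrite mul0n.
  apply: eq_card0 => f; rewrite !inE; apply/negP => /andP[/and3P[_ _ f0]].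
  by move=> /dvd_coef0/(_ d0); rewrite (eqP f0) => /eqP; rewrite (negbTE c0).
rewrite mul1n; case: ltnP => km.
  rewrite -(count_cong 'X^m c km (ltnW mN) sd d0).
  apply: (@count_bij _ (fun h => [&& (size h <= m)%N, h`_0 == c & d %| h + 'X^m])
    (fun f => f - 'X^m) (fun h => h + 'X^m)).
    move=> f /andP[/and3P[fm /eqP sf /eqP f0] df] _.
    have sfm : (size (f - 'X^m)%R <= m)%N.
      apply/leq_sizeP => j; rewrite leq_eqVlt => /predU1P[<-|mj].
        rewrite coefB coefXn eqxx; move: fm; rewrite monicE lead_coefE sf => /eqP ->.
        by rewrite subrr.
      by rewrite coefB coefXn gtn_eqF // subr0 nth_default // sf.
    rewrite subrK df sfm (leq_trans sfm (ltnW mN)) coefB coefXn.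
    by rewrite -(ltn_predK km) // f0 subr0 eqxx.
  move=> h /and3P[sh h0 dh] _; rewrite addrK dh /mon monicE lead_coefE.
  have shm : size (h + 'X^m) = m.+1.
    by rewrite addrC size_polyDl size_polyXn // ltnS.
  rewrite shm eqxx mN coefD coefXn eqxx nth_default // add0r eqxx.
  by rewrite coefD coefXn -(ltn_predK km) // (eqP h0) addr0 eqxx.
rewrite leq_eqVlt eq_sym in km; have [kE|km'] := eqVneq k m; last first.
  move: km; rewrite (negbTE km') /= => km.
  apply: eq_card0 => f; rewrite !inE; apply/negP => /andP[/and3P[fm sf _]].
  move=> /dvdp_leq; rewrite monic_neq0 // (eqP sf) sd ltnS leqNgt km.
  by move=> /(_ isT).
have sdN : (size d <= N)%N by rewrite sd kE.
have eqd (f : {poly F}) : mon m c f -> d %| f -> f = d.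
  move=> /and3P[fm /eqP sf _] df; apply/esym/eqP; rewrite -eqp_monic //.
  by rewrite -dvdp_size_eqp // sf sd kE.
rewrite /=; have [dc|dc] := eqVneq.
  rewrite -[RHS](@card1 B (npolyp N d)); apply: eq_card => f; rewrite !inE.
  apply/andP/eqP => [[fm /(eqd _ fm) fd]|->]; last first.
    by rewrite npolypK // /mon dm dvdpp sd kE dc !eqxx.
  by apply: val_inj; rewrite /= npolypK.
apply: eq_card0 => f; rewrite !inE; apply/negP => /andP[fm /(eqd _ fm) fd].
by case/and3P: fm => _ _; rewrite fd (negbTE dc).
Qed.

(** * The Moebius sieve over sets of irreducible polynomials *)

Definition monic_irr : {set B} :=
  [set g : B | ((g : {poly F}) \is monic) && irreducibleb g].

(** Sets of primes encode squarefree monic polynomials, with [(-1) ^+ #|S|] as the Moebius function.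
    The product may exceed the size bound [N] of its factors, hence the type [{poly F}]. *)
Definition prodp (S : {set B}) : {poly F} := \prod_(g in S) (g : {poly F}).

Lemma prodp_monic (S : {set B}) : S \subset monic_irr -> prodp S \is monic.
Proof.
move=> /subsetP SI; apply: monic_prod => g /SI.
by rewrite inE => /andP[].
Qed.

Lemma monic_irr_coprime (g h : B) :
  g \in monic_irr -> h \in monic_irr -> g != h -> coprimep g h.
Proof.
rewrite !inE => /andP[gm /irreducibleP gi] /andP[hm /irreducibleP hi] gh.
rewrite irreducible_poly_coprime //; apply: contra gh => gdh.
rewrite -val_eqE /= -eqp_monic //; apply: hi.2 gdh.
by rewrite neq_ltn gi.1 orbT.
Qed.

(** This is what allows a condition imposed at each prime of a set to be tested once, on their
    product. *)
Definition coprime_mult (P : pred {poly F}) :=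
  P 1 /\ forall d e, d \is monic -> e \is monic -> coprimep d e ->
    P (d * e) = P d && P e.

Lemma prodp_mult (P : pred {poly F}) (S : {set B}) : coprime_mult P ->
  S \subset monic_irr -> P (prodp S) = (S \subset [set g : B | P g]).
Proof.
move=> [P1 PM]; have [n] := ubnP #|S|; elim: n S => // n IHn S.
have [->|[g gS]] := set_0Vmem S; first by rewrite /prodp big_set0 !sub0set P1.
rewrite (cardsD1 g) gS ltnS => /IHn; rewrite -[in X in _ -> X](setD1K gS).
have {gS} : g \notin S :\ g by rewrite !inE eqxx.
move: (S :\ g) => {n IHn}S gS IH.
rewrite subUset sub1set => /andP[gI SI].
rewrite /prodp big_setU1 //= -/(prodp S) PM ?prodp_monic //.
- by rewrite IH // subUset sub1set inE.
- by move: gI; rewrite inE => /andP[].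
- apply: (big_ind (fun d : {poly F} => coprimep g d)) => [|x y gx gy|h hS].
  + exact: coprimep1.
  + by rewrite coprimepMr gx.
  + apply: monic_irr_coprime => //; first exact: (subsetP SI).
    by apply: contraNneq gS => ->.
Qed.

(** For a fixed [x] the sets [S] that contribute are the subsets of the set of bad primes of [x],
    and their signs cancel unless that set is empty. The type [T] is general because the sieve is
    applied to polynomials and to pairs of them. *)
Lemma inclusion_exclusion (T : finType) (A : pred T) (bad : T -> pred {poly F}) :
  (forall x, A x -> coprime_mult (bad x)) ->
  (#|[pred x | A x && [forall g in monic_irr, ~~ bad x (g : B)]]|)%:R =
  \sum_(S : {set B} | S \subset monic_irr)
     (-1) ^+ #|S| * #|[pred x | A x && bad x (prodp S)]|%:R :> int.
Proof.
move=> badM.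
have cardE (P : pred T) : #|[pred x | A x && P x]|%:R = \sum_(x | A x) (P x)%:R :> int.
  by rewrite -sum1_card natr_sum big_mkcondr; apply: eq_bigr => x _; case: (P x).
rewrite cardE; under [RHS]eq_bigr => S _ do rewrite cardE mulr_sumr.
rewrite exchange_big; apply: eq_bigr => x Ax /=.
pose Bd := [set g in monic_irr | bad x (g : B)].
transitivity ((Bd == set0)%:R : int).
  congr (_%:R); congr nat_of_bool; apply/forall_inP/eqP => [nb|B0 g gI].
    by apply/setP => g; rewrite !inE; apply/negP => /andP[gI]; apply/negP/nb; rewrite inE.
  by apply/negP => bg; have := in_set0 g; rewrite -B0 inE gI bg.
rewrite -sum_sign_subsets big_mkcond [RHS]big_mkcond /=; apply: eq_bigr => S _.
have -> : (S \subset Bd) = (S \subset monic_irr) && (S \subset [set g : B | bad x g]).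
  rewrite -subsetI (_ : Bd = monic_irr :&: [set g : B | bad x g]) //.
  by apply/setP => g; rewrite !inE.
have [SI|] := boolP (S \subset monic_irr) => //=.
rewrite (prodp_mult (badM x Ax) SI).
by case: ifP; rewrite ?mulr1 ?mulr0.
Qed.

(* The sum of [mu d] over the monic [d] of degree [k] with [d(0) = c]: a
   squarefree [d] is the product of a set [S] of irreducible polynomials. *)
Definition mob (k : nat) (c : F) : int :=
  \sum_(S : {set B} | [&& S \subset monic_irr, size (prodp S) == k.+1 &
     (prodp S)`_0 == c]) (-1) ^+ #|S|.

Lemma coprime_mult_dvd (f : {poly F}) : coprime_mult (fun d => d %| f).
Proof. by split=> [|d e _ _ de]; rewrite ?dvd1p // Gauss_dvdp. Qed.

Lemma coprime_mult_sqr_dvd (f : {poly F}) : coprime_mult (fun d => d ^+ 2 %| f).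
Proof.
split=> [|d e _ _ de]; first by rewrite expr1n dvd1p.
by rewrite exprMn Gauss_dvdp // coprimep_expl // coprimep_expr.
Qed.

(** A nonconstant divisor of least size, made monic, is irreducible. *)
Lemma exists_monic_irr_dvd (f : {poly F}) :
  (1 < size f <= N)%N -> exists2 g : B, g \in monic_irr & (g : {poly F}) %| f.
Proof.
move=> /andP[sf fN]; pose P (g : B) := (1 < size g)%N && ((g : {poly F}) %| f).
have Pf : P (npolyp N f) by rewrite /P /= npolypK // sf dvdpp.
case: (arg_minnP (fun g : B => size g) Pf) => g /andP[sg gf] gmin.
have g0 : (g : {poly F}) != 0 by rewrite -size_poly_gt0 ltnW.
have lg0 : (lead_coef g)^-1 != 0 by rewrite invr_eq0 lead_coef_eq0.
have sgN : (size ((lead_coef g)^-1 *: (g : {poly F}))%R <= N)%N.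
  by rewrite size_scale // size_npoly.
exists (npolyp N ((lead_coef g)^-1 *: (g : {poly F}))); last by rewrite npolypK // dvdpZl.
rewrite inE npolypK // monicE lead_coefZ mulVf ?lead_coef_eq0 // eqxx /=.
apply/irreducibleP; split; first by rewrite size_scale.
move=> d d1; rewrite dvdpZr // => dg; apply: eqp_trans (_ : d %= g) _; last first.
  by rewrite eqp_sym eqp_scale.
have d0 : d != 0 by apply: contraTneq dg => ->; rewrite dvd0p.
have sdg : (size d <= size g)%N by rewrite dvdp_leq.
have sdN : (size d <= N)%N by rewrite (leq_trans sdg) // size_npoly.
rewrite -dvdp_size_eqp // eqn_leq sdg /=; have := gmin (npolyp N d).
rewrite /P npolypK //; apply; rewrite (dvdp_trans dg) // andbT.
by rewrite ltn_neqAle eq_sym d1 size_poly_gt0.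
Qed.

Lemma size_prodp_eq1 (S : {set B}) : S \subset monic_irr ->
  (size (prodp S) == 1%N) = (S == set0).
Proof.
move=> SI; have [->|[g gS]] := set_0Vmem S.
  by rewrite /prodp big_set0 size_poly1 !eqxx.
have -> : (S == set0) = false by apply/negbTE/set0Pn; exists g.
have := subsetP SI g gS; rewrite inE => /andP[_ /irreducibleP[sg _]].
apply: gtn_eqF; apply: leq_trans sg _; apply: dvdp_leq.
  exact/monic_neq0/prodp_monic.
by rewrite /prodp (big_setD1 g) //= dvdp_mulr.
Qed.

Let deg (S : {set B}) := (size (prodp S)).-1.

Lemma size_prodp (S : {set B}) (k : nat) : S \subset monic_irr ->
  (size (prodp S) == k.+1) = (deg S == k).
Proof.
move=> SI; rewrite /deg; have := monic_neq0 (prodp_monic SI).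
by rewrite -size_poly_gt0; case: (size _).
Qed.

Lemma sum_mob (k : nat) :
  \sum_(c | c != 0) mob k c = \sum_(S : {set B} | [&& S \subset monic_irr,
     (prodp S)`_0 != 0 & deg S == k]) (-1) ^+ #|S|.
Proof.
rewrite [RHS](partition_big (fun S => (prodp S)`_0) (fun c => c != 0)) /=; last first.
  by move=> S /and3P[].
apply: eq_bigr => c c0; apply: eq_bigl => S.
have [SI /=|//] := boolP (S \subset _); rewrite size_prodp //.
have [->|] := eqVneq (prodp S)`_0 c; last by rewrite !andbF.
by rewrite c0 !andbT.
Qed.

(** No monic polynomial of degree [k > 0] survives the sieve by all its prime divisors; isolating
    the divisors of full degree gives [mob k b = - U k], the same for all nonzero [b]. Raising the
    degree bound gives [U k.+1 = q * U k + \sum_b mob k b = q * U k - (q - 1) * U k = U k], so [U]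
    keeps its first value [U 1 = 1]. *)
Lemma mob_eq (m : nat) (c : F) : c != 0 -> (0 < m < N)%N -> mob m c = -1.
Proof.
pose U m : int := \sum_(S : {set B} | [&& S \subset monic_irr, (prodp S)`_0 != 0 &
   (deg S < m)%N]) (-1) ^+ #|S| * (q ^ (m.-1 - deg S))%N%:R.
have mobU k b : b != 0 -> (0 < k < N)%N -> mob k b = - U k.
  move=> b0 /andP[k0 kN]; apply/eqP; rewrite -addr_eq0 addrC; apply/eqP.
  have := @inclusion_exclusion B (fun f : B => mon k b f) (fun (f : B) d => d %| f)
    (fun f _ => coprime_mult_dvd f).
  rewrite eq_card0; last first.
    move=> f; rewrite !inE; apply/negP => /andP[/and3P[_ /eqP sf _]] /forall_inP fI.
    have [|g gI gf] := @exists_monic_irr_dvd f; first by rewrite sf ltnS k0.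
    by have := fI g gI; rewrite gf.
  move=> E; rewrite -[RHS]/(0%:R) E /U /mob big_mkcond [X in _ + X]big_mkcond
    -big_split [RHS]big_mkcond /=.
  apply: eq_bigr => S _; have [SI /=|] := boolP (S \subset _); last by rewrite addr0.
  have /= := count_mon_dvd b0 (prodp_monic SI) kN; rewrite /npoly_count /= => ->.
  rewrite size_prodp // -/(deg S); have [->|d0 /=] := eqVneq.
    by rewrite mul0n mulr0 [0 == b]eq_sym (negbTE b0) andbF addr0.
  rewrite mul1n; case: ltngtP => //= _; rewrite ?addr0 ?add0r ?mulr0 //.
  by case: eqP; rewrite ?mulr1 ?mulr0.
have US k : U k.+1 = q%:R * U k + \sum_(b | b != 0) mob k b.
  rewrite sum_mob /U mulr_sumr big_mkcond [X in X + _]big_mkcond [X in _ + X]big_mkcond.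
  rewrite -big_split /=; apply: eq_bigr => S _.
  have [SI /=|] := boolP (S \subset _); last by rewrite addr0.
  have [//|d0 /=] := eqVneq; rewrite ?addr0 // ltnS.
  case: ltngtP => kS; rewrite ?addr0 //; last by rewrite kS subnn add0r mulr1.
  rewrite mulrCA -natrM -expnS; congr (_ * (_ ^ _)%:R).
  by rewrite -subSn ?prednK //; lia.
have U1 : U 1%N = 1.
  rewrite US sum_mob [U 0%N]big_pred0 ?mulr0 ?add0r; last by move=> S; rewrite !andbF.
  have deg0 (S : {set B}) : [&& S \subset monic_irr, (prodp S)`_0 != 0 & deg S == 0%N]
    = (S == set0).
    rewrite /deg; have [->|S0] := eqVneq S set0.
      by rewrite sub0set /prodp big_set0 coef1 size_poly1 oner_neq0.
    apply/negP => /and3P[SI _]; rewrite -(@size_prodp S 0%N) // size_prodp_eq1 //.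
    by rewrite (negbTE S0).
  by rewrite (eq_bigl _ _ deg0) big_pred1_eq cards0.
have Uc k : (0 < k <= N)%N -> U k = 1.
  elim: k => // -[|k] IHk kN; first exact: U1.
  have UkE : U k.+1 = 1 by apply: IHk; exact: ltnW.
  rewrite US UkE (eq_bigr (fun=> -1)) => [|b b0]; last by rewrite mobU // UkE.
  rewrite sumr_const mulr1 (cardC1 (0 : F)) mulNrn -subn1.
  by rewrite natrB ?(ltnW (finNzRing_gt1 F)) // opprB addrC subrK.
move=> c0 mN; by rewrite mobU // Uc //; case/andP: mN => -> /ltnW.
Qed.

Definition root_count (j : nat) (b : F) : nat := #|[pred c : F | (c != 0) && (c ^+ j ==
  b)]|.

(** Only the sets with [2 * deg S = n] see [c]. Grouped by the constant term [x] of their product, a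
    square root of [c], they contribute [mob n./2 x = -1] for each [x], times [w']. *)
Lemma weighted_mob (n : nat) (w : nat -> int) (w' : int) :
  (0 < n)%N -> (n./2 < N)%N -> exists C : int, forall c, c != 0 ->
  \sum_(S : {set B} | S \subset monic_irr) (-1) ^+ #|S| *
    (((prodp S)`_0 != 0)%:R * (if (2 * deg S < n)%N then w (deg S)
      else w' * ((2 * deg S == n)%N && ((prodp S)`_0 ^+ 2 == c))%:R)) =
  C - (~~ odd n)%:R * w' * (root_count 2 c)%:R.
Proof.
move=> n0 nN.
exists (\sum_(S : {set B} | [&& S \subset monic_irr, (prodp S)`_0 != 0 & (2 * deg S <
  n)%N])
  (-1) ^+ #|S| * w (deg S)) => c c0.
have -> : - ((~~ odd n)%:R * w' * (root_count 2 c)%:R) =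
   \sum_(S : {set B} | [&& S \subset monic_irr, (prodp S)`_0 != 0 &
       (2 * deg S == n)%N && ((prodp S)`_0 ^+ 2 == c)]) (-1) ^+ #|S| * w'.
  have [on|en] := boolP (odd n).
    rewrite /= !mul0r oppr0 big_pred0 // => S.
    rewrite [(_ * _ == _)%N](_ : _ = false) ?andbF //.
    by apply: contraTF on => /eqP <-; rewrite oddM.
  have nE : n = (2 * n./2)%N by rewrite mul2n even_halfK.
  rewrite mul1r -mulr_suml mulrC -mulNr; congr (_ * _).
  rewrite (partition_big (fun S => (prodp S)`_0) (fun x => (x != 0) && (x ^+ 2 == c)))
    /=; last first.
    by move=> S /and4P[_ -> _ ->].
  rewrite /root_count -sum1_card natr_sum -sumrN; apply: eq_big => [x|x /andP[x0 xc]].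
    by rewrite inE.
  rewrite -[LHS](@mob_eq n./2 x) //; last by rewrite nN; case: (n) n0 en => // -[].
  apply: eq_bigl => S; have [SI /=|//] := boolP (S \subset _).
  rewrite size_prodp // [in RHS]nE eqn_pmul2l //; have [->|] := eqVneq (prodp S)`_0 x;
    last by rewrite !andbF.
  by rewrite x0 xc !andbT.
rewrite big_mkcond [X in _ = X + _]big_mkcond [X in _ = _ + X]big_mkcond -big_split /=.
apply: eq_bigr => S _; have [SI /=|] := boolP (S \subset _); last by rewrite addr0.
have [_|d0 /=] := eqVneq; first by rewrite mul0r mulr0 addr0.
rewrite mul1r; case: ltngtP => _ /=; rewrite ?addr0 ?mulr0 // add0r.
by case: eqP; rewrite ?mulr1 ?mulr0.
Qed.

Definition sqfree (f : {poly F}) : bool :=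
  [forall g in monic_irr, ~~ ((g : {poly F}) ^+ 2 %| f)].

(** The bad primes are those whose square divides [f]. The sieve thus runs over the squares of the
    [prodp S], which doubles the degree and squares the constant term; hence the square roots of
    [c]. *)
Lemma count_sqfree (n : nat) : (0 < n < N)%N -> exists C : int, forall c, c != 0 ->
  (npoly_count (fun f => mon n c f && sqfree f))%:R = C - (~~ odd n)%:R * (root_count 2
    c)%:R.
Proof.
move=> /andP[n0 nN].
have [|C HC] := @weighted_mob n (fun k => (q ^ (n.-1 - 2 * k))%N%:R) 1 n0.
  by apply: leq_ltn_trans nN; rewrite -divn2 leq_div.
exists C => c c0; rewrite -[X in _ - X * _]mulr1 -HC //.
rewrite (@inclusion_exclusion B (fun f : B => mon n c f) (fun (f : B) d => d ^+ 2 %|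
  f)); last first.
  by move=> f _; exact: coprime_mult_sqr_dvd.
apply: eq_bigr => S SI; congr (_ * _).
have dm := prodp_monic SI; have d2m := monic_exp 2 dm.
have /= := count_mon_dvd c0 d2m nN; rewrite /npoly_count /= => ->.
have -> : (size (prodp S ^+ 2)%R).-1 = (2 * deg S)%N by rewrite size_exp mulnC.
have -> : (prodp S ^+ 2)`_0 = (prodp S)`_0 ^+ 2 by rewrite !expr2 coef0M.
rewrite expf_eq0 /= mul1r natrM; congr (_ * _).
by case: ltngtP.
Qed.

(** For each [f] the digit [h] runs through one residue class modulo [d], of the same size for all
    [f], so the number of pairs is a product of two counts. *)
Lemma count_pairs (n k : nat) (d : {poly F}) (e : {poly F} -> {poly F}) (b0 b1 : F) :
  b0 != 0 -> (0 < n < N)%N -> d \is monic -> (size d).-1 = k ->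
  #|[pred x : B * B | [&& mon n b0 x.1, (size x.2 <= n)%N, (x.2 : {poly F})`_0 == b1,
       d ^+ 2 %| (x.1 : {poly F}) & d %| (x.2 : {poly F}) + e x.1]]| =
  ((d`_0 != 0)%R * (if (2 * k < n)%N then q ^ (n.-1 - 2 * k) * q ^ (n.-1 - k)
                    else q ^ (n.-1 - k) * ((2 * k == n) && (d`_0 ^+ 2 == b0)%R)))%N.
Proof.
move=> b00 /andP[n0 nN] dm dk.
have sd : size d = k.+1 by rewrite -dk prednK // lt0n size_poly_eq0 monic_neq0.
have /= Hc := count_mon_dvd b00 (monic_exp 2 dm) nN.
have s2 : (size (d ^+ 2)%R).-1 = (2 * k)%N by rewrite size_exp dk mulnC.
have d20 : (d ^+ 2)`_0 = d`_0 ^+ 2 by rewrite !expr2 coef0M.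
rewrite s2 d20 expf_eq0 /= in Hc.
transitivity (\sum_(f : B | mon n b0 f && (d ^+ 2 %| (f : {poly F}))%R)
    ((d`_0 != 0)%R * q ^ (n.-1 - k)))%N.
  rewrite -sum1_card.
  rewrite (eq_bigl (fun x : B * B => (mon n b0 x.1 && (d ^+ 2 %| (x.1 : {poly F}))) &&
     [&& (size x.2 <= n)%N, (x.2 : {poly F})`_0 == b1 & d %| (x.2 : {poly F}) + e
       x.1])); last first.
    by move=> x; rewrite inE; do !case: (_ %| _); rewrite ?andbF ?andbT //= ?andbA.
  rewrite -(pair_big_dep (fun f : B => mon n b0 f && (d ^+ 2 %| (f : {poly F})))
    (fun (f h : B) => [&& (size h <= n)%N, (h : {poly F})`_0 == b1 & d %| (h : {poly
      F}) + e f]) (fun _ _ => 1%N)) /=.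
  apply: eq_bigr => f /andP[/and3P[fm /eqP sf /eqP f0] df].
  have d0 : d`_0 != 0.
    by apply: contraNneq b00 => d0; rewrite -f0 (dvd_coef0 df) // d20 d0 expr0n.
  rewrite d0 mul1n sum1_card -(@count_cong n k d (e f) b1) //; last exact: ltnW.
  (* As [d ^+ 2] divides [f], one has [2 * k <= n], hence [k < n] as [count_cong] requires. *)
  have := dvdp_leq (monic_neq0 fm) df; rewrite sf -(prednK (n := size (d ^+ 2)%R)) ?s2;
    last first.
    by rewrite lt0n size_poly_eq0 monic_neq0 // monic_exp.
  by rewrite ltnS; lia.
rewrite sum_nat_const [#|_|]Hc; case: (_ != 0); rewrite ?mul0n // !mul1n.
by case: ifP => // _; rewrite mulnC.
Qed.

(** The hypothesis on [e] makes the condition at [d] multiplicative for coprime factors although [e]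
    varies with [d]. At [2 * k = n] the first factor of [count_pairs] is at most one polynomial,
    which leaves the weight [q ^ (n.-1 - n./2)]. *)
Lemma count_pairs_good (n : nat) (e : {poly F} -> {poly F} -> {poly F}) :
  (1 < n < N)%N ->
  (forall f d1 d2, d1 \is monic -> d2 \is monic -> (d1 * d2) ^+ 2 %| f ->
     d1 %| e f (d1 * d2) - e f d1) ->
  exists C : int, forall b0 b1, b0 != 0 ->
  #|[pred x : B * B | [&& mon n b0 x.1, (size x.2 <= n)%N, (x.2 : {poly F})`_0 == b1 &
      [forall g in monic_irr, ~~ (((g : {poly F}) ^+ 2 %| (x.1 : {poly F})) &&
         ((g : {poly F}) %| (x.2 : {poly F}) + e x.1 g))]]]|%:R =
  C - (~~ odd n)%:R * (q ^ (n.-1 - n./2))%N%:R * (root_count 2 b0)%:R.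
Proof.
move=> /andP[n1 nN] eP; have n0 : (0 < n)%N by exact: ltnW.
have [|C HC] := @weighted_mob n (fun k => (q ^ (n.-1 - 2 * k) * q ^ (n.-1 - k))%N%:R)
    (q ^ (n.-1 - n./2))%N%:R n0.
  by apply: leq_ltn_trans nN; rewrite -divn2 leq_div.
exists C => b0 b1 b00; rewrite -HC //.
have := @inclusion_exclusion _ (fun x : B * B => [&& mon n b0 x.1, (size x.2 <= n)%N &
    (x.2 : {poly F})`_0 == b1]) (fun x d => (d ^+ 2 %| (x.1 : {poly F})) &&
         (d %| (x.2 : {poly F}) + e x.1 d)).
rewrite (eq_card (B := [pred x : B * B | [&& mon n b0 x.1, (size x.2 <= n)%N, (x.2 :
  {poly F})`_0 == b1 &
      [forall g in monic_irr, ~~ (((g : {poly F}) ^+ 2 %| (x.1 : {poly F})) &&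
         ((g : {poly F}) %| (x.2 : {poly F}) + e x.1 g))]]])); last by move=> x;
           rewrite !inE -!andbA.
move=> ->; last first.
  move=> x _; split=> [|d1 d2 d1m d2m d12]; first by rewrite expr1n !dvd1p.
  have d122 : coprimep (d1 ^+ 2) (d2 ^+ 2) by rewrite coprimep_expl // coprimep_expr.
  rewrite exprMn (Gauss_dvdp _ d122) (Gauss_dvdp _ d12).
  have [/= c1|] := boolP (d1 ^+ 2 %| (x.1 : {poly F})) => //=.
  have [/= c2|] := boolP (d2 ^+ 2 %| (x.1 : {poly F})) => //=; last by rewrite andbF.
  have c12 : (d1 * d2) ^+ 2 %| (x.1 : {poly F}).
    by rewrite exprMn (Gauss_dvdp _ d122) c1.
  have E (u v w : {poly F}) : u %| v - w -> (u %| (x.2 : {poly F}) + v) = (u %| (x.2 :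
    {poly F}) + w).
    move=> uvw; rewrite -[in LHS](subrK w v) addrCA dvdp_addr //.
  rewrite (E _ _ _ (eP _ _ _ d1m d2m c12)) mulrC (E d2 _ (e x.1 d2)) //.
  by apply: eP => //; rewrite mulrC.
apply: eq_bigr => S SI; congr (_ * _).
have dm := prodp_monic SI.
rewrite -(eq_card (A := [pred x : B * B | [&& mon n b0 x.1, (size x.2 <= n)%N, (x.2 :
  {poly F})`_0 == b1,
       (prodp S) ^+ 2 %| (x.1 : {poly F}) & (prodp S) %| (x.2 : {poly F}) + e x.1
         (prodp S)]])); last first.
  by move=> x; rewrite !inE -!andbA.
rewrite (@count_pairs n (deg S) (prodp S) (fun f => e f (prodp S))) ?n0 //.
rewrite natrM; congr (_ * _); case: ifP => // _.
rewrite natrM; case: eqP => [<-|_]; last by rewrite !mulr0.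
by rewrite mul2n doubleK.
Qed.

(** Up to a square, [a ^+ j] is [a] or [1] according to the parity of [j]. In the odd case
    [a |-> b / a] permutes the nonzero elements, and the square roots of all of them together are
    the [q.-1] nonzero elements. *)
Lemma sum_roots2 (j : nat) (b : F) : b != 0 ->
  (\sum_(a : F | a != 0) (root_count 2 (b / a ^+ j))%:R)%R =
    ((q.-1)%:R * (if odd j then 1 else (root_count 2 b)%:R))%R :> int.
Proof.
move=> b0.
have rootsM (a c : F) : a != 0 -> root_count 2 (c / a ^+ 2) = root_count 2 c.
  move=> a0; apply: (card_bij (f := fun x => x * a) (g := fun x => x / a)) => x;
    rewrite !inE.
    move=> /andP[x0 /eqP xc]; rewrite mulf_neq0 // exprMn xc divfK ?expf_neq0 //.
    by rewrite eqxx mulfK.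
  move=> /andP[x0 /eqP xc]; rewrite mulf_neq0 ?invr_eq0 // exprMn xc exprVn eqxx.
  by rewrite divfK.
have rootsj (a c : F) i : a != 0 -> root_count 2 (c / a ^+ (2 * i)) = root_count 2 c.
  by move=> a0; rewrite mulnC exprM rootsM // expf_neq0.
have sum1 : (\sum_(a : F | a != 0) (root_count 2 a)%:R)%R = q.-1%:R :> int.
  rewrite -(cardC1 (0 : F)) -sum1_card natr_sum.
  rewrite [RHS](partition_big (fun c : F => c ^+ 2) (fun a => a != 0)) /=; last first.
    by move=> c c0; exact: expf_neq0.
  apply: eq_bigr => a _; rewrite /root_count -sum1_card natr_sum.
  by apply: eq_bigl => c; rewrite !inE.
rewrite -(odd_double_half j); set i := j./2.
rewrite oddD odd_double addbF; case: (odd j) => /=.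
  rewrite mulr1 -sum1 [RHS](reindex_inj (h := fun a => b / a)) /=; last first.
    by move=> x y /(mulfI b0) /invr_inj.
  apply: eq_big => [a|a a0]; first by rewrite mulf_eq0 (negbTE b0) invr_eq0.
  congr (_%:R); rewrite -[RHS](rootsj a _ i) // -mul2n exprD expr1 -mulrA.
  by rewrite -invfM mulrC.
rewrite (eq_bigr (fun=> (root_count 2 b)%:R)) => [|a a0];
  last by rewrite add0n -mul2n rootsj.
by rewrite sumr_const (cardC1 (0 : F)) mulr_natl.
Qed.

(** * Polynomials with exactly one double root *)

Definition sqfree_away (a : F) (f : {poly F}) : bool := sqfree f && ~~ ('X + a%:P %| f).

Lemma size_XaddC (a : F) : size ('X + a%:P) = 2%N.
Proof. by rewrite -[a]opprK polyCN size_XsubC. Qed.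

Lemma irreducible_XaddC (a : F) : irreducible_poly ('X + a%:P).
Proof.
split=> [|d d1 dX]; first by rewrite size_XaddC.
have d0 : d != 0 by apply: contraTneq dX => ->; rewrite dvd0p -size_poly_gt0 size_XaddC.
have := dvdp_leq (monic_neq0 (monicXaddC a)) dX; rewrite size_XaddC => sd.
rewrite -dvdp_size_eqp // size_XaddC eqn_leq sd ltn_neqAle eq_sym d1.
by rewrite size_poly_gt0.
Qed.

Lemma sqfree_mul_XaddC (a : F) (f : {poly F}) : f != 0 -> (size f < N)%N ->
  sqfree (f * ('X + a%:P)) = sqfree_away a f.
Proof.
move=> f0 fN; have X0 := monic_neq0 (monicXaddC a).
have XN : (size ('X + a%:P)%R <= N)%N.
  by rewrite size_XaddC; apply: leq_trans fN; rewrite ltnS size_poly_gt0.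
pose l : B := NPoly XN.
have lI : l \in monic_irr.
  by rewrite inE /= monicXaddC; apply/irreducibleP/irreducible_XaddC.
apply/forall_inP/andP => [sf|[/forall_inP sf Xf] g gI].
  split; last first.
    apply/negP => Xf; have /negP[] := sf l lI.
    by rewrite /= expr2 dvdp_mul.
  apply/forall_inP => g gI; apply: contra (sf g gI) => gf.
  by rewrite dvdp_mulr.
have [->|gl] := eqVneq g l.
  by apply: contra Xf; rewrite /= expr2 dvdp_mul2r.
apply: contra (sf g gI); rewrite Gauss_dvdpl // coprimep_expl //.
exact: (monic_irr_coprime gI lI gl).
Qed.

Lemma count_split (P Q : pred {poly F}) :
  npoly_count P = (npoly_count (fun f => P f && Q f) + npoly_count (fun f => P f && ~~
    Q f))%N.
Proof.
rewrite /npoly_count -(cardID [pred f : B | Q f] [pred f : B | P f]); congr (_ + _)%N.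
  by apply: eq_card => f; rewrite !inE; case: (P f); case: (Q f).
Qed.

Definition sqfree_away_count (m : nat) (a c : F) : nat :=
  npoly_count (fun f => mon m c f && sqfree_away a f).

Lemma mon_mul (m k : nat) (c d : F) (f g : {poly F}) :
  mon m c f -> mon k d g -> mon (m + k) (c * d) (f * g).
Proof.
move=> /and3P[fm /eqP sf /eqP f0] /and3P[gm /eqP sg /eqP g0].
rewrite /mon monicMl // gm size_Mmonic ?monic_neq0 // sf sg addSn addnS /=.
by rewrite eqxx coef0M f0 g0 eqxx.
Qed.

Lemma mon_div (m k : nat) (c d : F) (f g : {poly F}) : d != 0 ->
  mon (m + k) c (f * g) -> mon k d g -> mon m (c / d) f.
Proof.
move=> d0 /and3P[fgm /eqP sfg /eqP fg0] /and3P[gm /eqP sg /eqP g0].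
have fm : f \is monic by rewrite -(monicMr _ gm).
rewrite /mon fm /=; move: sfg; rewrite size_Mmonic ?monic_neq0 // sg addnS /=.
rewrite -addSn => /eqP; rewrite eqn_add2r => ->.
by rewrite -fg0 coef0M g0 mulfK // eqxx.
Qed.

Lemma mon_XaddC (a : F) : mon 1 a ('X + a%:P).
Proof. by rewrite /mon monicXaddC size_XaddC coefD coefX coefC add0r !eqxx. Qed.

(** A squarefree polynomial divisible by ['X + a%:P] is this factor times a polynomial squarefree
    away from [a]. This is the recursion that removes the condition at [- a], at the price of
    lowering the degree by one. *)
Lemma sqfree_away_countS (m : nat) (a c : F) : a != 0 -> (m.+1 < N)%N ->
  npoly_count (fun f => mon m.+1 c f && sqfree f) =
  (sqfree_away_count m.+1 a c + sqfree_away_count m a (c / a))%N.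
Proof.
move=> a0 mN; rewrite (count_split _ (fun f => ~~ ('X + a%:P %| f))); congr (_ + _)%N.
  by apply: eq_count => f _; rewrite andbA.
have X0 := monic_neq0 (monicXaddC a).
apply: (@count_bij _ _ (fun f => f %/ ('X + a%:P)) (fun f => f * ('X + a%:P))).
  move=> f /andP[/andP[mf sf] /negPn Xf] _; rewrite -(divpK Xf) -addn1 in mf sf *.
  move: (f %/ _) mf sf => {Xf}f mf sf; rewrite mulpK //.
  have := mon_div a0 mf (mon_XaddC a) => mf'; have /and3P[fm /eqP szf _] := mf'.
  have fN : (size f <= N)%N by rewrite szf ltnW.
  by split=> //; rewrite mf' -sqfree_mul_XaddC ?monic_neq0 // szf.
move=> f /andP[mf sf] _; have := mon_mul mf (mon_XaddC a).
rewrite divfK // addn1 => mf'; rewrite mulpK //.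
have /and3P[fm /eqP szf _] := mf; have /and3P[_ /eqP szfX _] := mf'.
by rewrite mf' dvdp_mull // szfX mN sqfree_mul_XaddC ?monic_neq0 ?szf ?sf //.
Qed.

(* Induction on [m] with [n - m] decreasing: by [sqfree_away_countS] the term for
   [m.+1] is a squarefree count minus the term for [m]. *)
Lemma sum_sqfree_away (n m : nat) : (m <= n)%N -> (m < N)%N ->
  exists C : int, forall b, b != 0 ->
  \sum_(a : F | a != 0) (sqfree_away_count m a (b / a ^+ (n - m)))%:R =
    C + (-1) ^+ m * ((root_count n b)%:R -
          (~~ odd n)%:R * (q.-1 * m./2)%N%:R * (root_count 2 b)%:R).
Proof.
elim: m => [|m IHm] mn mN.
  (* In degree [0] the only polynomial is [1], and it is counted exactly for the [a] with
     [a ^+ n = b]: the [n]th roots enter here. *)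
  exists 0 => b b0; rewrite muln0 mulr0 mul0r subr0 mul1r add0r subn0.
  rewrite /root_count -sum1_card natr_sum big_mkcondr; apply: eq_bigr => a a0.
  have sN : (size (1 : {poly F})%R <= N)%N by rewrite size_poly1.
  have away1 : sqfree_away a 1.
    apply/andP; split; last by rewrite dvdp1 size_XaddC.
    apply/forall_inP => g; rewrite inE => /andP[_ /irreducibleP[sg _]].
    rewrite dvdp1 neq_ltn; apply/orP; right; apply: (leq_trans sg).
    apply: dvdp_leq; last by rewrite expr2 dvdp_mulr.
    by apply: expf_neq0; rewrite -size_poly_gt0 ltnW.
  rewrite eq_sym; case: eqVneq => [->|ab].
    rewrite divff ?expf_neq0 //.
    rewrite /sqfree_away_count -[RHS]/(1%N%:R) -(@card1 B (npolyp N 1)); congr (_%:R).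
    apply: eq_card => f; rewrite !inE; apply/andP/eqP => [[/and3P[fm sf _] _]|->].
      apply: val_inj; rewrite /= npolypK //; apply/eqP; rewrite -eqp_monic ?monic1 //.
      by rewrite -size_poly_eq1.
    by rewrite npolypK // away1 /mon monic1 size_poly1 coef1 !eqxx.
  rewrite /sqfree_away_count /npoly_count eq_card0 // => f; rewrite !inE.
  apply/negP => /andP[/and3P[fm /size_poly1P[x x0 fx] /eqP f0] _].
  move: fm f0; rewrite fx monicE lead_coefC coefC /= => /eqP -> /esym /eqP.
  rewrite -subr_eq0 -(inj_eq (mulIf (expf_neq0 n a0))) mulrBl divfK ?expf_neq0 //.
  by rewrite mul0r mul1r subr_eq0 (negbTE ab).
have [C1 HC1] := IHm (ltnW mn) (ltnW mN).
have [|C2 HC2] := @count_sqfree m.+1; first exact: mN.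
(* For [m.+1] even and [n] odd, the exponent [n - m.+1] is odd and [sum_roots2] contributes the
   constant [q.-1], absorbed here. For both even it contributes the multiple of [root_count 2 b]
   that raises [m./2] by one. *)
exists ((q.-1)%:R * (C2 - (~~ odd m.+1 && odd n)%:R) - C1) => b b0.
have -> : (\sum_(a : F | a != 0) (sqfree_away_count m.+1 a (b / a ^+ (n - m.+1)))%:R)%R =
  (\sum_(a : F | a != 0) (npoly_count (fun f => mon m.+1 (b / a ^+ (n - m.+1)) f &&
    sqfree f))%:R -
  \sum_(a : F | a != 0) (sqfree_away_count m a (b / a ^+ (n - m)))%:R)%R :> int.
  rewrite -sumrB; apply: eq_bigr => a a0; rewrite (sqfree_away_countS _ a0 mN).
  by rewrite natrD -mulrA -invfM -exprSr -subSn // subSS addrK.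
rewrite HC1 //.
have -> : (\sum_(a : F | a != 0) (npoly_count (fun f => mon m.+1 (b / a ^+ (n - m.+1))
  f && sqfree f))%:R)%R
    = ((q.-1)%:R * C2 - (~~ odd m.+1)%:R * ((q.-1)%:R * (if odd (n - m.+1) then 1 else
      (root_count 2 b)%:R)))%R :> int.
  rewrite (eq_bigr (fun a => C2 - (~~ odd m.+1)%:R * (root_count 2 (b / a ^+ (n -
    m.+1)))%:R)).
    by rewrite sumrB sumr_const (cardC1 (0 : F)) mulr_natl -mulr_sumr sum_roots2.
  by move=> a a0; rewrite HC2 // mulf_neq0 // invr_eq0 expf_neq0.
rewrite oddB // exprS /= uphalf_half; have := signr_odd int m.
case: (odd m) => /= <-; case: (odd n) => /=; rewrite ?natrM ?natrD /=; ring.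
Qed.

Definition double_root (a : F) (f : {poly F}) : bool :=
  (('X + a%:P) ^+ 2 %| f) && sqfree_away a (f %/ ('X + a%:P) ^+ 2).

Lemma count_double_root (n : nat) (a b : F) : a != 0 -> (1 < n < N)%N ->
  npoly_count (fun f => mon n b f && double_root a f) = sqfree_away_count (n - 2) a (b
    / a ^+ 2).
Proof.
move=> a0 /andP[n1 nN].
have X20 : ('X + a%:P) ^+ 2 != 0 by rewrite expf_neq0 // monic_neq0 // monicXaddC.
have mX2 : mon 2 (a ^+ 2) (('X + a%:P) ^+ 2).
  by have := mon_mul (mon_XaddC a) (mon_XaddC a); rewrite -!expr2.
have nE : n = (n - 2 + 2)%N by rewrite subnK.
apply: (@count_bij _ _ (fun f => f %/ ('X + a%:P) ^+ 2) (fun f => f * ('X + a%:P) ^+ 2)).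
  move=> f /andP[mf /andP[Xf sf]] _; rewrite divpK // sf andbT.
  rewrite -(divpK Xf) nE in mf; have mf' := mon_div (expf_neq0 2 a0) mf mX2.
  split=> //; case/and3P: mf' => _ /eqP -> _.
  by lia.
move=> f /andP[mf sf] _; have := mon_mul mf mX2.
rewrite -nE divfK ?expf_neq0 // => mf'; rewrite /double_root mulpK // sf dvdp_mull // mf'.
by split=> //; case/and3P: mf' => _ /eqP -> _.
Qed.

(** A second double root would give a square dividing the squarefree cofactor. Uniqueness turns the
    existential over [a] in the counts below into a sum over [a]. *)
Lemma double_root_inj (a a' : F) (f : {poly F}) : f != 0 -> (size f <= N)%N ->
  double_root a f -> double_root a' f -> a = a'.
Proof.
move=> f0 fN /andP[Xf /andP[/forall_inP sf _]] /andP[Xf' _].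
apply: contraTeq isT => aa'.
have X'f : ('X + a'%:P) ^+ 2 %| f %/ ('X + a%:P) ^+ 2.
  move: Xf'; rewrite -{1}(divpK Xf) Gauss_dvdpl // coprimep_expl // coprimep_expr //.
  have E c : 'X + c%:P = 'X - (- c)%:P :> {poly F} by rewrite polyCN opprK.
  by rewrite !E coprimep_XsubC root_XsubC eqr_opp.
have XN : (size ('X + a'%:P)%R <= N)%N.
  apply: leq_trans fN; apply: dvdp_leq f0 _; apply: dvdp_trans Xf'.
  by rewrite expr2 dvdp_mulr.
have lI : (NPoly XN : B) \in monic_irr.
  by rewrite inE /= monicXaddC; apply/irreducibleP/irreducible_XaddC.
by have /negP[] := sf _ lI.
Qed.

(** For each [f] with double root [- a], the digits [h] with given constant term number [q ^ n.-1],
    and those in the forbidden class modulo ['X + a%:P] number [q ^ n.-2]. Their difference [K]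
    multiplies the count of the [f], which is [sum_sqfree_away] in degree [n - 2]. *)
Lemma count_pairs_double_root (n : nat) (e : {poly F} -> {poly F} -> {poly F}) :
  (1 < n < N)%N ->
  exists C : int, forall b0 b1, b0 != 0 ->
  #|[pred x : B * B | [&& mon n b0 x.1, (size x.2 <= n)%N, (x.2 : {poly F})`_0 == b1 &
      [exists a, double_root a x.1 && ~~ ('X + a%:P %| (x.2 : {poly F}) + e x.1 ('X +
        a%:P))]]]|%:R =
  C + ((q ^ n.-1)%N%:R - (q ^ n.-2)%N%:R) * (-1) ^+ n *
     ((root_count n b0)%:R - (~~ odd n)%:R * (q.-1 * n.-2./2)%N%:R * (root_count 2
       b0)%:R).
Proof.
move=> /andP[n1 nN]; have [||C HC] := @sum_sqfree_away n (n - 2); [lia|lia|].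
pose K : int := (q ^ n.-1)%N%:R - (q ^ n.-2)%N%:R.
exists (K * C) => b0 b1 b00.
have n2 : (n - (n - 2) = 2)%N by lia.
have s1 : (-1) ^+ n = (-1) ^+ (n - 2) :> int.
  by rewrite -[in LHS](subnK n1) exprD sqrrN expr1n mulr1.
rewrite -/K s1 -mulrA -mulrDr -subn2; rewrite n2 in HC; rewrite -HC // mulr_sumr.
have hcount (a : F) (e1 : {poly F}) : a != 0 ->
  #|[pred h : B | [&& (size h <= n)%N, (h : {poly F})`_0 == b1 & ~~ ('X + a%:P %| (h :
    {poly F}) + e1)]]|%:R = K.
  move=> a0; have /= cs := count_split (fun h : {poly F} => (size h <= n)%N && (h`_0 ==
    b1))
    (fun h => 'X + a%:P %| h + e1).
  (* With [d = 1] the divisibility is empty, so this counts all [h]. *)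
  have c1 := @count_cong n 0 1 0 b1 (ltnW n1) (ltnW nN) (size_poly1 F).
  rewrite coef1 oner_eq0 subn0 in c1.
  have c2 := @count_cong n 1 ('X + a%:P) e1 b1 n1 (ltnW nN) (size_XaddC a).
  rewrite coefD coefX coefC add0r a0 subn1 in c2.
  rewrite /K -c1 // -c2 //; apply/eqP; rewrite eq_sym subr_eq -natrD; apply/eqP;
    congr (_%:R).
  rewrite addnC; apply: etrans (etrans cs _).
    by apply: eq_card => h; rewrite !inE dvd1p andbT.
  by congr (_ + _)%N; apply: eq_card => h; rewrite !inE andbA.
rewrite -sum1_card natr_sum.
rewrite (eq_bigr (fun a : F => \sum_(x : B * B | [&& mon n b0 x.1, double_root a x.1,
   (size x.2 <= n)%N, (x.2 : {poly F})`_0 == b1 &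
   ~~ ('X + a%:P %| (x.2 : {poly F}) + e x.1 ('X + a%:P))]) 1%:R)); last first.
  move=> a a0; rewrite -(count_double_root _ a0) ?n1 // /npoly_count mulrC.
  rewrite mulr_natl -sumr_const.
  rewrite (eq_bigl (fun x : B * B => (mon n b0 x.1 && double_root a x.1) && [&&
   (size x.2 <= n)%N, (x.2 : {poly F})`_0 == b1 &
   ~~ ('X + a%:P %| (x.2 : {poly F}) + e x.1 ('X + a%:P))])); last by move=> x;
     rewrite -andbA.
  rewrite -(pair_big_dep (fun f : B => mon n b0 f && double_root a f)
    (fun (f h : B) => [&& (size h <= n)%N, (h : {poly F})`_0 == b1 & ~~ ('X + a%:P %|
      (h : {poly F}) + e f ('X + a%:P))])
    (fun _ _ => 1%:R)) /=.
  apply: eq_bigr => f _; rewrite -(hcount a (e f ('X + a%:P))) // -sum1_card natr_sum.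
  by apply: eq_bigl => h; rewrite !inE.
rewrite [RHS](exchange_big_dep xpredT) //= big_mkcond; apply: eq_bigr => x _; rewrite inE.
case: ifPn => [/and4P[mx sx hx /existsP[a /andP[ra da]]]|nx].
  have /and3P[xm _ /eqP x0] := mx.
  rewrite (big_pred1 a) // => a'; apply/andP/eqP => [[_ /and5P[_ ra' _ _ _]]|->].
    by apply: double_root_inj ra' ra; rewrite ?monic_neq0 ?size_npoly.
  rewrite mx sx hx ra da; split=> //; apply: contraNneq b00 => a0; rewrite -x0.
  case/andP: ra => Xx _; apply/eqP; apply: (dvd_coef0 Xx).
  by rewrite a0 addr0 coefXn.
rewrite big_pred0 // => a; apply: contraNF nx => /andP[_ /and5P[-> ra -> -> da]].
by apply/existsP; exists a; rewrite ra.
Qed.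

End Counting.

From mathcomp Require Import all_classical all_reals all_analysis.

(** * Second-order digits of p-adic polynomials *)

Section Padic.
Variables (p : nat) (p_pr : prime p).
Local Notation Z_p := (padic_int p_pr).
Local Notation F := 'F_p.
Implicit Types (x y z : Z_p).

Let red : {rmorphism Z_p -> 'F_p} := @reduction p p_pr.

(** The representative in [[0, p)]. It respects neither sums nor products, and the resulting carries
    are what [sqr_defect] records. *)
Definition padic_lift (c : F) : Z_p := (c : nat)%:R.

Lemma padic_liftK c : reduction (padic_lift c) = c.
Proof. by rewrite /padic_lift (rmorph_nat red) natr_Zp. Qed.

Lemma padic_lift0 : padic_lift 0 = 0. Proof. by []. Qed.

Lemma residue_nat (m k : nat) : residue (m%:R : Z_p) k = (m %% p ^ k)%N.
Proof.
elim: m => [|m IHm]; first by [].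
by rewrite -addn1 natrD /= IHm modnDm.
Qed.

Lemma red_p : (p%:R : F) = 0.
Proof. by rewrite pchar_Fp_0. Qed.

Lemma padic_p_neq0 : (p%:R : Z_p) != 0.
Proof.
apply/eqP => /(congr1 (fun x : Z_p => residue x 2)); rewrite residue_nat /= mod0n.
rewrite modn_small; first by move=> p0; have := prime_gt0 p_pr; rewrite p0.
by rewrite -{1}[p]expn1 ltn_exp2l ?prime_gt1.
Qed.

Lemma reduction_eq0P x : reduction x = 0 <-> padic_dvd p%:R x.
Proof.
split=> [x0|[y ->]]; last by rewrite (rmorphM red) (rmorph_nat red) red_p mul0r.
have r1 : residue x 1 = 0%N.
  have := residue_lt x 1; rewrite expn1 => xp.
  move/(congr1 val): x0; rewrite /reduction /= val_Fp_nat //.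
  by rewrite modn_small.
have pd k : (p %| residue x k.+1)%N.
  by rewrite /dvdn -{2}[p]expn1 residue_le // r1.
(* The residue of [x / p] modulo [p ^ k] is the residue of [x] one level higher, divided by [p]. *)
have coh k : (residue x k.+1 %/ p)%N = (residue x k.+2 %/ p)%N %[mod p ^ k].
  apply/eqP; rewrite -(eqn_pmul2r (prime_gt0 p_pr)) !muln_modl -?expnSr.
  by rewrite !divnK // residue_mod residueS eqxx.
exists (padic_of p_pr coh); apply/padicP => k.
rewrite [in RHS]/= modnMmr residue_nat modnMml mulnC divnK //.
by rewrite residue_le.
Qed.

Lemma unit_padicE x : (x \is a GRing.unit) = (reduction x != 0).
Proof.
apply/idP/idP => [xU|x0]; first by rewrite -unitfE; exact: (rmorph_unit red).
have cop k : coprime (residue x k) (p ^ k).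
  case: k => [|k]; first exact: coprimen1.
  apply: coprimeXr; rewrite coprime_sym prime_coprime //.
  apply: contra x0 => px; apply/eqP/val_inj; rewrite /reduction /= val_Fp_nat //.
  have := residue_le x (ltn0Sn k); rewrite expn1 => <-.
  by rewrite modn_mod; apply/eqP.
(* Bezout inverts [x] modulo each [p ^ k]. Level [0] is set apart because [residue x 0 = 0]. *)
pose u k := (if k is 0 then 0 else (egcdn (residue x k) (p ^ k)).1)%N.
have uP k : (u k * residue x k = 1 %[mod p ^ k])%N.
  case: k => [|k]; first by rewrite !modn1.
  rewrite /u; case: egcdnP => [|km kn e _ /=].
    have := cop k.+1; case: (residue x k.+1) => //.
    by rewrite /coprime gcd0n => /eqP pk; have := prime_gt1 p_pr; rewrite -(expn1 p);
      have := @ltn_exp2l p 0 k.+1 (prime_gt1 p_pr); rewrite pk.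
  by rewrite e (eqP (cop k.+1)) modnMDl.
have coh k : u k = u k.+1 %[mod p ^ k].
  have e1 : (u k.+1 * residue x k = 1 %[mod p ^ k])%N.
    rewrite residueS modnMmr; have /(congr1 (fun t => (t %% p ^ k)%N)) := uP k.+1.
    by rewrite !modn_dvdm // dvdn_exp2l.
  rewrite -[u k]muln1 -modnMmr -e1 modnMmr mulnCA -modnMmr uP.
  by rewrite modnMmr muln1.
apply/unitrP; exists (padic_of p_pr coh).
suff yx : padic_of p_pr coh * x = 1 by rewrite [x * _]mulrC.
by apply/padicP => k; rewrite [in LHS]/= modnMml uP [in RHS]/=.
Qed.

(* [x / p], with the junk value [0] when [p] does not divide [x]. *)
Definition divp_p x : Z_p :=
  if pselect (padic_dvd p%:R x) is left ex then projT1 (cid ex) else 0.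

Lemma divp_pK x : reduction x = 0 -> p%:R * divp_p x = x.
Proof.
by move=> /reduction_eq0P xp; rewrite /divp_p; case: pselect => // ex; case: cid.
Qed.

Lemma divp_p0 : divp_p 0 = 0.
Proof.
apply: (mulfI padic_p_neq0); rewrite mulr0 divp_pK //; exact: (rmorph0 red).
Qed.

(** Induction on a level at which [x] has a nonzero residue: dividing by [p] lowers this level, and
    at level [0] all residues vanish. *)
Lemma padic_factor x : x != 0 ->
  exists k u, u \is a GRing.unit /\ x = p%:R ^+ k * u.
Proof.
move=> x0; have [k xk] : exists k, residue x k != 0%N.
  apply: contrapT => /forallNP xk; move/eqP: x0; apply; apply/padicP => k.
  by rewrite [RHS]mod0n; apply/eqP/negPn/negP/xk.
elim: k x x0 xk => [|k IHk] x x0 xk.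
  by have := residue_lt x 0; rewrite ltnS leqn0 (negbTE xk).
have [xU|] := boolP (x \is a GRing.unit); first by exists 0%N, x; rewrite mul1r.
rewrite unit_padicE => /negPn/eqP/reduction_eq0P[y xy].
have [||i [u [uU yu]]] := IHk y.
- by apply: contraNneq x0; rewrite xy => ->; rewrite mulr0.
- apply: contraNneq xk => yk; rewrite xy /= residue_nat modnMml.
  rewrite (residueS y) in yk; rewrite (divn_eq (residue y k.+1) (p ^ k)) yk addn0.
  by rewrite mulnCA -expnS modnMl.
by exists i.+1, u; rewrite xy yu exprS mulrA.
Qed.

Local Notation redp := (map_poly (@reduction p p_pr)).

Definition liftp (g : {poly F}) : {poly Z_p} := map_poly padic_lift g.

Lemma coef_liftp (g : {poly F}) i : (liftp g)`_i = padic_lift g`_i.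
Proof. by rewrite coef_map_id0. Qed.

Lemma liftpK g : redp (liftp g) = g.
Proof. by apply/polyP => i; rewrite (coef_map red) coef_liftp /= padic_liftK. Qed.

Lemma redp_p : redp p%:R = 0.
Proof.
by rewrite -polyC_natr map_polyC /= (rmorph_nat red) red_p.
Qed.

Lemma redpD (f g : {poly Z_p}) : redp (f + g) = redp f + redp g.
Proof. exact: rmorphD. Qed.
Lemma redpN (f : {poly Z_p}) : redp (- f) = - redp f.
Proof. exact: rmorphN. Qed.
Lemma redpM (f g : {poly Z_p}) : redp (f * g) = redp f * redp g.
Proof. exact: rmorphM. Qed.
Lemma redpX (f : {poly Z_p}) n : redp (f ^+ n) = redp f ^+ n.
Proof. exact: rmorphXn. Qed.
Definition redpE := (redpX, redpD, redpN, redpM, redp_p, liftpK).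

Lemma poly_p_neq0 : (p%:R : {poly Z_p}) != 0.
Proof. by rewrite -polyC_natr polyC_eq0 padic_p_neq0. Qed.

Definition poly_div_p (f : {poly Z_p}) : {poly Z_p} := map_poly divp_p f.

Lemma poly_div_pK f : redp f = 0 -> p%:R * poly_div_p f = f.
Proof.
move=> f0; apply/polyP => i; rewrite mulr_natl coefMn coef_map_id0 ?divp_p0 //.
by rewrite -mulr_natl divp_pK // -(coef_map red) f0 coef0.
Qed.

Lemma redp_eq0P f : redp f = 0 <-> exists g, f = p%:R * g.
Proof.
split=> [/poly_div_pK fE|[g ->]]; first by exists (poly_div_p f).
by rewrite rmorphM /= redp_p mul0r.
Qed.

Definition digit1 x : F := reduction (divp_p (x - padic_lift (reduction x))).

Lemma digits2 x : exists z,
  x = padic_lift (reduction x) + p%:R * padic_lift (digit1 x) + p%:R ^+ 2 * z.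
Proof.
have x0 : reduction (x - padic_lift (reduction x)) = 0.
  by rewrite (rmorphB red) /= padic_liftK subrr.
have y0 : reduction (divp_p (x - padic_lift (reduction x)) - padic_lift (digit1 x)) = 0.
  by rewrite (rmorphB red) /= padic_liftK subrr.
exists (divp_p (divp_p (x - padic_lift (reduction x)) - padic_lift (digit1 x))).
by rewrite expr2 -mulrA divp_pK // mulrBr divp_pK //; ring.
Qed.

Lemma digit1_0 : digit1 0 = 0.
Proof. by rewrite /digit1 (rmorph0 red) padic_lift0 subrr divp_p0 (rmorph0 red). Qed.

Definition digit1p (f : {poly Z_p}) : {poly F} := map_poly digit1 f.

Lemma coef_digit1p f i : (digit1p f)`_i = digit1 f`_i.
Proof. by rewrite coef_map_id0 ?digit1_0. Qed.

Lemma digits2p f : exists w,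
  f = liftp (redp f) + p%:R * liftp (digit1p f) + p%:R ^+ 2 * w.
Proof.
have /choice[z zE] x := digits2 x.
exists (\poly_(i < size f) z f`_i); apply/polyP => i.
rewrite -natrX !(coefD, mulr_natl, coefMn) !coef_liftp coef_digit1p (coef_map red) /=.
rewrite coef_poly; case: ltnP => [_|fi].
  by rewrite {1}(zE f`_i) -natrX !mulr_natl.
by rewrite nth_default // (rmorph0 red) digit1_0 !padic_lift0 !mul0rn !addr0.
Qed.

(* [f] lies in the square of the ideal [(p, g)]; by Dedekind's criterion this is
   what prevents [Z_p[x]/(f)] from being maximal at the prime above [g]. *)
Definition in_sqr_ideal (f : {poly Z_p}) (g : {poly F}) : Prop :=
  exists G u v w, redp G = g /\ f = G ^+ 2 * u + p%:R * G * v + p%:R ^+ 2 * w.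

(* For [g^2] dividing [f], the digit that turns [f + p h] being in [(p, g)^2]
   into the divisibility of [h + sqr_defect f g] by [g]. *)
Definition sqr_defect (f g : {poly F}) : {poly F} :=
  redp (poly_div_p (liftp f - liftp g ^+ 2 * liftp (f %/ g ^+ 2))).

Lemma sqr_defectP (f g : {poly F}) : g ^+ 2 %| f ->
  exists2 E, redp E = sqr_defect f g &
    liftp f = liftp g ^+ 2 * liftp (f %/ g ^+ 2) + p%:R * E.
Proof.
move=> gf; exists (poly_div_p (liftp f - liftp g ^+ 2 * liftp (f %/ g ^+ 2))) => //.
have d0 : redp (liftp f - liftp g ^+ 2 * liftp (f %/ g ^+ 2)) = 0.
  by rewrite !redpE mulrC divpK // subrr.
by rewrite (poly_div_pK d0) addrCA subrr addr0.
Qed.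

(** With [G = liftp g + p t], and the lift of the quotient of [f] by [g ^+ 2] equal to [u + p s],
    both expressions of [f] agree modulo [p]. Comparing them one digit further, the choices of [G],
    [u] and [v] contribute only multiples of [g], so all that matters is the class of the second
    digit modulo [g]. *)
Lemma in_sqr_idealP (f : {poly Z_p}) (g : {poly F}) : g != 0 ->
  in_sqr_ideal f g <->
  g ^+ 2 %| redp f /\ g %| digit1p f + sqr_defect (redp f) g.
Proof.
move=> g0; have [w fE] := digits2p f; split=> [[G [u [v [w' [Gg fE']]]]]|[g2f gh]].
  have g2f : g ^+ 2 %| redp f.
    rewrite fE' !redpE Gg expr0n /= !mul0r !addr0.
    exact: dvdp_mulr.
  split=> //; have [E <- LE] := sqr_defectP g2f; rewrite LE in fE.
  have /redp_eq0P[t tE] : redp (G - liftp g) = 0 by rewrite !redpE Gg subrr.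
  have {tE}GE : G = liftp g + p%:R * t by rewrite -tE addrC subrK.
  set U := liftp (_ %/ _) in fE.
  (* Reducing the two expressions of [f] modulo [p] and cancelling [g ^+ 2]. *)
  have /redp_eq0P[s sE] : redp (U - u) = 0.
    apply/eqP; rewrite -(mulrI_eq0 _ (mulfI (expf_neq0 2 g0))).
    have := congr1 redp fE; rewrite {1}fE' !redpE Gg.
    rewrite expr0n /= !mul0r !addr0 => e; apply/eqP.
    by rewrite mulrBr e subrr.
  have UE : U = u + p%:R * s by rewrite -sE addrC subrK.
  set L := liftp g in fE GE; set H := liftp (digit1p f) in fE.
  have e0 : p%:R * (L ^+ 2 * s + E + H - 2%:R * L * t * u - G * v) =
      p%:R * (p%:R * (t ^+ 2 * u + w' - w)).
    have : f - f = 0 by rewrite subrr.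
    rewrite {1}fE fE' UE GE => e1; apply/eqP; rewrite -subr_eq0 -[X in _ == X]e1.
    by apply/eqP; ring.
  have {e0} := congr1 redp (mulfI poly_p_neq0 e0).
  rewrite /L /H !redpE Gg mul0r.
  move=> e0; have -> : digit1p f + redp E = g * (redp 2%:R * redp t * redp u + redp v -
    g * redp s).
    apply/eqP; rewrite -subr_eq0 -[X in _ == X]e0; apply/eqP; ring.
  exact: dvdp_mulr.
have [E EE LE] := sqr_defectP g2f; rewrite LE in fE.
move/dvdpP: gh => [v vE].
have /redp_eq0P[t tE] : redp (liftp (digit1p f) + E - liftp g * liftp v) = 0.
  by rewrite !redpE EE vE mulrC subrr.
exists (liftp g), (liftp (redp f %/ g ^+ 2)), (liftp v), (w + t); split;
  first exact: liftpK.
rewrite {1}fE; have -> : liftp (digit1p f) = p%:R * t - E + liftp g * liftp v by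
  rewrite -tE; ring.
ring.
Qed.

(** The compatibility required by [count_pairs_good]. The two decompositions of [liftp f] differ by
    the carries [t] and [r] of [d1 * d2] and of the quotient [v]; modulo [p] both carries enter with
    a factor [d1]. *)
Lemma sqr_defect_mul (f d1 d2 : {poly F}) : d1 \is monic -> d2 \is monic ->
  (d1 * d2) ^+ 2 %| f -> d1 %| sqr_defect f (d1 * d2) - sqr_defect f d1.
Proof.
move=> d1m d2m d12f; have d120 : d1 * d2 != 0 by rewrite mulf_neq0 ?monic_neq0.
have d1f : d1 ^+ 2 %| f by apply: dvdp_trans d12f; rewrite exprMn dvdp_mulr.
have [E1 <- L1] := sqr_defectP d1f; have [E12 <- L12] := sqr_defectP d12f.
set u := f %/ (d1 * d2) ^+ 2 in L12; set v := f %/ d1 ^+ 2 in L1.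
have vE : v = d2 ^+ 2 * u.
  apply: (mulIf (expf_neq0 2 (monic_neq0 d1m))); rewrite /v divpK //.
  by rewrite -[LHS](divpK d12f) -/u; ring.
have /redp_eq0P[t tE] : redp (liftp (d1 * d2) - liftp d1 * liftp d2) = 0.
  by rewrite !redpE subrr.
have /redp_eq0P[r rE] : redp (liftp v - liftp d2 ^+ 2 * liftp u) = 0.
  by rewrite !redpE vE subrr.
have {}tE : liftp (d1 * d2) = liftp d1 * liftp d2 + p%:R * t by rewrite -tE addrC subrK.
have {}rE : liftp v = liftp d2 ^+ 2 * liftp u + p%:R * r by rewrite -rE addrC subrK.
have : p%:R * (E12 - E1) = p%:R * (liftp d1 ^+ 2 * r - 2%:R * liftp d1 * liftp d2 * t *
  liftp u
    - p%:R * (t ^+ 2 * liftp u)).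
  have : liftp f - liftp f = 0 by rewrite subrr.
  rewrite {1}L12 L1 tE rE => e1; apply/eqP; rewrite -subr_eq0 -[X in _ == X]e1.
  by apply/eqP; ring.
move=> /(mulfI poly_p_neq0)/(congr1 redp); rewrite redpD redpN => ->.
rewrite !redpE mul0r subr0.
rewrite -[X in _ - X](_ : d1 * (redp 2%:R * d2 * redp t * u) = _); last by ring.
by rewrite dvdp_sub // ?dvdp_mulr // expr2 -mulrA dvdp_mulr.
Qed.

End Padic.

(** * Dedekind's criterion *)

Lemma fraction_numden (D : idomainType) (x : {fraction D}) :
  exists n d : D, d != 0 /\ x * FracField.tofrac d = FracField.tofrac n.
Proof.
exists (generic_quotient.repr x).1, (generic_quotient.repr x).2; split;
  first exact: denom_ratioP.
rewrite -{1}[x]generic_quotient.reprK; unlock FracField.tofrac;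
  rewrite -[LHS]FracField.pi_mul.
apply/eqP; rewrite eqmodE /= /FracField.equivf /= /FracField.mulf.
rewrite !numden_Ratio ?mulr1 ?oner_neq0 ?denom_ratioP //; apply/eqP; exact: mulrC.
Qed.

Section MaximalOrder.
Variables (p : nat) (p_pr : prime p) (f : {poly padic_int p_pr}).
Hypotheses (f_monic : f \is monic) (f_size : (1 < size f)%N).
Local Notation Z_p := (padic_int p_pr).
Local Notation Q_p := {fraction Z_p}.
Local Notation F := 'F_p.
Local Notation redp := (map_poly (@reduction p p_pr)).
Local Notation A := (poly_alg f).
Local Notation fq := (map_poly (@toQp p p_pr) f).

Let tq : {rmorphism Z_p -> Q_p} := @FracField.tofrac Z_p.

Let toQp_inj : injective (@toQp p p_pr).
Proof. by move=> x y /eqP; rewrite /toQp tofrac_eq => /eqP. Qed.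

Definition eval_alg : {rmorphism {poly Z_p} -> A} := in_qpoly fq \o map_poly tq.

Lemma eval_algE g : eval_alg g = in_qpoly fq (map_poly (@toQp p p_pr) g).
Proof. by []. Qed.

Lemma size_fq : size fq = size f.
Proof. by rewrite (size_map_poly_id0 (f := tq)) // (monicP f_monic) rmorph1 oner_eq0. Qed.

Lemma monic_fq : fq \is monic.
Proof. exact: (monic_map tq). Qed.

Lemma mk_monic_fq : mk_monic fq = fq.
Proof. by rewrite /mk_monic size_fq f_size monic_fq. Qed.

Lemma toQp_scale (c : Z_p) (a : A) : toQp c *: a = eval_alg c%:P * a.
Proof.
rewrite eval_algE (map_polyC tq) /= -alg_polyC in_qpolyZ.
by rewrite (_ : in_qpoly fq 1 = 1) ?rmorph1 // -scalerAl mul1r.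
Qed.

(** As [f] is monic, division by [f] over Z_p is also the division over Q_p; hence Z_p[x]/(f) embeds
    in the algebra. *)
Lemma eval_alg_eq0 g : eval_alg g = 0 <-> exists h, g = f * h.
Proof.
split=> [|[h ->]].
  move=> /(congr1 (@polyn _ _)); rewrite eval_algE /= mk_monic_fq => g0.
  have gE := Pdiv.IdomainMonic.divp_eq f_monic g.
  exists (g %/ f); rewrite {1}gE mulrC; apply/eqP; rewrite -subr_eq0 addrC addKr.
  apply/eqP; apply: (map_inj_poly toQp_inj (rmorph0 tq)); rewrite (rmorph0 (map_poly tq)).
  move: g0; rewrite {1}gE (rmorphD (map_poly tq)) (rmorphM (map_poly tq)) /=.
  rewrite Pdiv.RingMonic.rmodp_addl_mul_small ?monic_fq // size_fq.
  by rewrite (leq_ltn_trans (size_poly _ _)) // ltn_modpN0 // monic_neq0.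
apply: val_inj; rewrite eval_algE /= mk_monic_fq (rmorphM (map_poly tq)) /= mulrC.
by rewrite Pdiv.RingMonic.rmodp_mull // monic_fq.
Qed.

Lemma toQp_p_neq0 : toQp (p%:R : Z_p) != 0.
Proof. by rewrite -(rmorph0 tq) (inj_eq toQp_inj) padic_p_neq0. Qed.

Lemma eval_alg_p (a : A) : eval_alg p%:R * a = toQp p%:R *: a.
Proof. by rewrite toQp_scale polyC_natr. Qed.

Lemma eval_alg_p_inj : injective ( *%R (eval_alg p%:R)).
Proof.
move=> a b; rewrite !eval_alg_p => /(congr1 ( *:%R (toQp (p%:R : Z_p))^-1)).
by rewrite !scalerA mulVf ?toQp_p_neq0 // !scale1r.
Qed.

Lemma eval_alg_p_div (a : A) : exists b, eval_alg p%:R * b = a.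
Proof.
exists ((toQp (p%:R : Z_p))^-1 *: a).
by rewrite eval_alg_p scalerA divff ?toQp_p_neq0 // scale1r.
Qed.

Lemma clear_denominator (x : Q_p) : exists k (c : Z_p), toQp p%:R ^+ k * x = toQp c.
Proof.
have [n [d [d0 xd]]] := fraction_numden x.
have [k [u [uU dE]]] := padic_factor d0.
exists k, (n * u^-1); rewrite /toQp -(rmorphXn tq) (rmorphM tq) /= -xd dE.
rewrite -[LHS]mulr1 -(rmorph1 tq) -(divrr uU) !(rmorphM tq) /=; ring.
Qed.

Lemma clear_denominators (a : A) :
  exists k g, eval_alg p%:R ^+ k * a = eval_alg g.
Proof.
have sa : (size (a : {poly Q_p}) <= (size f).-1)%N.
  rewrite -ltnS prednK ?(ltnW f_size) //; apply: leq_trans (size_mk_monic a) _.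
  by rewrite mk_monic_fq size_fq.
have /choice[k /choice[c kc]] := clear_denominator.
pose ca i : Q_p := (a : {poly Q_p})`_i.
pose K := (\max_(i < size (a : {poly Q_p})) k (ca i))%N.
pose g : {poly Z_p} := \poly_(i < size (a : {poly Q_p})) (p%:R ^+ (K - k (ca i)) * c
  (ca i)).
exists K, g; have -> : eval_alg p%:R ^+ K * a = toQp (p%:R ^+ K) *: a.
  by rewrite toQp_scale polyC_exp polyC_natr rmorphXn.
apply: val_inj; transitivity (map_poly tq g); last first.
  apply/esym/in_qpoly_small; rewrite mk_monic_fq size_fq.
  rewrite (leq_ltn_trans (size_poly _ _)) // (leq_ltn_trans (size_poly _ _)) //.
  by rewrite (leq_ltn_trans sa) // prednK // ltnW.
apply/polyP => i; rewrite coefZ (coef_map tq) coef_poly -/(ca i).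
case: ltnP => [ia|ia]; last first.
  by rewrite /ca (nth_default 0 ia) mulr0; exact/esym/(rmorph0 tq).
transitivity (tq (p%:R ^+ (K - k (ca i))) * toQp (c (ca i)));
  last exact/esym/(rmorphM tq).
rewrite -kc mulrA; congr (_ * _); rewrite /toQp !(rmorphXn tq) /= -exprD subnK //.
exact: (leq_bigmax (Ordinal ia)).
Qed.

Lemma monogenicP (a : A) : monogenic_order a <-> exists g, a = eval_alg g.
Proof. by split=> [[g _ <-]|[g ->]]; exists g. Qed.

Lemma eval_algZ (c : Z_p) g : eval_alg (c *: g) = toQp c *: eval_alg g.
Proof. by rewrite toQp_scale -mul_polyC rmorphM. Qed.

Lemma eval_alg_span (g : {poly Z_p}) : exists c : 'I_(size f).-1 -> Z_p,
  eval_alg g = \sum_i toQp (c i) *: eval_alg 'X^i.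
Proof.
have gE := Pdiv.IdomainMonic.divp_eq f_monic g.
exists (fun i => (g %% f)`_i); rewrite {1}gE rmorphD (proj2 (eval_alg_eq0 _)) ?add0r;
  last first.
  by exists (g %/ f); rewrite mulrC.
have sr : (size (g %% f)%R <= (size f).-1)%N.
  by rewrite -ltnS prednK ?(ltnW f_size) // ltn_modpN0 // monic_neq0.
rewrite {1}(_ : g %% f = \sum_(i < (size f).-1) (g %% f)`_i *: 'X^i).
  by rewrite rmorph_sum; apply: eq_bigr => i _; exact: eval_algZ.
by rewrite -poly_def; apply/polyP => i; rewrite coef_poly; case: ltnP => // ri;
  rewrite nth_default // (leq_trans sr).
Qed.

Lemma alg_span (a : A) : exists c : 'I_(size f).-1 -> Q_p,
  a = \sum_i c i *: eval_alg 'X^i.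
Proof.
have [k [g ag]] := clear_denominators a; have [c gE] := eval_alg_span g.
exists (fun i => (toQp p%:R ^+ k)^-1 * toQp (c i)).
have -> : a = (toQp (p%:R : Z_p) ^+ k)^-1 *: eval_alg g.
  rewrite -ag (_ : _ * a = toQp p%:R ^+ k *: a) ?scalerA ?mulVf ?scale1r ?expf_neq0
    ?toQp_p_neq0 //.
  elim: k {ag} => [|k IHk]; first by rewrite !expr0 mul1r scale1r.
  by rewrite !exprS -mulrA IHk eval_alg_p scalerA.
by rewrite gE scaler_sumr; apply: eq_bigr => i _; rewrite scalerA.
Qed.

Lemma monogenic_is_order : is_order (@monogenic_order p p_pr f).
Proof.
split.
- by apply/monogenicP; exists 1; rewrite rmorph1.
- by move=> x y /monogenicP[g ->] /monogenicP[h ->]; apply/monogenicP; exists (g - h);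
  rewrite rmorphB.
- by move=> x y /monogenicP[g ->] /monogenicP[h ->]; apply/monogenicP; exists (g * h);
  rewrite rmorphM.
exists (size f).-1, (fun i => eval_alg 'X^i); split=> x; last exact: alg_span.
split=> [/monogenicP[g ->]|[c ->]]; first exact: eval_alg_span.
apply/monogenicP; exists (\sum_i c i *: 'X^i).
by rewrite rmorph_sum; apply: eq_bigr => i _; rewrite /= -eval_algZ.
Qed.

(** Cayley-Hamilton for a matrix of multiplication by [z] on the generators [s]: its characteristic
    polynomial at [z] kills every generator, hence kills [1]. *)
Lemma order_integral (O : set A) (z : A) : is_order O -> O z ->
  exists m (c : nat -> Z_p), c m = 1 /\ \sum_(i < m.+1) eval_alg (c i)%:P * z ^+ i = 0.
Proof.
move=> [one_O _ OM [m [s [Os _]]]] Oz.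
(* An empty family of generators would give [1 = 0]. *)
case: m s Os => [|m] s Os.
  have [c /eqP] := (Os 1).1 one_O; rewrite big_ord0 oner_eq0 //.
have Osi i : O (s i).
  apply/Os; exists (fun j => (i == j)%:R); rewrite (bigD1 i) //= eqxx.
  rewrite big1 => [|j ij]; first by rewrite addr0 [toQp 1](rmorph1 tq) scale1r.
  by rewrite eq_sym (negbTE ij) [toQp 0](rmorph0 tq) scale0r.
have /choice[M HM] : forall i, exists c : 'I_m.+1 -> Z_p, z * s i = \sum_j toQp (c j)
  *: s j.
  by move=> i; apply/Os/OM.
pose MM : 'M[Z_p]_m.+1 := \matrix_(i, j) M i j.
pose ev (P : {poly Z_p}) : A := \sum_(k < size P) eval_alg (P`_k)%:P * z ^+ k.
have evE n (P : {poly Z_p}) : (size P <= n)%N -> ev P = \sum_(k < n) eval_alg (P`_k)%:P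
  * z ^+ k.
  move=> Pn; rewrite -(big_mkord xpredT (fun k => eval_alg (P`_k)%:P * z ^+ k)).
  rewrite (big_cat_nat (n := size P)) //= [X in _ + X]big_nat_cond [X in _ + X]big1
    ?addr0 ?big_mkord //.
  by move=> k /andP[/andP[kP _] _]; rewrite nth_default // polyC0 !rmorph0 mul0r.
have evMX (P : {poly Z_p}) c : ev (P * 'X + c%:P) = ev P * z + eval_alg c%:P.
  rewrite (evE (size P).+1); last first.
    apply: leq_trans (size_polyD _ _) _; rewrite geq_max (leq_trans (size_polyMleq _
      _)) ?size_polyX ?addn2 //=.
    exact: leq_trans (size_polyC_leq1 _) _.
  rewrite big_ord_recl coefD coefMX coefC add0r mulr1 addrC; congr (_ + _).
  rewrite /ev mulr_suml; apply: eq_bigr => i _.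
  by rewrite coefD coefMX coefC addr0 /= -mulrA -exprSr.
have key (P : {poly Z_p}) i : ev P * s i = \sum_j toQp (horner_mx MM P i j) *: s j.
  elim/poly_ind: P i => [|P c IHP] i.
    by rewrite /ev size_poly0 big_ord0 mul0r rmorph0 big1 // => j _;
      rewrite mxE [toQp 0](rmorph0 tq) scale0r.
  rewrite evMX mulrDl -mulrA [z * _]mulrC mulrA.
  rewrite rmorphD rmorphM /= horner_mx_X horner_mx_C.
  transitivity (\sum_j toQp ((horner_mx MM P *m MM) i j) *: s j + toQp c *: s i).
    congr (_ + _); last by rewrite toQp_scale.
    rewrite IHP mulr_suml.
    transitivity (\sum_j \sum_l (toQp (horner_mx MM P i j) * toQp (M j l)) *: s l).
      by apply: eq_bigr => j _; rewrite -scalerAl [s j * z]mulrC HM scaler_sumr;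
        apply: eq_bigr => l _; rewrite scalerA.
    rewrite exchange_big; apply: eq_bigr => l _;
      rewrite mxE -scaler_suml /toQp (rmorph_sum tq); congr (_ *: _).
    by apply: eq_bigr => j _; rewrite (rmorphM tq) !mxE.
  have -> : toQp c *: s i = \sum_j toQp (c%:M i j) *: s j.
    rewrite (bigD1 i) //= mxE eqxx mulr1n big1 ?addr0 // => j ij.
    by rewrite mxE eq_sym (negbTE ij) [toQp 0](rmorph0 tq) scale0r.
  rewrite -big_split; apply: eq_bigr => j _; rewrite /= -scalerDl; congr (_ *: _).
  by rewrite [in RHS]mxE; exact/esym/(rmorphD tq).
have chi0 : ev (char_poly MM) = 0.
  have [c c1] := (Os 1).1 one_O.
  rewrite -[LHS]mulr1 c1 mulr_sumr big1 // => i _; rewrite -scalerAr key Cayley_Hamilton.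
  by rewrite big1 ?scaler0 // => j _; rewrite mxE [toQp 0](rmorph0 tq) scale0r.
exists m.+1, (fun i => (char_poly MM)`_i); split.
  by have /monicP := char_poly_monic MM; rewrite lead_coefE size_char_poly.
by rewrite -[RHS]chi0 /ev size_char_poly.
Qed.

Lemma redp_monic : redp f \is monic.
Proof. exact: monic_map. Qed.

(** The element [y = (G u + p v) / p] satisfies [y ^+ 2 = v y - u w], because
    [K ^+ 2 - p v K + p ^+ 2 u w = u f] for [K = p y]. So adjoining [y] gives an order. If [y] were
    already in Z_p[x]/(f), then modulo [p] one would get [g * redp u = g ^+ 2 * redp u * redp s],
    making [g] a unit. *)
Lemma not_maximal (g : {poly F}) : (1 < size g)%N -> in_sqr_ideal f g ->
  ~ is_maximal_order (@monogenic_order p p_pr f).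
Proof.
move=> g1 [G [u [v [w [Gg fE]]]]] [_ maxO].
pose K := G * u + p%:R * v; have [y yK] := eval_alg_p_div (eval_alg K).
have yy : y * y = eval_alg v * y - eval_alg (u * w).
  do 2!apply: eval_alg_p_inj.
  have -> : eval_alg p%:R * (eval_alg p%:R * (y * y)) = eval_alg (K ^+ 2).
    by rewrite expr2 rmorphM -yK; ring.
  have -> : eval_alg p%:R * (eval_alg p%:R * (eval_alg v * y - eval_alg (u * w)))
      = eval_alg (p%:R * v * K - p%:R * p%:R * (u * w)).
    by rewrite rmorphB !rmorphM -yK; ring.
  apply/eqP; rewrite -subr_eq0 -rmorphB; apply/eqP/eval_alg_eq0.
  by exists u; rewrite [in RHS]fE /K; ring.
pose O' : set A := fun a => exists s t, a = eval_alg s + eval_alg t * y.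
have O'ord : is_order O'.
  split.
  - by exists 1, 0; rewrite rmorph1 rmorph0 mul0r addr0.
  - move=> _ _ [a [b ->]] [c [d ->]]; exists (a - c), (b - d).
    by rewrite !rmorphB; ring.
  - move=> _ _ [a [b ->]] [c [d ->]].
    exists (a * c - b * d * (u * w)), (a * d + b * c + b * d * v).
    rewrite rmorphB !rmorphD !rmorphM -!rmorphM.
    transitivity (eval_alg a * eval_alg c + (eval_alg a * eval_alg d + eval_alg b *
      eval_alg c) * y +
       eval_alg b * eval_alg d * (y * y)); first by ring.
    by rewrite yy !rmorphM; ring.
  exists ((size f).-1 + (size f).-1)%N, (fun i => match fintype.split i with inl j =>
    eval_alg 'X^j | inr j => eval_alg 'X^j * y end).
  split=> x; last first.
    have [c xE] := alg_span x.
    exists (fun i => match fintype.split i with inl j => c j | inr j => 0 end).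
    rewrite big_split_ord /= [X in _ + X]big1 ?addr0 => [|i _].
      by rewrite {1}xE; apply: eq_bigr => i _; rewrite (unsplitK (inl i)).
    by rewrite (unsplitK (inr i)) scale0r.
  split=> [[a [b ->]]|[c ->]].
    have [ca aE] := eval_alg_span a; have [cb bE] := eval_alg_span b.
    exists (fun i => match fintype.split i with inl j => ca j | inr j => cb j end).
    rewrite big_split_ord aE bE mulr_suml; congr (_ + _); apply: eq_bigr => i _.
      by rewrite (unsplitK (inl i)).
    by rewrite (unsplitK (inr i)) scalerAl.
  exists (\sum_i c (lshift _ i) *: 'X^i), (\sum_i c (rshift _ i) *: 'X^i).
  rewrite big_split_ord !rmorph_sum mulr_suml; congr (_ + _); apply: eq_bigr => i _.
    by rewrite (unsplitK (inl i)) -eval_algZ.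
  by rewrite (unsplitK (inr i)) scalerAl -eval_algZ.
have OO' : (monogenic_order (f := f) `<=` O')%classic.
  by move=> _ /monogenicP[h ->]; exists h, 0; rewrite rmorph0 mul0r addr0.
have : O' y by exists 0, 1; rewrite rmorph0 rmorph1 mul1r add0r.
rewrite (maxO _ O'ord OO') => /monogenicP[t yt].
have [s sE] : exists s, K - p%:R * t = f * s.
  by apply/eval_alg_eq0; rewrite rmorphB rmorphM -yK yt subrr.
have := congr1 redp sE; rewrite /K !redpE !mul0r subr0 addr0 Gg.
have f0E : redp f = g ^+ 2 * redp u by rewrite fE !redpE Gg expr0n /= !mul0r !addr0.
have f0 : redp f != 0 by rewrite monic_neq0 // redp_monic.
have gu0 : g * redp u != 0.
  by apply: contraNneq f0 => gu; rewrite f0E expr2 -mulrA gu mulr0.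
rewrite f0E => e; have e1 : g * redp u = g * redp u * (g * redp s) by rewrite [LHS]e;
  ring.
have : g * redp s = 1 by apply: (mulfI gu0); rewrite mulr1 -e1.
move=> gs1; have : g %| 1 by rewrite -gs1 dvdp_mulr.
by rewrite dvdp1 gtn_eqF.
Qed.

Lemma monic_irreducible_dvd (h : {poly F}) : (1 < size h)%N ->
  exists g : {poly F}, [/\ g \is monic, irreducible_poly g & g %| h].
Proof.
move=> h1; have [|g gI gh] := @exists_monic_irr_dvd _ (size h) h;
  first by rewrite h1 leqnn.
by exists g; move: gI; rewrite inE => /andP[gm /irreducibleP].
Qed.

(* [q] lies in the maximal ideal [(p, g)] and [r] is a unit modulo it, so
   [q z = r] contradicts the integrality of [z]. *)
Lemma not_integral (g : {poly F}) (q r : {poly Z_p}) (z : A) m (c : nat -> Z_p) :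
  (1 < size g)%N -> g %| redp f -> g %| redp q -> coprimep g (redp r) ->
  eval_alg q * z = eval_alg r -> c m = 1 ->
  \sum_(i < m.+1) eval_alg (c i)%:P * z ^+ i = 0 -> False.
Proof.
move=> g1 gf gq gr qz cm cz.
(* The integral equation of [z] multiplied by [q ^+ m] becomes a relation between [q] and [r];
   modulo [g] only its term [r ^+ m] survives. *)
have [h hE] : exists h, \sum_(i < m.+1) (c i)%:P * q ^+ (m - i) * r ^+ i = f * h.
  apply/eval_alg_eq0; rewrite rmorph_sum -[RHS](mulr0 (eval_alg q ^+ m)) -[in RHS]cz
    mulr_sumr.
  apply: eq_bigr => i _; rewrite !rmorphM !rmorphXn -qz exprMn.
  have -> : eval_alg q ^+ m = eval_alg q ^+ (m - i) * eval_alg q ^+ i.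
    by rewrite -exprD subnK // -ltnS.
  move: (eval_alg q ^+ (m - i)) => qi; ring.
have := congr1 redp hE; rewrite redpM big_ord_recr /= subnn cm !redpE.
rewrite !expr0 !mul1r => e.
have gs : g %| redp (\sum_(i < m) (c i)%:P * q ^+ (m - i) * r ^+ i).
  apply: (big_ind (fun x => g %| redp x)) => [|x y gx gy|i _].
  - by rewrite rmorph0 dvdp0.
  - by rewrite redpD dvdp_add.
  rewrite !redpE -subSS subSn // exprS.
  by rewrite dvdp_mulr // dvdp_mull // dvdp_mulr.
have : g %| redp r ^+ m by rewrite -(dvdp_addr _ gs) e dvdp_mulr.
move=> gr'; have := coprimep_expr m gr; rewrite /coprimep => /eqP gg1.
have : g %| gcdp g (redp r ^+ m) by rewrite dvdp_gcd dvdpp.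
have: gcdp g (redp r ^+ m) != 0 by rewrite -size_poly_gt0 gg1.
by move=> n0 /(dvdp_leq n0); rewrite gg1 leqNgt g1.
Qed.

(** For the converse, a strictly larger order contains some [z] with [p z = K], where [K] lifts the
    quotient [m0] of [redp f] by an irreducible [g]. Writing [f = G K + p h] gives also [G z = - h].
    As [z] is integral, [g] divides the reductions of both [K] and [h], which puts [f] in the square
    of [(p, G)]. *)
Lemma maximalP :
  is_maximal_order (@monogenic_order p p_pr f) <->
  (forall g : {poly F}, g \is monic -> irreducible_poly g -> ~ in_sqr_ideal f g).
Proof.
split=> [maxf g gm [g1 _] gf|nsq]; first exact: not_maximal gf maxf.
split=> [|S Sord sub_S]; first exact: monogenic_is_order.
apply/seteqP; split=> // a Sa; apply: contrapT => nOa.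
have [S1 SB SM _] := Sord.
have Se g : S (eval_alg g) by apply: sub_S; exists g.
(* Some [p ^+ k * a] lies in Z_p[x]/(f); [y] is the last multiple of this kind still outside. *)
have [y [K1 [Sy nOy yK1]]] : exists y K1,
    [/\ S y, ~ monogenic_order y & eval_alg p%:R * y = eval_alg K1].
  have [k [g]] := clear_denominators a; elim: k a Sa nOa => [|k IHk] a Sa nOa.
    by rewrite expr0 mul1r => ag; case: nOa; apply/monogenicP; exists g.
  rewrite exprSr -mulrA => ag.
  have [/monogenicP[h hE]|nO] := pselect (monogenic_order (eval_alg p%:R * a)).
    by exists a, h.
  by apply: IHk ag => //; apply: SM.
have f0m := redp_monic; have f00 := monic_neq0 f0m.
have nf0 : ~~ (redp f %| redp K1).
  apply/negP => /dvdpP[h hE]; apply: nOy; apply/monogenicP.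
  have /redp_eq0P[t tE] : redp (K1 - liftp p_pr h * f) = 0 by rewrite !redpE hE subrr.
  exists t; apply: eval_alg_p_inj; rewrite yK1 -rmorphM -tE.
  apply/eqP; rewrite -subr_eq0 -rmorphB; apply/eqP/eval_alg_eq0.
  by exists (liftp p_pr h); ring.
(* By [nf0] the quotient of [redp f] by [d] is not constant and has an irreducible factor [g]. The
   quotient of [redp f] by [g] is then a multiple of [d], hence a combination of [redp f] and
   [redp K1]; this is why [m0 / p] can be lifted into the larger order. *)
pose d := gcdp (redp f) (redp K1).
have df : d %| redp f := dvdp_gcdl _ _.
have [g [gm gI /dvdpP[e eE]]] : exists g : {poly F},
    [/\ g \is monic, irreducible_poly g & g %| redp f %/ d].
  apply: monic_irreducible_dvd; rewrite ltnNge; apply: contra nf0 => sfd.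
  have /size_poly1P[c c0 cE] : size (redp f %/ d) == 1%N.
    rewrite eqn_leq sfd size_poly_gt0; apply: contraNneq f00 => fd0.
    by rewrite -(divpK df) fd0 mul0r.
  rewrite -(divpK df) cE mul_polyC dvdpZl //; exact: dvdp_gcdr.
have g1 := gI.1; pose m0 := e * d.
have fgm : redp f = g * m0 by rewrite -{1}(divpK df) eE /m0; ring.
have [[al be] /= /eqpP[[c1 c2] /= /andP[c10 c20] ab]] := Bezoutp (redp f) (redp K1).
have mE : m0 = (c2^-1 * c1) *: (e * al) * redp f + (c2^-1 * c1) *: (e * be) * redp K1.
  rewrite /m0 -!scalerAl -scalerDr -scalerA.
  have -> : e * al * redp f + e * be * redp K1 = e * (al * redp f + be * redp K1) by ring.
  by rewrite scalerAr ab -scalerAr scalerA mulVf // scale1r.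
move: ((c2^-1 * c1) *: (e * al)) ((c2^-1 * c1) *: (e * be)) mE => {ab c10 c20 c1
  c2}{}al {}be mE.
pose K := liftp p_pr m0; pose G := liftp p_pr g.
have [z Sz zK] : exists2 z, S z & eval_alg p%:R * z = eval_alg K.
  have /redp_eq0P[t tE] : redp (liftp p_pr be * K1 + liftp p_pr al * f - K) = 0.
    by rewrite !redpE mE; ring.
  exists (eval_alg (liftp p_pr be) * y - eval_alg t); first by apply: SB => //; exact: SM.
  rewrite mulrBr mulrCA yK1 -!rmorphM -tE -rmorphB; apply/eqP; rewrite -subr_eq0 -rmorphB.
  by apply/eqP/eval_alg_eq0; exists (- liftp p_pr al); ring.
have /redp_eq0P[h hE] : redp (f - G * K) = 0 by rewrite !redpE fgm subrr.
have Gz : eval_alg G * z = eval_alg (- h).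
  apply: eval_alg_p_inj; rewrite mulrCA zK -!rmorphM; apply/eqP.
  rewrite -subr_eq0 -rmorphB; apply/eqP/eval_alg_eq0; exists 1.
  by rewrite mulrN -hE; ring.
have [m [c [cm cz]]] := order_integral Sord Sz.
have gf : g %| redp f by rewrite fgm dvdp_mulr.
have cop (r : {poly F}) : ~~ (g %| r) -> coprimep g r.
  by move=> gr; rewrite irreducible_poly_coprime.
(* Integrality is used twice, with the equations [p z = K] and [G z = - h]. *)
have [gm0|gm0] := boolP (g %| m0); last first.
  apply: (not_integral g1 gf _ _ zK cm cz); first by rewrite redp_p dvdp0.
  by rewrite liftpK cop.
have [gh|gh] := boolP (g %| redp h); last first.
  apply: (not_integral g1 gf _ _ Gz cm cz); first by rewrite liftpK dvdpp.
  by rewrite redpN cop // dvdpNr.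
apply: (nsq g gm gI).
move/dvdpP: gm0 => [m' m'E]; move/dvdpP: gh => [v vE].
have /redp_eq0P[t tE] : redp (K - G * liftp p_pr m') = 0 by rewrite !redpE m'E; ring.
have /redp_eq0P[w wE] : redp (h - G * liftp p_pr v) = 0 by rewrite !redpE vE; ring.
exists G, (liftp p_pr m'), (t + liftp p_pr v), w; split; first exact: liftpK.
have -> : f = G * K + p%:R * h by rewrite -hE; ring.
have -> : K = G * liftp p_pr m' + p%:R * t by rewrite -tE; ring.
have -> : h = G * liftp p_pr v + p%:R * w by rewrite -wE; ring.
ring.
Qed.

End MaximalOrder.

(** * The discriminant *)

Section Determinant.
Variables (p : nat) (p_pr : prime p) (N : nat) (M : 'M[padic_int p_pr]_N).
Local Notation Z_p := (padic_int p_pr).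
Local Notation F := 'F_p.

Let red : {rmorphism Z_p -> 'F_p} := @reduction p p_pr.
Local Notation redm := (map_mx red).
Local Notation r := (\rank (redm M)).

Lemma redm_lift m k (B : 'M[F]_(m, k)) : redm (map_mx (@padic_lift p p_pr) B) = B.
Proof. by apply/matrixP => i j; rewrite !mxE [LHS]padic_liftK. Qed.

Lemma redm_eq0P m k (B : 'M[Z_p]_(m, k)) : redm B = 0 <-> exists C, B = p%:R *: C.
Proof.
split=> [B0|[C ->]].
  exists (map_mx (@divp_p p p_pr) B); apply/matrixP => i j; rewrite !mxE divp_pK //.
  by have /matrixP/(_ i j) := B0; rewrite !mxE.
by apply/matrixP => i j; rewrite !mxE (rmorphM red) (rmorph_nat red) (red_p p_pr) mul0r.
Qed.

(** [P] lifts the row operations that bring the reduction of [M] to rank-normal form up to column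
    operations. The rows of [P *m M] from index [r] on are then divisible by [p], and [D] carries
    these factors, one for each unit of corank. *)
Let P : 'M[Z_p]_N := map_mx (@padic_lift p p_pr) (invmx (col_ebase (redm M))).
Let D : 'M[Z_p]_N := diag_mx (\row_i (if (i < r)%N then 1 else p%:R)).

Lemma det_unit_lift : \det P \is a GRing.unit.
Proof.
rewrite unit_padicE -[reduction _]/(red _) -det_map_mx redm_lift.
by rewrite -unitfE -unitmxE unitmx_inv col_ebase_unit.
Qed.

Lemma row_echelon : redm P *m redm M = pid_mx r *m row_ebase (redm M).
Proof.
by rewrite redm_lift -{2}[redm M]mulmx_ebase !mulmxA mulVmx ?col_ebase_unit // mul1mx.
Qed.

Lemma det_D : \det D = p%:R ^+ (N - r).
Proof.
have rN : (r <= N)%N by exact: rank_leq_row.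
rewrite det_diag; under eq_bigr => i _ do rewrite mxE.
rewrite -(big_mkord xpredT (fun i => if (i < r)%N then 1 else p%:R : Z_p)).
rewrite (big_cat_nat (n := r)) //= big_nat_cond big1 => [|i /andP[/andP[_ ->]] //].
rewrite mul1r big_nat_cond (eq_bigr (fun=> p%:R)) => [|i /andP[/andP[ri _] _]].
  by rewrite -big_nat_cond prodr_const_nat.
by rewrite ltnNge ri.
Qed.

Lemma factor_D : exists C, P *m M = D *m C.
Proof.
exists (\matrix_(i, j) if (i < r)%N then (P *m M) i j else divp_p ((P *m M) i j)).
apply/matrixP => i j; rewrite mul_diag_mx [in RHS]mxE [X in X * _]mxE [X in _ * X]mxE.
case: ltnP => ri; first by rewrite mul1r.
rewrite divp_pK //; have /matrixP/(_ i j) := row_echelon.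
rewrite -map_mxM [in LHS]mxE => ->; rewrite mxE big1 // => k _.
by rewrite mxE [(i < r)%N]ltnNge ri andbF mul0r.
Qed.

Lemma dvd_det_corank k : (r + k <= N)%N -> padic_dvd (p%:R ^+ k) (\det M).
Proof.
move=> rk; have [C PC] := factor_D; have := congr1 determinant PC.
rewrite !det_mulmx det_D => e.
exists ((\det P)^-1 * p%:R ^+ (N - r - k) * \det C).
have -> : p%:R ^+ k * ((\det P)^-1 * p%:R ^+ (N - r - k) * \det C) =
  (\det P)^-1 * (p%:R ^+ (N - r - k + k) * \det C) by rewrite exprD mulrCA -!mulrA;
    congr (_ * _); rewrite mulrCA.
by rewrite subnK ?leq_subRL ?rank_leq_row // -e mulKr // det_unit_lift.
Qed.

(** In corank one, [p ^+ 2] dividing [\det M] makes the cofactor [C] singular modulo [p]. A kernel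
    vector of [C] modulo [p], carried back through [D' *m P] with [D' *m D = p], is a vector that
    [M] kills even modulo [p ^+ 2]. *)
Lemma corank1_kernel : (r.+1 = N)%N -> padic_dvd (p%:R ^+ 2) (\det M) ->
  exists s : 'rV[Z_p]_N, redm s != 0 /\ exists t, s *m M = p%:R ^+ 2 *: t.
Proof.
move=> rN [x detM]; have [C PC] := factor_D; have := congr1 determinant PC.
have Nr : (N - r = 1)%N by move: rN; move: r => k <-; rewrite subSnn.
rewrite !det_mulmx det_D Nr expr1 detM expr2 -!mulrA mulrCA.
move=> /(mulfI (padic_p_neq0 p_pr)) e.
have /eqP/det0P[y y0 yC] : \det (redm C) = 0.
  by rewrite det_map_mx -e; apply/reduction_eq0P; exists (\det P * x); rewrite mulrCA.
pose D' : 'M[Z_p]_N := diag_mx (\row_i (if (i < r)%N then p%:R else 1)).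
have D'D : D' *m D = p%:R%:M.
  apply/matrixP => i j; rewrite mul_diag_mx !mxE.
  by case: (i == j); rewrite ?mulr0n ?mulr0 // !mulr1n; case: ifP; rewrite ?mulr1 ?mul1r.
pose yl := map_mx (@padic_lift p p_pr) y.
have [z zE] : exists z, yl *m C = p%:R *: z by apply/redm_eq0P; rewrite map_mxM redm_lift.
exists (yl *m D' *m P); split; last first.
  exists z; rewrite -mulmxA PC mulmxA -(mulmxA yl) D'D scalar_mxC -mulmxA zE.
  by rewrite mul_scalar_mx scalerA.
have PU : redm P \in unitmx by rewrite redm_lift unitmx_inv col_ebase_unit.
rewrite !map_mxM redm_lift; apply: contraNneq y0 => /(congr1 (mulmx^~ (invmx (redm P)))).
rewrite mulmxK // mul0mx => yD'.
(* If [s] vanished modulo [p], then [y] would be supported on the indices below [r], where [D] is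
   the identity; [y *m redm C = 0] would then give [y *m pid_mx r = 0], so [y = 0]. *)
have y_ge (i : 'I_N) : (r <= i)%N -> y 0 i = 0.
  move=> ri; have /rowP/(_ i) := yD'; rewrite /D' map_diag_mx mul_mx_diag !mxE ltnNge
    ri /=.
  by rewrite (rmorph1 red) mulr1.
have yD : y *m redm D = y.
  rewrite /D map_diag_mx mul_mx_diag; apply/rowP => i; rewrite !mxE.
  case: ltnP => ri; first by rewrite (rmorph1 red) mulr1.
  by rewrite y_ge // mul0r.
have : y *m pid_mx r *m row_ebase (redm M) = 0.
  rewrite -mulmxA -row_echelon -map_mxM PC map_mxM mulmxA yD; exact: yC.
move=> /(congr1 (mulmx^~ (invmx (row_ebase (redm M))))).
rewrite mulmxK ?row_ebase_unit // mul0mx => yr.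
apply/eqP/rowP => i; rewrite mxE; case: (leqP r i) => [/y_ge //|ir].
have /rowP/(_ i) := yr; rewrite !mxE (bigD1 i) //= mxE eqxx ir mulr1.
by rewrite big1 ?addr0 // => j ji; rewrite mxE (inj_eq val_inj) (negbTE ji) mulr0.
Qed.

End Determinant.

(** * Squarefreeness and derivatives over the prime field *)

Section PrimeField.
Variables (p : nat) (p_pr : prime p).
Local Notation F := 'F_p.

(** If the derivative vanishes, only exponents divisible by [p] occur, and since Frobenius fixes the
    coefficients [g] is the [p]th power of [h], contrary to irreducibility. *)
Lemma irreducible_deriv_neq0 (g : {poly F}) : irreducible_poly g -> g^`() != 0.
Proof.
move=> [g1 gI]; apply/eqP => g'0.
have chp : p \in [pchar {poly F}] by rewrite pchar_poly pchar_Fp.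
have gi i : ~~ (p %| i)%N -> g`_i = 0.
  case: i => [|i] pi; first by rewrite dvdn0 in pi.
  have /eqP := coef_deriv g i; rewrite g'0 coef0 eq_sym -mulr_natr mulf_eq0 =>
    /orP[/eqP //|].
  by rewrite -(dvdn_pcharf (pchar_Fp p_pr)) (negbTE pi).
pose h : {poly F} := \poly_(j < size g) g`_(p * j).
have gE : g = h ^+ p.
  rewrite -(pFrobenius_autE chp) /h poly_def rmorph_sum /=; apply/polyP => i.
  rewrite coef_sum; under eq_bigr => j _ do
    rewrite pFrobenius_autE exprZn -exprM coefZ coefXn.
  have [/dvdnP[j ->]|pi] := boolP (p %| i)%N; last first.
    rewrite gi // big1 // => j _; rewrite [(i == _)%N](_ : _ = false) ?mulr0 //.
    by apply: contraNF pi => /eqP ->; rewrite dvdn_mull.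
  have [jg|gj] := ltnP j (size g).
    rewrite (bigD1 (Ordinal jg)) //= eqxx mulr1 -[X in _ ^+ X](card_Fp p_pr) expf_card
      [(p * _)%N]mulnC.
    rewrite big1 ?addr0 // => l lj; rewrite eqn_pmul2r ?prime_gt0 //.
    by rewrite eq_sym -[j]/(nat_of_ord (Ordinal jg)) (inj_eq val_inj) (negbTE lj) mulr0.
  rewrite nth_default; last by rewrite (leq_trans gj) // leq_pmulr // prime_gt0.
  rewrite big1 // => l _; rewrite eqn_pmul2r ?prime_gt0 //.
  by rewrite gtn_eqF ?mulr0 // (leq_trans (ltn_ord l)).
have h1 : size h != 1%N.
  apply: contraTneq g1 => h1; rewrite gE; have /eqP/size_poly1P[c _ ->] := h1.
  by rewrite -polyC_exp ltnNge size_polyC_leq1.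
have /(_ _)/eqp_size := gI h h1; rewrite {1}gE -[X in _ ^+ X](prednK (prime_gt0 p_pr)).
rewrite exprS dvdp_mulr // => /(_ isT) hg.
have : (size g).-1 = ((size h).-1 * p)%N by rewrite gE size_exp.
rewrite hg; move: g1 (prime_gt1 p_pr); move: (size g) => x x1 p1 xE; nia.
Qed.

Lemma sqr_dvd_deriv (f g : {poly F}) : irreducible_poly g -> g %| f -> g %| f^`() ->
  g ^+ 2 %| f.
Proof.
move=> gI /dvdpP[u ->]; rewrite derivM dvdp_addr; last exact: dvdp_mull.
have gg' : coprimep g g^`().
  rewrite irreducible_poly_coprime //; apply/negP => /(dvdp_leq (irreducible_deriv_neq0
    gI)).
  by rewrite leqNgt lt_size_deriv // -size_poly_gt0 ltnW // gI.1.
by rewrite Gauss_dvdpl // => gu; rewrite expr2 dvdp_mul.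
Qed.

Lemma sqfree_coprime_deriv N (f : {poly F}) : (1 < size f <= N)%N ->
  sqfree N f = coprimep f f^`().
Proof.
move=> /andP[f1 fN]; have f0 : f != 0 by rewrite -size_poly_gt0 ltnW.
apply/forall_inP/idP => [sf|cf g]; last first.
  rewrite inE => /andP[_ /irreducibleP[g1 _]]; apply/negP => /dvdpP[u fE].
  have : (g : {poly F}) %| gcdp f f^`().
    rewrite dvdp_gcd fE derivM expr2; apply/andP; split; first by rewrite mulrA dvdp_mull.
    apply/dvdpP; exists (u^`() * g + u * g^`() + u * g^`()).
    by rewrite derivM; ring.
  rewrite (eqp_dvdr _ (_ : gcdp f f^`() %= 1)) ?dvdp1;
    last by rewrite -size_poly_eq1 -coprimep_def.
  by rewrite gtn_eqF.
apply: contraT => ncf.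
have g1 : (1 < size (gcdp f f^`()) <= N)%N.
  rewrite (leq_trans (dvdp_leq f0 (dvdp_gcdl _ _))) // andbT ltn_neqAle eq_sym.
  by rewrite -coprimep_def ncf size_poly_gt0 gcdp_eq0 negb_and f0.
have [g gI] := exists_monic_irr_dvd g1; rewrite dvdp_gcd => /andP[gf gf'].
have := sf g gI; rewrite sqr_dvd_deriv //.
by move: gI; rewrite inE => /andP[_ /irreducibleP].
Qed.

End PrimeField.

(** * Valuation of the discriminant through the Sylvester matrix *)

Section Discriminant.
Variables (p : nat) (p_pr : prime p) (f : {poly padic_int p_pr}).
Hypotheses (f_monic : f \is monic) (f_size : (2 < size f)%N).
Local Notation Z_p := (padic_int p_pr).
Local Notation F := 'F_p.
Local Notation redp := (map_poly (@reduction p p_pr)).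
Local Notation M := (Sylvester_mx f f^`()).

Let red : {rmorphism Z_p -> 'F_p} := @reduction p p_pr.
Local Notation redm := (map_mx red).

Lemma natr_padic_neq0 n : (0 < n)%N -> (n%:R : Z_p) != 0.
Proof.
move=> n0; apply/eqP => /padicP/(_ n).
have -> : residue (0 : Z_p) n = 0%N by exact: mod0n.
rewrite residue_nat modn_small; last exact/ltn_expl/prime_gt1.
by move=> nE; rewrite nE in n0.
Qed.

(** Z_p has characteristic zero, so the leading coefficient of the derivative is nonzero even when
    [p] divides the degree of [f]. *)
Lemma size_deriv_gt1 : (1 < size f^`())%N.
Proof.
have fE := prednK (ltnW (ltnW f_size)).
have : f^`()`_(size f).-2 != 0.
  rewrite coef_deriv -mulr_natr mulf_neq0 ?natr_padic_neq0 //.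
  have -> : (size f).-2.+1 = (size f).-1 by rewrite prednK // -ltnS fE ltnW.
  by move: f_monic; rewrite monicE lead_coefE => /eqP ->; rewrite oner_neq0.
by move=> h; apply: contraR h; rewrite -leqNgt => h; rewrite nth_default //;
  apply: leq_trans h _; case: (size f) f_size => [|[|[|]]].
Qed.

Lemma padic_dvd_disc k : padic_dvd (p%:R ^+ k) (disc f) <-> padic_dvd (p%:R ^+ k) (\det
  M).
Proof.
rewrite /disc /resultant; split=> [[z zE]|[z ->]].
  by exists ((-1) ^+ 'C((size f).-1, 2) * z);
    rewrite mulrCA -zE mulrA -exprMn mulrNN mul1r expr1n mul1r.
by exists ((-1) ^+ 'C((size f).-1, 2) * z); rewrite mulrCA.
Qed.

Lemma rVpoly_Sylvester (s : 'rV[Z_p]_((size f^`()).-1 + (size f).-1)) :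
  rVpoly (s *m M) = rVpoly (lsubmx s) * f + rVpoly (rsubmx s) * f^`().
Proof.
rewrite -{1}[s]hsubmxK mul_row_col !mul_rV_lin1 /= linearD /=.
have sz (a b : nat) (u : 'rV[Z_p]_a) (g : {poly Z_p}) : (size g).-1 = b -> (0 < size
  g)%N ->
    (size (rVpoly u * g)%R <= a + b)%N.
  move=> <- g0; apply: leq_trans (size_polyMleq _ _) _.
  by have : (size (rVpoly u) <= a)%N := size_poly _ _;
    move: (size (rVpoly u)) (size g) g0 => x y; lia.
congr (_ + _); rewrite poly_rV_K //.
  by apply: sz => //; rewrite ltnW // ltnW.
by rewrite addnC; apply: sz => //; rewrite ltnW // size_deriv_gt1.
Qed.

Local Notation f0 := (redp f).
Local Notation f0' := (redp f)^`().
Local Notation dim := ((size f^`()).-1 + (size f).-1)%N.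

Lemma redp_deriv : redp f^`() = f0'.
Proof. by rewrite (deriv_map red). Qed.

Lemma size_red_monic : size f0 = size f.
Proof.
by rewrite (size_map_poly_id0 (f := @reduction p p_pr)) // (monicP f_monic) (rmorph1
  red) oner_eq0.
Qed.

Lemma red_monic_neq0 : f0 != 0.
Proof. by rewrite -size_poly_gt0 size_red_monic ltnW // ltnW. Qed.

(** The reduced matrix keeps the dimensions set by the derivative over Z_p, while [f0'] may have
    smaller degree when [p] divides the degree of [f]. Lifting [y] gives the formula in all
    cases. *)
Lemma rVpoly_red_Sylvester (y : 'rV[F]_dim) :
  rVpoly (y *m redm M) = rVpoly (lsubmx y) * f0 + rVpoly (rsubmx y) * f0'.
Proof.
rewrite -[y](redm_lift p_pr) -map_mxM -map_rVpoly rVpoly_Sylvester.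
rewrite [LHS]redpD !redpM redp_deriv.
by congr (_ * _ + _ * _); rewrite (map_rVpoly red) ?map_lsubmx ?map_rsubmx.
Qed.

Lemma red_Sylvester_eq0 (y : 'rV[F]_dim) : y *m redm M = 0 <->
  rVpoly (lsubmx y) * f0 + rVpoly (rsubmx y) * f0' = 0.
Proof.
rewrite -rVpoly_red_Sylvester; split=> [->|]; first by rewrite linear0.
by move=> /(congr1 (@poly_rV _ dim)); rewrite rVpolyK linear0.
Qed.

Lemma resultant_ideal : exists U V : {poly Z_p},
  (resultant f f^`())%:P = U * f + V * f^`().
Proof.
have [[U V] _ /= e] := resultant_in_ideal (ltnW f_size) size_deriv_gt1.
by exists U, V.
Qed.

(** A kernel vector modulo [p] is a relation [U * f0 + V * f0' = 0]; if [f0] and [f0'] are coprime,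
    then [f0] divides [V], whose degree is too small. Conversely, a common factor divides the
    resultant modulo [p], a constant. *)
Lemma dvd_disc_coprime : padic_dvd p%:R (disc f) <-> ~~ coprimep f0 f0'.
Proof.
rewrite -[p%:R]expr1 padic_dvd_disc expr1 -reduction_eq0P.
split=> [det0|]; last first.
  rewrite coprimep_def; set d := gcdp _ _ => d1.
  have [U [V e]] := resultant_ideal; have := congr1 redp e.
  rewrite !redpE redp_deriv (map_polyC red) /= => e0.
  have dd : d %| (reduction (resultant f f^`()))%:P.
    by rewrite e0 dvdp_add // dvdp_mull // ?dvdp_gcdl ?dvdp_gcdr.
  apply/eqP; apply: contraNT d1 => r0; move: dd.
  by rewrite (eqp_dvdr _ (_ : _ %= 1)) ?dvdp1 // -size_poly_eq1 size_polyC r0.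
apply/negP => cop.
have /eqP/det0P[y y0 /red_Sylvester_eq0 e] : \det (redm M) = 0 by rewrite det_map_mx.
have V0 : rVpoly (rsubmx y) = 0.
  apply/eqP; apply: contraT => V0.
  have : f0 %| rVpoly (rsubmx y).
    rewrite -(Gauss_dvdpl _ cop); apply/dvdpP; exists (- rVpoly (lsubmx y)).
    by rewrite mulNr; apply/eqP; rewrite -addr_eq0 addrC e.
  move=> /(dvdp_leq V0); rewrite size_red_monic leqNgt.
  by rewrite (leq_ltn_trans (size_poly _ _)) // prednK // ltnW // ltnW.
move: e; rewrite V0 mul0r addr0 => /eqP; rewrite mulf_eq0 (negbTE red_monic_neq0) orbF
  => /eqP U0.
case/negP: y0; apply/eqP; rewrite -[y]hsubmxK -[lsubmx y]rVpolyK -[rsubmx y]rVpolyK.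
by rewrite U0 V0 !linear0 row_mx0.
Qed.

(** If the gcd [d] has degree at least 2, the cofactor relation between [f0] and [f0'] and its
    multiple by ['X] both fit in the kernel, and they are independent. *)
Lemma corank_gcd : (2 < size (gcdp f0 f0'))%N -> (\rank (redm M) + 2 <= dim)%N.
Proof.
set d := gcdp _ _ => d2.
have d0 : d != 0 by rewrite -size_poly_gt0 ltnW // ltnW.
have fd : f0 = f0 %/ d * d by rewrite divpK // dvdp_gcdl.
have f'd : f0' = f0' %/ d * d by rewrite divpK // dvdp_gcdr.
set h := f0 %/ d in fd; set H := f0' %/ d in f'd.
have h0 : h != 0 by apply: contraTneq red_monic_neq0 => h0; rewrite fd h0 mul0r eqxx.
pose K : 'M[F]_(2, dim) := \matrix_(i < 2) row_mx (poly_rV (- H * 'X^i)) (poly_rV (h *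
  'X^i)).
have size_div (g k : {poly F}) m (i : 'I_2) : g = k * d -> (size g <= m)%N -> (size (k
  * 'X^i)%R <= m.-1)%N.
  move=> gkd gm; have [->|k0] := eqVneq k 0; first by rewrite mul0r size_poly0.
  have := size_mul k0 d0; rewrite -gkd size_mulXn // => gs.
  by move: gm (ltn_ord i) d2 (size_poly_eq0 k); rewrite (negbTE k0) gs;
    move: (size k) (size d) => x y; case: (nat_of_ord i) => [|[|]] //=; lia.
have sH (i : 'I_2) : (size (- H * 'X^i)%R <= (size f^`()).-1)%N.
  by rewrite mulNr size_polyN (size_div f0' H) // -redp_deriv size_poly.
have sh (i : 'I_2) : (size (h * 'X^i)%R <= (size f).-1)%N.
  by rewrite (size_div f0 h) // size_red_monic.
have rK : \rank K = 2%N.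
  apply/eqP; apply: inj_row_free => v vK.
  have vh : \sum_i v 0 i *: (h * 'X^i) = 0.
    transitivity (rVpoly (rsubmx (v *m K))); last by rewrite vK !linear0.
    rewrite mulmx_sum_row !linear_sum; apply: eq_bigr => i _.
    by rewrite !linearZ /= rowK row_mxKr poly_rV_K.
  rewrite -[v]rVpolyK; have -> : rVpoly v = 0; last by rewrite linear0.
  apply: (mulfI h0); rewrite mulr0 -vh /rVpoly poly_def mulr_sumr; apply: eq_bigr => i _.
  by rewrite valK -scalerAr.
rewrite -rK addnC; apply: mulmx0_rank_max; apply/row_matrixP => i;
  rewrite row_mul row0 rowK.
apply/red_Sylvester_eq0; rewrite row_mxKl row_mxKr !poly_rV_K // f'd fd; ring.
Qed.

(** * Discriminant at a single double root, [p] odd *)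

Section DoubleRoot.
Variables (N : nat) (a : F).
Hypotheses (fN : (size f <= N)%N) (p_odd : odd p) (fa : double_root N a f0).
Local Notation l := ('X + a%:P : {poly F}).
Local Notation m := (f0 %/ l ^+ 2).
Local Notation h := (m * l).
Local Notation H := (m^`() * l + m *+ 2).
Let x0 : Z_p := - padic_lift p_pr a.

Lemma factor_double_root : f0 = l * h.
Proof. by case/andP: fa => lf _; rewrite -{1}(divpK lf); ring. Qed.

Lemma deriv_double_root : f0' = l * H.
Proof.
rewrite {1}factor_double_root !(derivM, derivD, derivX, derivC) addr0 -mulr_natl; ring.
Qed.

Lemma red_x0 : reduction x0 = - a.
Proof. by rewrite (rmorphN red) /= padic_liftK. Qed.

Lemma horner_x0 (g : {poly Z_p}) : reduction g.[x0] = (redp g).[- a].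
Proof. by rewrite -red_x0 -(horner_map red). Qed.

Lemma l_root : l.[- a] = 0.
Proof. by rewrite !hornerE addNr. Qed.

Lemma dvd_l (g : {poly F}) : (l %| g) = (g.[- a] == 0).
Proof. by rewrite -[a]opprK polyCN dvdp_XsubCl opprK. Qed.

(** The value is twice that of [m], and [p] is odd. *)
Lemma H_root_neq0 : H.[- a] != 0.
Proof.
case/andP: fa => _ /andP[_]; rewrite dvd_l => ma.
rewrite hornerD hornerM l_root mulr0 add0r hornerMn -mulr_natr mulf_neq0 //.
by rewrite -(dvdn_pcharf (pchar_Fp p_pr)) gtnNdvd // odd_prime_gt2.
Qed.

(** A common prime factor coprime to [l] would divide [m] and its derivative, so its square would
    divide [m]; one associated to [l] contradicts [H_root_neq0]. *)
Lemma coprime_hH : coprimep h H.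
Proof.
apply: contraT => nc.
have h0 : h != 0.
  by apply: contraNneq red_monic_neq0 => h0; rewrite factor_double_root h0 mulr0.
have hN : (size h <= N)%N.
  apply: leq_trans fN; rewrite -size_red_monic; apply: dvdp_leq red_monic_neq0 _.
  by rewrite {2}factor_double_root dvdp_mull.
have g1 : (1 < size (gcdp h H) <= N)%N.
  rewrite (leq_trans (dvdp_leq h0 (dvdp_gcdl _ _))) // andbT ltn_neqAle eq_sym.
  by rewrite -coprimep_def nc size_poly_gt0 gcdp_eq0 negb_and h0.
have [g gI] := exists_monic_irr_dvd g1; rewrite dvdp_gcd => /andP[gh gH].
have gI' : irreducible_poly (g : {poly F}).
  by move: gI; rewrite inE => /andP[_ /irreducibleP].
case/andP: fa => _ /andP[/forall_inP sf lm].
have [cgl|] := boolP (coprimep g l).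
  move: gh; rewrite Gauss_dvdpl // => gm; have := sf g gI; rewrite sqr_dvd_deriv //.
  move: gH; rewrite dvdp_addl ?Gauss_dvdpl // -mulr_natl; exact: dvdp_mull.
rewrite irreducible_poly_coprime // negbK => gl.
have sg : size g != 1%N by rewrite gtn_eqF //; exact: gI'.1.
have lg := (irreducible_XaddC a).2 _ sg gl.
by have := H_root_neq0; rewrite -dvd_l -(eqp_dvdl _ lg) gH.
Qed.

(* In [Disc f = U f + V f'] evaluated at a lift of [- a], both [V] and [f'] are
   divisible by [p]. *)
Lemma dvd_disc_sqr_ideal : in_sqr_ideal f l -> padic_dvd (p%:R ^+ 2) (disc f).
Proof.
move=> [G [u [v [w [Gl fE]]]]]; apply/padic_dvd_disc.
have [U [V e]] := resultant_ideal.
have e1 : (reduction (resultant f f^`()))%:P = redp U * f0 + redp V * f0'.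
  by have := congr1 redp e; rewrite !redpE redp_deriv (map_polyC red).
have f0a : f0.[- a] = 0 by rewrite factor_double_root hornerM l_root mul0r.
have f0'a : f0'.[- a] = 0 by rewrite deriv_double_root hornerM l_root mul0r.
have e0 : redp U * f0 + redp V * f0' = 0.
  rewrite -e1 -[reduction _](hornerC _ (- a)) e1 hornerD !hornerM f0a f0'a.
  by rewrite !mulr0 addr0.
(* After cancelling [l], evaluation at [- a], where [h] vanishes and [H] does not, shows that [V]
   vanishes there modulo [p]. *)
have VH : redp V * H = - (redp U * h).
  apply: (mulfI (monic_neq0 (monicXaddC a))); apply/eqP; rewrite -subr_eq0.
  rewrite -[X in _ == X]e0 deriv_double_root {4}factor_double_root; apply/eqP; ring.
have /reduction_eq0P[y yE] : reduction V.[x0] = 0.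
  rewrite horner_x0; apply/eqP; have /(congr1 (fun g : {poly F} => g.[- a])) := VH.
  rewrite hornerN !hornerM l_root !mulr0 oppr0 => /eqP.
  by rewrite mulf_eq0 (negbTE H_root_neq0) orbF.
have /reduction_eq0P[y' yE'] : reduction f^`().[x0] = 0.
  by rewrite horner_x0 redp_deriv.
have /reduction_eq0P[g gE] : reduction G.[x0] = 0 by rewrite horner_x0 Gl l_root.
have fx : f.[x0] = p%:R ^+ 2 * (g ^+ 2 * u.[x0] + g * v.[x0] + w.[x0]).
  rewrite {1}fE !hornerE -!polyC_natr -?polyC_exp !hornerE gE /=; ring.
exists (U.[x0] * (g ^+ 2 * u.[x0] + g * v.[x0] + w.[x0]) + y * y').
rewrite -[LHS](hornerC _ x0) -/(resultant f f^`()) e hornerD !hornerM fx yE yE'; ring.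
Qed.

(** By coprimality [h] divides the second component, whose degree is at most that of [h]: the kernel
    is the line spanned by [(- H, h)]. *)
Lemma kernel_double_root (y : 'rV[F]_dim) : y *m redm M = 0 ->
  exists c, rVpoly (lsubmx y) = c *: (- H) /\ rVpoly (rsubmx y) = c *: h.
Proof.
move=> /red_Sylvester_eq0; set u := rVpoly (lsubmx y); set v := rVpoly (rsubmx y).
rewrite deriv_double_root [X in u * X]factor_double_root => e.
have l0 := monic_neq0 (monicXaddC a).
have {}e : u * h = - (v * H).
  apply: (mulfI l0); apply/eqP; rewrite -subr_eq0 -[X in _ == X]e; apply/eqP; ring.
have h0 : h != 0.
  by apply: contraNneq red_monic_neq0 => h0; rewrite factor_double_root h0 mulr0.
have : h %| v.
  rewrite -(Gauss_dvdpl _ coprime_hH); apply/dvdpP; exists (- u).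
  by rewrite mulNr e opprK.
move=> /dvdpP[k vk].
have : (size k <= 1)%N.
  have [->|k0] := eqVneq k 0; first by rewrite size_poly0.
  have sv : (size v <= (size f).-1)%N := size_poly _ _.
  have : size f0 = (size h).+1 by rewrite {1}factor_double_root mulrC size_mul //
    size_XaddC addn2.
  rewrite size_red_monic => sf; move: sv; rewrite vk size_mul // sf /=.
  move: (size_poly_gt0 h); rewrite h0; move: (size k) (size h) => x y'; lia.
move=> /size1_polyC kE; rewrite kE in vk; exists k`_0; split;
  last by rewrite vk mul_polyC.
apply: (mulIf h0); rewrite e vk -mul_polyC; ring.
Qed.

Lemma rank_double_root : ((\rank (redm M)).+1 = dim)%N.
Proof.
apply/eqP; rewrite eqn_leq; apply/andP; split.
  rewrite ltn_neqAle rank_leq_row andbT -[_ == _]/(row_free (redm M)) row_free_unit.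
  rewrite unitmxE det_map_mx unitfE negbK; apply/eqP/reduction_eq0P.
  rewrite -[p%:R]expr1 -padic_dvd_disc expr1; apply/dvd_disc_coprime.
  rewrite coprimep_def; apply: contraTN isT => /eqP g1.
  have : l %| gcdp f0 f0' by rewrite dvdp_gcd {1}factor_double_root deriv_double_root
    !dvdp_mulIl.
  move/dvdp_leq; rewrite size_XaddC g1 => /(_ _) //.
  by rewrite -size_poly_gt0 g1 => /(_ isT).
pose w : 'rV[F]_dim := row_mx (poly_rV (- H)) (poly_rV h).
have kw : (kermx (redm M) <= w)%MS.
  apply/row_subP => i; have [c [cu cv]] : exists c,
      rVpoly (lsubmx (row i (kermx (redm M)))) = c *: (- H) /\
      rVpoly (rsubmx (row i (kermx (redm M)))) = c *: h.
    by apply: kernel_double_root; rewrite -row_mul mulmx_ker row0.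
  rewrite -[row i _]hsubmxK -[lsubmx _]rVpolyK -[rsubmx _]rVpolyK cu cv !linearZ /=.
  by rewrite -scale_row_mx scalemx_sub.
have := leq_trans (mxrankS kw) (rank_leq_row _); rewrite mxrank_ker.
by rewrite leq_subLR addn1.
Qed.

(** [corank1_kernel] gives [U f + V f' = p ^+ 2 t] with [(U, V)] congruent to a nonzero multiple of
    [(- H, h)]. At [x0] both [V] and [f'] are divisible by [p] and [U] is a unit, so [p ^+ 2]
    divides the value of [f]. Dividing [f] by ['X - x0%:P] then leaves a remainder in [p ^+ 2] and a
    quotient congruent to [m * l]. *)
Lemma sqr_ideal_dvd_disc : padic_dvd (p%:R ^+ 2) (disc f) -> in_sqr_ideal f l.
Proof.
move=> /padic_dvd_disc detM.
have [s [s0 [t st]]] := corank1_kernel rank_double_root detM.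
have [c [uE vE]] : exists c, rVpoly (lsubmx (redm s)) = c *: (- H) /\ rVpoly (rsubmx
  (redm s)) = c *: h.
  apply: kernel_double_root; rewrite -map_mxM st; apply/redm_eq0P.
  by exists (p%:R *: t); rewrite scalerA -expr2.
have c0 : c != 0.
  apply: contraNneq s0 => c0.
  by rewrite -[redm s]hsubmxK -[lsubmx _]rVpolyK -[rsubmx _]rVpolyK uE vE c0 !scale0r
    !linear0 row_mx0.
have := congr1 rVpoly st; rewrite rVpoly_Sylvester linearZ /=.
set U := rVpoly (lsubmx s); set V := rVpoly (rsubmx s) => e.
have U0 : redp U = c *: (- H) by rewrite -uE -map_lsubmx (map_rVpoly red).
have V0 : redp V = c *: h by rewrite -vE -map_rsubmx (map_rVpoly red).
have /reduction_eq0P[y yE] : reduction V.[x0] = 0.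
  by rewrite horner_x0 V0 hornerZ hornerM l_root !mulr0.
have /reduction_eq0P[y' yE'] : reduction f^`().[x0] = 0.
  by rewrite horner_x0 redp_deriv deriv_double_root hornerM l_root mul0r.
have UU : U.[x0] \is a GRing.unit.
  by rewrite unit_padicE horner_x0 U0 hornerZ hornerN mulf_neq0 // oppr_eq0 H_root_neq0.
have [z fz] : exists z, f.[x0] = p%:R ^+ 2 * z.
  exists (U.[x0]^-1 * ((rVpoly t).[x0] - y * y')); apply: (mulrI UU).
  rewrite mulrCA mulVKr //; have := congr1 (fun g : {poly Z_p} => g.[x0]) e.
  rewrite hornerD !hornerM hornerZ yE yE' => e'; rewrite mulrBr -e'; ring.
have [Q fQ] : exists Q, f = Q * ('X - x0%:P) + (p%:R ^+ 2 * z)%:P.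
  have /factor_theorem[Q QE] : root (f - (p%:R ^+ 2 * z)%:P) x0.
    by rewrite /root hornerD hornerN hornerC fz subrr.
  by exists Q; rewrite -QE subrK.
have redl : redp ('X - x0%:P) = l.
  by rewrite redpD redpN map_polyX (map_polyC red) /= red_x0 polyCN opprK.
have Q0 : redp Q = h.
  apply: (mulIf (monic_neq0 (monicXaddC a))); rewrite [RHS]mulrC -factor_double_root.
  rewrite [in RHS]fQ redpD redpM redl -[p%:R ^+ 2 * z]expr1 expr1 polyCM polyC_exp
    polyC_natr.
  by rewrite redpM redpX redp_p expr0n mul0r addr0.
have /redp_eq0P[v vQ] : redp (Q - liftp p_pr m * ('X - x0%:P)) = 0.
  by rewrite redpD redpN redpM redl liftpK Q0 subrr.
exists ('X - x0%:P), (liftp p_pr m), v, z%:P; split=> //.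
rewrite {1}fQ; have -> : Q = liftp p_pr m * ('X - x0%:P) + p%:R * v by rewrite -vQ
  addrC subrK.
by rewrite polyCM polyC_exp polyC_natr; ring.
Qed.

End DoubleRoot.

(** Valuation one forces corank at most one, so [f0] and [f0'] have a gcd of degree exactly one, a
    linear [l], and [l ^+ 2] divides [f0]. If [p = 2], or if the cofactor [m] were divisible by [l]
    or by a square, a common divisor of degree at least 2 would appear. *)
Lemma double_root_of_val1 N : (size f <= N)%N -> padic_val_eq (disc f) 1 ->
  odd p /\ exists a, double_root N a f0.
Proof.
move=> fN [d1 d2].
have ncop : ~~ coprimep f0 f0' by apply/dvd_disc_coprime; rewrite -[p%:R]expr1.
have small : (size (gcdp f0 f0') <= 2)%N.
  rewrite leqNgt; apply/negP => /corank_gcd /dvd_det_corank dd.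
  by apply: d2; apply/padic_dvd_disc.
have dvd_small (d : {poly F}) : d %| f0 -> d %| f0' -> (size d <= 2)%N.
  move=> df df'; apply: leq_trans small; apply: dvdp_leq; last by rewrite dvdp_gcd df.
  by rewrite gcdp_eq0 negb_and red_monic_neq0.
have g1 : (1 < size (gcdp f0 f0') <= N)%N.
  rewrite (leq_trans (dvdp_leq red_monic_neq0 (dvdp_gcdl _ _))) ?size_red_monic // andbT.
  by rewrite ltn_neqAle eq_sym -coprimep_def ncop size_poly_gt0 gcdp_eq0 negb_and
    red_monic_neq0.
have [g] := exists_monic_irr_dvd g1; rewrite inE dvdp_gcd => /andP[gm /irreducibleP gI]
  /andP[gf gf'].
have [a ga] : exists a, (g : {poly F}) = 'X + a%:P.
  have sg : size g = 2%N by apply/eqP; rewrite eqn_leq dvd_small //= gI.1.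
  exists (g : {poly F})`_0; apply/polyP => i; rewrite coefD coefX coefC.
  case: i => [|[|i]] /=; rewrite ?add0r ?addr0 //.
    by move: gm; rewrite monicE lead_coefE sg => /eqP.
  by rewrite nth_default // sg.
rewrite ga in gI gf gf'; have lf := sqr_dvd_deriv p_pr gI gf gf'.
set l := 'X + a%:P in gI gf gf' lf *; set m := f0 %/ l ^+ 2.
have l'1 : l^`() = 1 by rewrite derivD derivX derivC addr0.
have fE : f0 = m * l ^+ 2 by rewrite divpK.
have f'E : f0' = m^`() * l ^+ 2 + m * l *+ 2.
  by rewrite {1}fE derivM expr2 derivM l'1 -mulr_natl; ring.
have nl2 : ~~ (l ^+ 2 %| f0').
  apply/negP => lf'; have := dvd_small _ lf lf'.
  by rewrite expr2 size_mul ?monic_neq0 ?monicXaddC // size_XaddC.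
have p_odd : odd p.
  apply: contraNT nl2 => /(prime_oddPn p_pr) p2.
  have two0 : (2%:R : F) = 0.
    by apply/eqP; rewrite -(dvdn_pcharf (pchar_Fp p_pr)) {1}p2.
  by rewrite f'E -mulr_natr -polyC_natr two0 polyC0 mulr0 addr0 dvdp_mull.
split=> //; exists a; rewrite /double_root lf /=.
have lm : ~~ (l %| m).
  apply: contra nl2 => lm; rewrite f'E -mulr_natl; apply: dvdp_add;
    apply: dvdp_mull => //.
  by rewrite expr2 dvdp_mul.
rewrite /sqfree_away lm andbT; apply/forall_inP => k;
  rewrite inE => /andP[_ /irreducibleP kI].
apply/negP => k2m; have km : (k : {poly F}) %| m by apply: dvdp_trans k2m;
  rewrite expr2 dvdp_mulr.
have lk : coprimep l k.
  rewrite irreducible_poly_coprime //; apply: contra lm => /dvdp_trans; exact.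
have km' : (k : {poly F}) %| m^`().
  move/dvdpP: k2m => [u uE]; have -> : m = u * (k : {poly F}) ^+ 2 := uE.
  rewrite expr2 !derivM.
  by apply/dvdpP; exists (u^`() * k + u * k^`() + u * k^`()); ring.
have : (size (l * (k : {poly F}))%R <= 2)%N.
  apply: dvd_small; rewrite Gauss_dvdp //.
    by rewrite gf fE dvdp_mulr.
  by rewrite gf' f'E -mulr_natl; apply: dvdp_add;
    [exact: dvdp_mulr|apply/dvdp_mull/dvdp_mulr].
have k0 : (k : {poly F}) != 0 by rewrite -size_poly_gt0 ltnW // kI.1.
rewrite (size_mul (monic_neq0 (monicXaddC a)) k0) size_XaddC.
by have := kI.1; case: (size k) => [|[|]].
Qed.

Lemma val1_discP N : (size f <= N)%N -> padic_val_eq (disc f) 1 <->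
  odd p /\ exists a, double_root N a f0 /\ ~ in_sqr_ideal f ('X + a%:P).
Proof.
move=> fN; split=> [v1|[po [a [fa nsq]]]].
  have [po [a fa]] := double_root_of_val1 fN v1; split=> //; exists a; split=> // sq.
  by case: v1 => _; apply; exact: dvd_disc_sqr_ideal fa sq.
split; last by move=> /(sqr_ideal_dvd_disc fN po fa).
rewrite expr1; apply/dvd_disc_coprime; rewrite coprimep_def.
apply/eqP => g1.
have : 'X + a%:P %| gcdp f0 f0'.
  by rewrite dvdp_gcd {1}(factor_double_root fa) (deriv_double_root fa) !dvdp_mulIl.
move/dvdp_leq; rewrite size_XaddC g1 => gl.
by have := gl; rewrite -size_poly_gt0 g1 => /(_ isT).
Qed.

End Discriminant.

(** * Haar measure and densities *)

Local Open Scope classical_set_scope.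
Local Open Scope ring_scope.

Section Haar.
Variables (R : realType) (p : nat) (p_pr : prime p) (m : nat).
Variables (mu : probability (padic_space p_pr m) R) (mu_haar : is_haar mu).
Local Notation Z_p := (padic_int p_pr).
Local Notation X := (padic_space p_pr m).
Local Notation vball := (@vball p p_pr m).

Lemma measurable_vball (x : 'rV[Z_p]_m) k : measurable (vball x k : set X).
Proof. by apply: sub_sigma_algebra; exact: open_vball. Qed.

Lemma measure_preimage (T : finType) (c : X -> T) (A : pred T) :
  (forall t, measurable (c @^-1` [set t])) ->
  mu (c @^-1` [set t | A t]) = (\sum_(t | A t) mu (c @^-1` [set t]))%E.
Proof.
move=> mc; rewrite -big_filter fsbig_seq ?filter_uniq ?index_enum_uniq //.
rewrite -measure_fin_bigcup //.
- congr (mu _); apply/seteqP; split=> [y Ay|y [t /= + ->]].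
    by exists (c y) => //=; rewrite mem_filter mem_index_enum andbT.
  by rewrite mem_filter => /andP[].
- by apply/trivIsetP => s t _ _ st; apply/seteqP; split=> // y [/= ys yt];
  case/eqP: st; rewrite -ys.
Qed.

Lemma haar_vball_eq (x y : 'rV[Z_p]_m) k : mu (vball x k) = mu (vball y k).
Proof.
have H z : mu (vball z k) = mu (vball 0 k).
  rewrite -(mu_haar z (measurable_vball 0 k)) (translateE z (vball 0 k)).
  by rewrite vball_translate add0r.
by rewrite !H.
Qed.

(** The balls of level 2 partition the space into [p ^ (2 * m)] translates of each other. *)
Lemma haar_vball (x : 'rV[Z_p]_m) : mu (vball x 2) = ((p ^ (2 * m))%:R^-1)%:E.
Proof.
pose c (y : X) : 'rV['I_(p ^ 2)]_m := \row_i Ordinal (residue_lt (y 0 i) 2).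
have cE (t : 'rV['I_(p ^ 2)]_m) : c @^-1` [set t] = vball (\row_i (t 0 i)%:R) 2.
  apply/seteqP; split=> y /=.
    move=> <- i; rewrite !mxE residue_nat modn_small //; exact: residue_lt.
  move=> yt; apply/rowP => i; apply: val_inj; rewrite mxE /= yt mxE residue_nat.
  by rewrite modn_small.
have := @measure_preimage _ c xpredT.
rewrite (_ : c @^-1` _ = setT); last by apply/seteqP.
rewrite probability_setT => E.
have {E} : 1%E = (\sum_(t : 'rV['I_(p ^ 2)]_m) mu (vball x 2))%E.
  rewrite E => [|t]; last by rewrite cE; exact: measurable_vball.
  by apply: eq_bigr => t _; rewrite cE; exact: haar_vball_eq.
have fv : mu (vball x 2) \is a fin_num by apply: fin_num_measure; exact: measurable_vball.
rewrite -(fineK fv) sumEFin sumr_const card_mx card_ord mul1n -expnM => -[].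
move=> E; congr (_%:E).
have p0 : (p ^ (2 * m))%:R != 0 :> R by rewrite pnatr_eq0 -lt0n expn_gt0 prime_gt0.
by apply: (mulIf p0); rewrite mulVf // [RHS]E mulr_natr.
Qed.

(** Here [cl] labels the balls of level 2 and [S] is the set of labels, so that measuring is
    counting labels. *)
Lemma haar_count (T : finType) (cl : X -> T) (S A : pred T) :
  (forall y, S (cl y)) -> (forall t, S t -> exists y, cl y = t) ->
  (forall y y', cl y' = cl y <-> vball y 2 y') ->
  mu [set y | A (cl y)] = ((#|[pred t | S t && A t]|)%:R / (p ^ (2 * m))%:R)%:E.
Proof.
move=> Scl surj clP.
have cE y : cl @^-1` [set cl y] = vball y 2.
  by apply/seteqP; split=> y' /= /clP.
have c0 t : ~~ S t -> cl @^-1` [set t] = set0.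
  by move=> St; apply/seteqP; split=> // y /= yt; move: St; rewrite -yt Scl.
rewrite (_ : [set y | _] = cl @^-1` [set t | A t]) // measure_preimage; last first.
  move=> t; have [/surj[y <-]|/c0 ->] := boolP (S t); last exact: measurable0.
  by rewrite cE; exact: measurable_vball.
rewrite (bigID S) /= [X in (_ + X)%E]big1 ?adde0 => [|t /andP[_ /c0 ->]];
  last by rewrite measure0.
rewrite (eq_bigr (fun=> ((p ^ (2 * m))%:R^-1)%:E)) => [|t /andP[_ /surj[y <-]]];
  last first.
  by rewrite cE haar_vball.
rewrite sumEFin sumr_const mulr_natl; congr (_ *+ _)%:E.
by apply: eq_card => t; rewrite !inE andbC.
Qed.

End Haar.

(** * Congruence modulo [p ^ 2] in terms of digits *)

Section Digits.
Variables (p : nat) (p_pr : prime p).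
Local Notation Z_p := (padic_int p_pr).
Local Notation F := 'F_p.

Lemma digits_uniq (x w : Z_p) (c d : F) :
  x = padic_lift p_pr c + p%:R * padic_lift p_pr d + p%:R ^+ 2 * w ->
  reduction x = c /\ digit1 x = d.
Proof.
move=> xE; have redE (y z : Z_p) : reduction (y + p%:R * z) = reduction y.
  rewrite (rmorphD (@reduction p p_pr)) (rmorphM (@reduction p p_pr)) /=.
  by rewrite (rmorph_nat (@reduction p p_pr)) (red_p p_pr) mul0r addr0.
have xc : reduction x = c by rewrite xE expr2 -mulrA -addrA -mulrDr redE padic_liftK.
split=> //; rewrite /digit1 xc (_ : divp_p _ = padic_lift p_pr d + p%:R * w) ?redE
  ?padic_liftK //.
apply: (mulfI (padic_p_neq0 p_pr)); rewrite divp_pK ?xE; first by ring.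
by rewrite -xE (rmorphB (@reduction p p_pr)) /= xc padic_liftK subrr.
Qed.

Lemma residue2_eq0 (x : Z_p) : residue x 2 = 0%N <-> exists w, x = p%:R ^+ 2 * w.
Proof.
have r1 (y : Z_p) : residue y 1 = 0%N -> exists z, y = p%:R * z.
  by move=> y1; apply/reduction_eq0P; rewrite /reduction y1.
split=> [x2|[w ->]]; last first.
  by rewrite -natrX [LHS]/= residue_nat modnn mul0n mod0n.
have [y yE] : exists y, x = p%:R * y by apply: r1; rewrite residueS x2 mod0n.
have [z zE] : exists z, y = p%:R * z.
  apply: r1; move: x2; rewrite yE [LHS]/= residue_nat modnMml => /eqP.
  rewrite -/(dvdn _ _) expnS expn1 dvdn_pmul2l ?prime_gt0 // => py.
  by rewrite residueS expn1; apply/eqP.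
by exists z; rewrite yE zE expr2 mulrA.
Qed.

Lemma residue2P (x y : Z_p) : residue x 2 = residue y 2 <->
  reduction x = reduction y /\ digit1 x = digit1 y.
Proof.
split=> [xy|[xy1 xy2]].
  have [w wE] : exists w, x - y = p%:R ^+ 2 * w.
    by apply/residue2_eq0/residue_subP.
  have [v vE] := digits2 y; apply: (@digits_uniq _ (v + w)).
  by rewrite -[x](subrK y) wE {1}vE; ring.
apply/residue_subP/residue2_eq0.
have [v vE] := digits2 x; have [w wE] := digits2 y.
by exists (v - w); rewrite {1}vE {1}wE xy1 xy2; ring.
Qed.

End Digits.

(** * Coordinates on spaces of monic polynomials *)

Section Chart.
Variables (R : realType) (p : nat) (p_pr : prime p) (n m : nat).
Variables (mu : probability (padic_space p_pr m) R) (mu_haar : is_haar mu).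
Local Notation Z_p := (padic_int p_pr).
Local Notation F := 'F_p.
Local Notation B := {poly_(n.+1) F}.
Local Notation redp := (map_poly (@reduction p p_pr)).
Variable (t : {poly Z_p}).
Hypotheses (mn : (m <= n)%N) (st : (size t <= n - m)%N).

(** One chart for both spaces: [m = n.-1] with [t] the prescribed constant term, and [m = n] with
    [t = 0]. *)
Definition chart (a : 'rV[Z_p]_m) : {poly Z_p} :=
  'X^n + \sum_(i < m) a 0 i *: 'X^(n - i.+1) + t.

Lemma coef_chart (a : 'rV[Z_p]_m) (i : 'I_m) : (chart a)`_(n - i.+1) = a 0 i.
Proof.
have im := ltn_ord i.
rewrite !coefD coefXn (ltn_eqF (_ : _ < n)%N) ?add0r; last by lia.
rewrite (nth_default 0 (_ : size t <= _)%N) ?addr0; last by apply: leq_trans st _; lia.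
rewrite coef_sum (bigD1 i) //= coefZ coefXn eqxx mulr1 big1 ?addr0 // => j ji.
rewrite coefZ coefXn [(_ == _)%N](_ : _ = false) ?mulr0 //.
apply: contraNF ji => /eqP e; apply/eqP/val_inj => /=; have := ltn_ord j; lia.
Qed.

Lemma coef_chart_out (a : 'rV[Z_p]_m) j : (j < n - m)%N || (n <= j)%N ->
  (chart a)`_j = (j == n)%:R + t`_j.
Proof.
move=> jm; rewrite !coefD coefXn coef_sum big1 ?addr0 // => i _.
rewrite coefZ coefXn [(_ == _)%N](_ : _ = false) ?mulr0 //.
by apply/eqP => e; have := ltn_ord i; lia.
Qed.

Lemma index_chart j : ~~ ((j < n - m)%N || (n <= j)%N) -> exists i : 'I_m, j = (n -
  i.+1)%N.
Proof.
rewrite negb_or -leqNgt -ltnNge => /andP[j1 j2].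
by have jm : (n - j.+1 < m)%N by [lia]; exists (Ordinal jm) => /=; lia.
Qed.

Lemma monic_chart (a : 'rV[Z_p]_m) : chart a \is monic /\ size (chart a) = n.+1.
Proof.
have sz : size (chart a) = n.+1.
  apply/anti_leq/andP; split.
    apply/leq_sizeP => j nj; rewrite coef_chart_out; last by rewrite (ltnW nj) orbT.
    rewrite gtn_eqF // add0r nth_default //; apply: leq_trans st _; lia.
  rewrite ltnNge; apply/negP => /leq_sizeP/(_ n (leqnn n)).
  rewrite coef_chart_out ?leqnn ?orbT // eqxx nth_default ?addr0;
    last by apply: leq_trans st _; lia.
  by move/eqP; rewrite oner_eq0.
split=> //; rewrite monicE lead_coefE sz coef_chart_out ?leqnn ?orbT // eqxx.
by rewrite nth_default ?addr0 //; apply: leq_trans st _; lia.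
Qed.

Definition digit_pair (f : {poly Z_p}) : B * B := (npolyp n.+1 (redp f), npolyp n.+1
  (digit1p f)).

Lemma digit1_1 : digit1 (1 : Z_p) = 0.
Proof.
apply: (proj2 (@digits_uniq p p_pr 1 0 1 0 _)).
by rewrite padic_lift0 !mulr0 !addr0 /padic_lift [X in X%:R](_ : _ = 1%N).
Qed.

Lemma digit_pairE (f : {poly Z_p}) : (size f <= n.+1)%N ->
  (digit_pair f).1 = redp f :> {poly F} /\ (digit_pair f).2 = digit1p f :> {poly F}.
Proof. by move=> sf; split; rewrite npolypK // (leq_trans (size_poly _ _)). Qed.

(** The second component has size at most [n] because the leading coefficient [1] has second digit
    [0]. *)
Definition chart_image : pred (B * B) := fun x =>
  [&& (x.1 : {poly F}) \is monic, size x.1 == n.+1, (size x.2 <= n)%N &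
    [forall j : 'I_(n - m), ((x.1 : {poly F})`_j == reduction t`_j) &&
        ((x.2 : {poly F})`_j == digit1 t`_j)]].

Lemma digit_pair_chart (a : 'rV[Z_p]_m) : chart_image (digit_pair (chart a)).
Proof.
have [cm sc] := monic_chart a; have [] := digit_pairE (f := chart a); first by rewrite sc.
rewrite /chart_image => -> ->; apply/and4P; split.
- exact: monic_map.
- by rewrite size_red_monic // sc.
- apply/leq_sizeP => j nj; rewrite coef_digit1p coef_chart_out ?nj ?orbT //.
  rewrite [t`_j]nth_default ?addr0; last by apply: leq_trans st _; lia.
  by case: eqP; rewrite ?digit1_1 ?digit1_0.
- apply/forallP => j; rewrite coef_digit1p (coef_map (@reduction p p_pr)) /=.
  by rewrite coef_chart_out ?ltn_ord // ltn_eqF ?add0r ?eqxx //; have := ltn_ord j; lia.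
Qed.

Lemma chart_image_surj x : chart_image x -> exists a, digit_pair (chart a) = x.
Proof.
move=> /and4P[xm /eqP sx1 sx2 /forallP xt].
pose a : 'rV[Z_p]_m := \row_i (padic_lift p_pr (x.1 : {poly F})`_(n - i.+1) +
   p%:R * padic_lift p_pr (x.2 : {poly F})`_(n - i.+1)).
have [cm sc] := monic_chart a; have [d1 d2] := digit_pairE (f := chart a) ltac:(by
  rewrite sc).
have key j : reduction (chart a)`_j = (x.1 : {poly F})`_j /\ digit1 (chart a)`_j = (x.2
  : {poly F})`_j.
  have [jm|/index_chart[i ->]] := boolP ((j < n - m)%N || (n <= j)%N); last first.
    rewrite coef_chart mxE; apply: (@digits_uniq p p_pr _ 0).
    by rewrite mulr0 addr0.
  rewrite coef_chart_out //; case/orP: jm => jm.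
    rewrite ltn_eqF ?add0r; last by lia.
    by have /andP[/eqP -> /eqP ->] := xt (Ordinal jm).
  rewrite [t`_j]nth_default ?addr0; last by apply: leq_trans st _; lia.
  rewrite [(x.2 : {poly F})`_j]nth_default; last exact: leq_trans jm.
  have [->|nj] := eqVneq j n.
    rewrite digit1_1 (rmorph1 (@reduction p p_pr)); split=> //.
    by move: xm; rewrite monicE lead_coefE sx1 => /eqP.
  rewrite digit1_0 (rmorph0 (@reduction p p_pr)) nth_default // sx1.
  by rewrite ltn_neqAle eq_sym nj.
exists a; rewrite [x]surjective_pairing; congr (_, _); apply: val_inj => /=.
  by rewrite [LHS]d1; apply/polyP => j; rewrite (coef_map (@reduction p p_pr)) /= (key
    j).1.
by rewrite [LHS]d2; apply/polyP => j; rewrite coef_digit1p (key j).2.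
Qed.

Lemma digit_pair_chartP (a a' : 'rV[Z_p]_m) :
  digit_pair (chart a') = digit_pair (chart a) <-> vball a 2 a'.
Proof.
have [cm sc] := monic_chart a; have [d1 d2] := digit_pairE (f := chart a) ltac:(by
  rewrite sc).
have [cm' sc'] := monic_chart a'; have [d1' d2'] := digit_pairE (f := chart a')
  ltac:(by rewrite sc').
split=> [e i|aa'].
  apply/residue2P; rewrite -!coef_chart -!(coef_map (@reduction p p_pr)) -!coef_digit1p
    /=.
  by rewrite -d1 -d1' -d2 -d2' e.
have key j : reduction (chart a')`_j = reduction (chart a)`_j /\ digit1 (chart a')`_j =
  digit1 (chart a)`_j.
  have [jm|/index_chart[i ->]] := boolP ((j < n - m)%N || (n <= j)%N).
    by rewrite !coef_chart_out.
  by rewrite !coef_chart; apply/residue2P; exact: aa'.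
rewrite [digit_pair _]surjective_pairing [RHS]surjective_pairing; congr (_, _);
  apply: val_inj => /=.
  by rewrite [LHS]d1' [RHS]d1; apply/polyP => j;
    rewrite !(coef_map (@reduction p p_pr)) /= (key j).1.
by rewrite [LHS]d2' [RHS]d2; apply/polyP => j; rewrite !coef_digit1p (key j).2.
Qed.

Lemma haar_chart (A : pred (B * B)) : mu [set a | A (digit_pair (chart a))] =
  ((#|[pred x | chart_image x && A x]|)%:R / (p ^ (2 * m))%:R)%:E.
Proof.
apply: (haar_count mu_haar (cl := fun a => digit_pair (chart a))).
- exact: digit_pair_chart.
- exact: chart_image_surj.
- exact: digit_pair_chartP.
Qed.

End Chart.

(** * Densities as numbers of digit pairs *)

Section Densities.
Variables (R : realType) (p n : nat) (p_pr : prime p) (n_ge2 : (2 <= n)%N).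
Variables (b : padic_int p_pr) (b_unit : b \is a GRing.unit).
Variables (mu : probability (padic_space p_pr n.-1) R) (mu_haar : is_haar mu).
Variables (mu' : probability (padic_space p_pr n) R) (mu'_haar : is_haar mu').
Local Notation Z_p := (padic_int p_pr).
Local Notation F := 'F_p.
Local Notation B := {poly_(n.+1) F}.
Local Notation redp := (map_poly (@reduction p p_pr)).

Definition fiber_count (A : pred (B * B)) (b0 b1 : F) : nat :=
  #|[pred x : B * B | [&& mon n b0 x.1, (size x.2 <= n)%N, (x.2 : {poly F})`_0 == b1 &
    A x]]|.

(** This says that on monic polynomials of degree [n] membership in [E] depends only on the class
    modulo [p ^ 2]. *)
Definition detects (E : set {poly Z_p}) (A : pred (B * B)) : Prop :=
  forall f, f \is monic -> size f = n.+1 -> (E f <-> A (digit_pair n f)).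

Let n_gt0 : (0 < n)%N. Proof. exact: ltnW. Qed.

Lemma size_fixed_tail (c : Z_p) : (size c%:P <= n - n.-1)%N.
Proof. by rewrite (leq_trans (size_polyC_leq1 _)) // subn_gt0 ltn_predL. Qed.

Lemma haar_fixed (c : Z_p) (A : pred (B * B)) :
  mu [set a | A (digit_pair n (fixed_poly n c a))] =
  ((fiber_count A (reduction c) (digit1 c))%:R / (p ^ (2 * n.-1))%:R)%:E.
Proof.
rewrite (haar_chart mu_haar (leq_pred n) (size_fixed_tail c) A); congr (_%:R / _)%:E.
apply: eq_card => x; rewrite !inE /chart_image /mon -!andbA.
have -> : [forall j : 'I_(n - n.-1), ((x.1 : {poly F})`_j == reduction (c%:P)`_j) &&
    ((x.2 : {poly F})`_j == digit1 (c%:P)`_j)] =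
    ((x.1 : {poly F})`_0 == reduction c) && ((x.2 : {poly F})`_0 == digit1 c).
  have h0 : (0 < n - n.-1)%N by rewrite subn_gt0 ltn_predL.
  apply/forallP/idP => [/(_ (Ordinal h0))|x0 j]; rewrite ?coefC //=.
  have -> : j = 0%N :> nat by have := ltn_ord j; lia.
  by [].
by do !case: (_ == _); rewrite ?andbT ?andbF //; case: (_ <= _)%N.
Qed.

Lemma monic_polyE (a : 'rV[Z_p]_n) : monic_poly p_pr n a = chart n 0 a.
Proof. by rewrite /chart addr0. Qed.

Lemma fixed_polyP (c : Z_p) a : [/\ fixed_poly n c a \is monic,
  size (fixed_poly n c a) = n.+1 & (fixed_poly n c a)`_0 = c].
Proof.
have [cm cs] := monic_chart (leq_pred n) (size_fixed_tail c) a; split=> //.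
rewrite (coef_chart_out (leq_pred n) (size_fixed_tail c));
  last by rewrite subn_gt0 ltn_predL n_gt0.
by rewrite ltn_eqF // coefC add0r.
Qed.

Lemma monic_polyP a : monic_poly p_pr n a \is monic /\ size (monic_poly p_pr n a) = n.+1.
Proof.
by rewrite monic_polyE; apply: monic_chart; rewrite ?subnn ?size_poly0.
Qed.

Lemma haar_monic (A : pred (B * B)) :
  mu' [set a | A (digit_pair n (monic_poly p_pr n a))] =
  ((#|[pred x : B * B | [&& (x.1 : {poly F}) \is monic, size x.1 == n.+1, (size x.2 <=
    n)%N & A x]]|)%:R
     / (p ^ (2 * n))%:R)%:E.
Proof.
rewrite (_ : [set a | _] = [set a | A (digit_pair n (chart n 0 a))]); last first.
  by apply/seteqP; split=> a /=; rewrite monic_polyE.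
rewrite (haar_chart mu'_haar (leqnn n)) ?subnn ?size_poly0 //; congr (_%:R / _)%:E.
apply: eq_card => x; rewrite !inE /chart_image -!andbA.
have -> // : [forall j : 'I_(n - n), ((x.1 : {poly F})`_j == reduction (0 : {poly
  Z_p})`_j) &&
    ((x.2 : {poly F})`_j == digit1 (0 : {poly Z_p})`_j)] = true.
by apply/forallP => -[j jn]; suff: false by []; move: (jn); rewrite {1}subnn.
Qed.

(** Read off from the total measure 1 of the chart. *)
Lemma fiber_count_all (b0 b1 : F) : fiber_count xpredT b0 b1 = (p ^ (2 * n.-1))%N.
Proof.
pose c : Z_p := padic_lift p_pr b0 + p%:R * padic_lift p_pr b1.
have [c0 c1] : reduction c = b0 /\ digit1 c = b1.
  by apply: (@digits_uniq p p_pr _ 0); rewrite mulr0 addr0.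
have := haar_fixed c xpredT; rewrite c0 c1.
have -> : mu [set _ | true] = 1%E.
  by rewrite -(probability_setT mu); congr (mu _); apply/seteqP.
by move=> -[] /esym /divr1_eq /eqP; rewrite eqr_nat => /eqP.
Qed.

Lemma density_fixed (E : set {poly Z_p}) (A : pred (B * B)) : detects E A ->
  density mu (fixed_poly n b) (V_fixed n b) E =
  (fiber_count A (reduction b) (digit1 b))%:R / (p ^ (2 * n.-1))%:R.
Proof.
move=> EA; rewrite /density.
have -> : fixed_poly n b @^-1` V_fixed n b = setT.
  by apply/seteqP; split=> // a _; exact: fixed_polyP.
rewrite probability_setT divr1.
rewrite (_ : _ @^-1` _ = [set a | A (digit_pair n (fixed_poly n b a))]) ?haar_fixed //.
apply/seteqP; split=> a /=; have [fm fs f0] := fixed_polyP b a;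
  first by case=> _ /(EA _ fm fs).
by move=> /(EA _ fm fs).
Qed.

Lemma density_unit (E : set {poly Z_p}) (A : pred (B * B)) : detects E A ->
  density mu' (monic_poly p_pr n) (V_unit p_pr n) E =
  (\sum_(b0 : F | b0 != 0) \sum_(b1 : F) (fiber_count A b0 b1)%:R) /
  (p * p.-1 * p ^ (2 * n.-1))%:R.
Proof.
have mV (E' : set {poly Z_p}) (A' : pred (B * B)) : detects E' A' ->
    fine (mu' (monic_poly p_pr n @^-1` (V_unit p_pr n `&` E'))) =
    (\sum_(b0 : F | b0 != 0) \sum_(b1 : F) (fiber_count A' b0 b1)%:R) / (p ^ (2 * n))%:R.
  move=> EA'.
  pose A'' (x : B * B) := ((x.1 : {poly F})`_0 != 0) && A' x.
  rewrite (_ : _ @^-1` _ = [set a | A'' (digit_pair n (monic_poly p_pr n a))]);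
    last first.
    have c0 a : (digit_pair n (monic_poly p_pr n a)).1`_0 != 0 <-> ~ padic_dvd p%:R
      (monic_poly p_pr n a)`_0.
      have [fm fs] := monic_polyP a; have [-> _] := digit_pairE (n := n) (f :=
        monic_poly p_pr n a) ltac:(by rewrite fs).
      rewrite (coef_map (@reduction p p_pr)) /=; split=> [/eqP r0 /reduction_eq0P //|r0].
      by apply/eqP => /reduction_eq0P.
    apply/seteqP; split=> a; rewrite /A'' /=; have [fm fs] := monic_polyP a.
      by case=> [[_ _ /c0 ->] /(EA' _ fm fs)].
    by move=> /andP[/c0 a0 /(EA' _ fm fs)].
  rewrite (haar_monic A'') /=; congr (_ / _).
  rewrite -sum1_card natr_sum (partition_big (fun x : B * B => (x.1 : {poly F})`_0)
    (fun b0 => b0 != 0)) /=; last first.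
    by move=> x; rewrite inE => /and5P[].
  apply: eq_bigr => b0 b00.
  rewrite (partition_big (fun x : B * B => (x.2 : {poly F})`_0) xpredT) //=.
  apply: eq_bigr => b1 _; rewrite -natr_sum sum1_card; congr (_%:R).
  apply: eq_card => x; rewrite /mon !inE unfold_in /= inE /A''.
  have [->|] := eqVneq (x.1 : {poly F})`_0 b0; last by rewrite !andbF.
  rewrite b00 !andbT; case: (_ \is monic) => //=; case: (_ == _) => //=.
  by case: (_ <= _)%N => //=; rewrite andbC.
move=> EA; rewrite /density (mV E A) // -[V_unit p_pr n]setIT.
(* The denominator is the same sum for the empty condition, where every fiber has the size given by
   [fiber_count_all]. *)
rewrite (mV setT xpredT); last by move=> f _ _; split.
have -> : \sum_(b0 : F | b0 != 0) \sum_(b1 : F) (fiber_count xpredT b0 b1)%:R =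
    (p * p.-1 * p ^ (2 * n.-1))%:R :> R.
  under eq_bigr => b0 _ do under eq_bigr => b1 _ do rewrite fiber_count_all.
  rewrite !sumr_const (cardC1 (0 : F)) card_Fp // -!mulrnA; congr (_%:R).
  by move: (p ^ _)%N p.-1 => x y; lia.
have p0 : (p ^ (2 * n))%:R != 0 :> R by rewrite pnatr_eq0 -lt0n expn_gt0 prime_gt0.
by rewrite invfM invrK mulrACA mulVf // mulr1.
Qed.

(** Each nonzero [c] is a [j]th root of exactly one nonzero [b0]. Root counts thus have mean 1 over
    the [p.-1] values of [b0]. *)
Lemma sum_roots (j : nat) : (\sum_(b0 : F | b0 != 0) (root_count j b0)%:R)%R = p.-1%:R
  :> R.
Proof.
rewrite -[p in RHS](card_Fp p_pr) -(cardC1 (0 : F)) -sum1_card natr_sum.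
rewrite [RHS](partition_big (fun c : F => c ^+ j) (fun b0 => b0 != 0)) /=; last first.
  by move=> c c0; exact: expf_neq0.
apply: eq_bigr => b0 _; rewrite /root_count -sum1_card natr_sum.
by apply: eq_bigl => c; rewrite !inE.
Qed.

(** Averaging over the nonzero [b0] replaces each root count by its mean 1 and leaves [C] unchanged,
    so [C] drops out of the difference. *)
Lemma density_diff (E : set {poly Z_p}) (A : pred (B * B)) (C w1 w2 : int) :
  detects E A ->
  (forall b0 b1, b0 != 0 -> (fiber_count A b0 b1)%:R =
     C + w1 * (root_count n b0)%:R + w2 * (root_count 2 b0)%:R) ->
  density mu (fixed_poly n b) (V_fixed n b) E =
  density mu' (monic_poly p_pr n) (V_unit p_pr n) E +
    (w1%:~R * ((root_count n (reduction b))%:R - 1) + w2%:~R * ((root_count 2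
      (reduction b))%:R - 1)) /
       (p ^ (2 * n.-1))%:R.
Proof.
move=> EA fE.
have fER b0 b1 : b0 != 0 -> (fiber_count A b0 b1)%:R =
    C%:~R + w1%:~R * (root_count n b0)%:R + w2%:~R * (root_count 2 b0)%:R :> R.
  move=> b00; rewrite -[LHS](rmorph_nat (intmul 1)) /= fE //.
  by rewrite !rmorphD !rmorphM /= !rmorph_nat.
have rb : reduction b != 0 by rewrite -unit_padicE.
rewrite (density_fixed EA) (density_unit EA) fER //.
have -> : \sum_(b0 : F | b0 != 0) \sum_(b1 : F) (fiber_count A b0 b1)%:R =
    p%:R * p.-1%:R * (C%:~R + w1%:~R + w2%:~R) :> R.
  rewrite (eq_bigr (fun b0 => p%:R * (C%:~R + w1%:~R * (root_count n b0)%:R + w2%:~R *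
    (root_count 2 b0)%:R))).
    rewrite -mulr_sumr !big_split /= -!mulr_sumr !sum_roots sumr_const (cardC1 (0 : F))
      card_Fp //.
    by rewrite -[C%:~R *+ _]mulr_natr; ring.
  move=> b0 b00; under eq_bigr => b1 _ do rewrite fER //.
  by rewrite sumr_const card_Fp // mulr_natl.
have p0 : p%:R != 0 :> R by rewrite pnatr_eq0 -lt0n prime_gt0.
have p1 : p.-1%:R != 0 :> R by rewrite pnatr_eq0 -lt0n -ltnS prednK ?prime_gt0 //
  prime_gt1.
have q0 : (p ^ (2 * n.-1))%:R != 0 :> R by rewrite pnatr_eq0 -lt0n expn_gt0 prime_gt0.
rewrite !natrM; field; rewrite p0 p1 q0 //.
Qed.

Lemma detects_sqf0 : detects (sqf0_set p_pr) (fun x => sqfree n.+1 (x.1 : {poly F})).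
Proof.
move=> f fm fs; rewrite /sqf0_set /=; have [-> _] := digit_pairE (n := n) (f := f)
  ltac:(by rewrite fs).
rewrite (sqfree_coprime_deriv p_pr) ?size_red_monic // ?fs ?ltnS ?leqnn ?n_gt0 //.
have dd := dvd_disc_coprime fm (_ : (2 < size f)%N); rewrite fs in dd.
by split=> [nd|cf]; [apply: contraT => /(dd n_ge2) | move=> /(dd n_ge2); rewrite cf].
Qed.

Lemma detects_max : detects (max_set p_pr) (fun x =>
  [forall g in monic_irr F n.+1, ~~ (((g : {poly F}) ^+ 2 %| (x.1 : {poly F})) &&
         ((g : {poly F}) %| (x.2 : {poly F}) + sqr_defect p_pr x.1 g))]).
Proof.
move=> f fm fs; rewrite /max_set /=.
have [d1 d2] := digit_pairE (n := n) (f := f) ltac:(by rewrite fs); rewrite d1 d2.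
rewrite maximalP ?fs //; split=> [nsq|/forall_inP nsq g gm gI].
  apply/forall_inP => g; rewrite inE => /andP[gm /irreducibleP gI].
  by apply/negP => /andP[g2 gh]; apply: (nsq g gm gI); apply/in_sqr_idealP;
    rewrite ?monic_neq0.
move=> /in_sqr_idealP-/(_ (monic_neq0 gm))[g2 gh].
have gN : (size g <= n.+1)%N.
  rewrite -fs -(size_red_monic fm); apply: dvdp_leq.
    exact/monic_neq0/redp_monic.
  by apply: dvdp_trans g2; rewrite expr2 dvdp_mulr.
have /negP[] := nsq (NPoly gN : B) ltac:(by rewrite inE /= gm; apply/irreducibleP).
by rewrite /= g2.
Qed.

Lemma detects_sqf1 : detects (sqf1_set p_pr) (fun x =>
  odd p && [exists a, double_root n.+1 a (x.1 : {poly F}) &&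
    ~~ ('X + a%:P %| (x.2 : {poly F}) + sqr_defect p_pr x.1 ('X + a%:P))]).
Proof.
move=> f fm fs; rewrite /sqf1_set /=.
have [d1 d2] := digit_pairE (n := n) (f := f) ltac:(by rewrite fs); rewrite d1 d2.
have fN : (size f <= n.+1)%N by rewrite fs.
have f2 : (2 < size f)%N by rewrite fs.
rewrite (val1_discP fm f2 fN).
have sq a : double_root n.+1 a (redp f) -> in_sqr_ideal f ('X + a%:P) <->
    'X + a%:P %| digit1p f + sqr_defect p_pr (redp f) ('X + a%:P).
  move=> /andP[fa _]; rewrite in_sqr_idealP ?monic_neq0 ?monicXaddC //.
  by split=> [[]|].
split=> [[-> [a [fa nsq]]]|/andP[-> /existsP[a /andP[fa nsq]]]].
  by apply/existsP; exists a; rewrite fa /=; apply/negP => /(sq a fa).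
by split=> //; exists a; split=> // /(sq a fa); apply/negP.
Qed.

End Densities.

(** * The character sum *)

Section Kappa.
Variables (p : nat) (p_pr : prime p).
Local Notation F := 'F_p.
Local Notation G := [set: {unit F}]%G.

Lemma card_units : #|G| = p.-1.
Proof. by rewrite card_finField_unit card_Fp. Qed.

(** Column orthogonality for the abelian group of units: summed over all characters,
    ['chi_i (c ^+ n)] times the conjugate of ['chi_i b] gives [p - 1] if [c ^+ n = b] and 0
    otherwise. Leaving out the trivial character subtracts 1 for each [c], hence 1 after
    normalization. *)
Lemma kappaE (n : nat) (b : {unit F}) :
  kappa n b = #|[pred c : {unit F} | (c ^+ n)%g == b]|%:R - 1.
Proof.
have abG : abelian G by apply: cyclic_abelian; exact: field_unit_group_cyclic.
have lin i : 'chi[G]_i \is a linear_char by apply/char_abelianP.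
have p1 : (p%:R - 1 : algC) != 0.
  by rewrite subr_eq0 pnatr_eq1 gtn_eqF // prime_gt1.
have cardG : #|G|%:R = p%:R - 1 :> algC.
  by rewrite card_units -subn1 natrB // prime_gt0.
have sum_chi (x : {unit F}) : (\sum_(i : Iirr G | i != 0) 'chi_i x * ('chi_i b)^*)%R =
    (p%:R - 1) * (x == b)%:R - 1 :> algC.
  have := second_orthogonality_relation x (finset.in_setT b).
  rewrite (bigD1 0) //= irr0 !cfun1E !finset.in_setT conjC1 mulr1 => e.
  apply: (addrI 1); rewrite e addrC subrK.
  have -> : ('C_G[x] = G)%g by apply/finset.setIidPl;
    rewrite sub_cent1 (fintype.subsetP abG).
  rewrite cardG (_ : x \in (b ^: G)%g = (x == b)); last first.
    apply/idP/eqP => [/imsetP[y _ ->]|->]; last exact: class_refl.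
    by rewrite conjgE (centsP abG b _ y) ?mulKg ?finset.in_setT.
  by rewrite mulr_natr.
rewrite /kappa (eq_bigl (fun i : Iirr G => i != 0)) => [|i]; last by rewrite lin andbT.
rewrite (eq_bigr (fun i : Iirr G => \sum_(c : {unit F}) 'chi_i (c ^+ n)%g * ('chi_i
  b)^*)); last first.
  move=> i _; rewrite mulrC -lin_charV_conj ?lin_charV ?finset.in_setT // mulr_suml.
  by apply: eq_bigr => c _; rewrite lin_charX ?finset.in_setT.
rewrite exchange_big /= (eq_bigr _ (fun c _ => sum_chi (c ^+ n)%g)) sumrB sumr_const.
rewrite -mulr_sumr -natr_sum -cardsT.
rewrite (_ : #|_| = #|G|) // cardG mulrBr mulKf // mulVf //.
by congr (_%:R - 1); rewrite -sum1_card [RHS]big_mkcond.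
Qed.

(** A nonempty fiber is a coset of the kernel of the [n]th power map; in a cyclic group of order
    [p.-1] with generator [x] this kernel is generated by [x ^+ (p.-1 %/ gcdn n p.-1)]. *)
Lemma card_power_fiber (n : nat) (b : {unit F}) :
  #|[pred c : {unit F} | (c ^+ n)%g == b]| =
  (if [exists d : {unit F}, b == (d ^+ n)%g] then gcdn n p.-1 else 0)%N.
Proof.
have abG : abelian G by apply: cyclic_abelian; exact: field_unit_group_cyclic.
have comm (x y : {unit F}) : commute x y.
  by apply: (centsP abG); rewrite finset.in_setT.
case: existsP => [[d /eqP ->]|nd]; last first.
  by apply: eq_card0 => c; rewrite !inE; apply/negP => /eqP cb; apply: nd; exists c;
    rewrite cb.
have -> : #|[pred c : {unit F} | (c ^+ n)%g == (d ^+ n)%g]| = #|[pred c : {unit F} | (c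
  ^+ n)%g == 1%g]|.
  apply: (card_bij (f := fun c => (c * d^-1)%g) (g := fun c => (c * d)%g)) => c;
    rewrite !inE => /eqP e.
    by rewrite expgMn ?e; [rewrite expVgn mulgV mulgKV eqxx | exact: comm].
  by rewrite expgMn ?e; [rewrite mul1g mulgK eqxx | exact: comm].
have /cyclicP[x Gx] : cyclic G by exact: field_unit_group_cyclic.
have ox : #[x]%g = p.-1 by rewrite /order -Gx card_units.
set g := gcdn n p.-1.
have p1 : (0 < p.-1)%N by rewrite -ltnS prednK ?prime_gt0 // prime_gt1.
have g0 : (0 < g)%N by rewrite gcdn_gt0 p1 orbT.
have gp : (g %| p.-1)%N := dvdn_gcdr _ _.
rewrite -[RHS](_ : #|<[x ^+ (p.-1 %/ g)]>%g| = g); last first.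
  by rewrite -/(order _) orderXdiv ox ?dvdn_div // -{1}(divnK gp) mulKn // divn_gt0 //
    dvdn_leq.
apply: eq_card => c; rewrite !inE; apply/eqP/cycleP => [cn|[i ->]]; last first.
  rewrite -!expgM; apply/eqP; rewrite -order_dvdn ox.
  rewrite -?mulnA mulnCA; apply: dvdn_mull; rewrite -{1}(divnK gp);
    apply: dvdn_mul => //; exact: dvdn_gcdl.
have : c \in <[x]>%g by rewrite -Gx finset.in_setT.
move=> /cycleP[k cE]; move: cn; rewrite cE -expgM => /eqP; rewrite -order_dvdn ox => kn.
have : (p.-1 %/ g %| k)%N.
  have cop : coprime (p.-1 %/ g) (n %/ g).
    rewrite /coprime gcdnC -(eqn_pmul2r g0) muln_gcdl mul1n !divnK ?dvdn_gcdl //.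
  rewrite -(Gauss_dvdl _ cop) -(dvdn_pmul2r g0) divnK // -mulnA divnK // dvdn_gcdl //.
by move=> /dvdnP[j ->]; exists j; rewrite -expgM mulnC.
Qed.

Lemma kappa_formula (n : nat) (c : {unit F}) :
  kappa n c = if [exists d : {unit F}, c == (d ^+ n)%g] then (gcdn n p.-1)%:R - 1 else -1.
Proof. by rewrite kappaE card_power_fiber; case: ifP => // _; rewrite sub0r. Qed.

Lemma root_count_unit (n : nat) (b : {unit F}) :
  root_count n (FinRing.uval b) = #|[pred c : {unit F} | (c ^+ n)%g == b]|.
Proof.
rewrite /root_count -(fintype.card_image (f := @FinRing.uval F) val_inj);
  apply: eq_card => x.
rewrite !inE; apply/andP/fintype.imageP => [[x0 /eqP xb]|[c]].
  have xU : x \is a GRing.unit by rewrite unitfE.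
  exists (FinRing.unit F xU) => //; rewrite inE -val_eqE /= FinRing.val_unitX /=;
    exact/eqP.
rewrite inE -val_eqE /= FinRing.val_unitX => /eqP cb ->; rewrite cb; split=> //.
by rewrite -unitfE; exact: (valP c).
Qed.

Lemma ratr_kappa (R : realType) (n : nat) (b : {unit F}) :
  ratr (getCrat (kappa n b)) = (root_count n (FinRing.uval b))%:R - 1 :> R.
Proof.
rewrite kappaE root_count_unit; set k := #|_|.
have -> : (k%:R - 1 : algC) = ratr (k%:R - 1) by rewrite rmorphB rmorph_nat rmorph1.
by rewrite ratCK rmorphB rmorph_nat rmorph1.
Qed.

Lemma root_count2 (b : F) : odd p -> b != 0 ->
  (root_count 2 b)%:Z - 1 = legendre b.
Proof.
move=> po b0; rewrite /legendre (negbTE b0); case: existsP => [[c /eqP bc]|nc].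
  have c0 : c != 0 by apply: contraNneq b0; rewrite bc => ->; rewrite expr0n.
  have cc : c != - c.
    rewrite -addr_eq0 -mulr2n -mulr_natr mulf_neq0 //.
    by rewrite -(dvdn_pcharf (pchar_Fp p_pr)) gtnNdvd // odd_prime_gt2.
  rewrite /root_count (eq_card (B := pred2 c (- c))) ?card2 ?cc // => x;
    rewrite !inE bc eqf_sqr.
  by apply: andb_idl => /orP[] /eqP ->; rewrite ?oppr_eq0.
rewrite /root_count eq_card0 // => x; rewrite !inE; apply/negP => /andP[_ /eqP xb].
by apply: nc; exists x; rewrite xb.
Qed.

End Kappa.

(** * Fiber counts for the three conditions *)

Section FiberCounts.
Variables (p n : nat) (p_pr : prime p) (n_ge2 : (2 <= n)%N).
Local Notation F := 'F_p.
Local Notation B := {poly_(n.+1) F}.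

Lemma fiber_count_sqfree : exists C : int, forall b0 b1 : F, b0 != 0 ->
  (fiber_count (fun x : B * B => sqfree n.+1 (x.1 : {poly F})) b0 b1)%:R =
  C - (~~ odd n)%:R * (p ^ n.-1)%N%:R * (root_count 2 b0)%:R.
Proof.
have [|C HC] := @count_sqfree F n.+1 n; first by rewrite (ltnW n_ge2) ltnSn.
exists (C * (p ^ n.-1)%N%:R) => b0 b1 b00.
have -> : fiber_count (fun x : B * B => sqfree n.+1 (x.1 : {poly F})) b0 b1 =
    (npoly_count n.+1 (fun f => mon n b0 f && sqfree n.+1 f) * p ^ n.-1)%N.
  have c1 := @count_cong F n.+1 n 0 1 0 b1 (ltnW n_ge2) (leqnSn n) (size_poly1 _).
  rewrite coef1 oner_eq0 subn0 card_Fp // in c1.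
  rewrite -(c1 isT) /npoly_count -cardX; apply: eq_card => x; rewrite !inE dvd1p andbT.
  by rewrite -!andbA; do 3!congr (_ && _); rewrite andbA andbC.
by rewrite natrM HC //; ring.
Qed.

Lemma fiber_count_maximal : exists C : int, forall b0 b1 : F, b0 != 0 ->
  (fiber_count (fun x : B * B => [forall g in monic_irr F n.+1,
      ~~ (((g : {poly F}) ^+ 2 %| (x.1 : {poly F})) &&
         ((g : {poly F}) %| (x.2 : {poly F}) + sqr_defect p_pr x.1 g))]) b0 b1)%:R =
  C - (~~ odd n)%:R * (p ^ (n.-1 - n./2))%N%:R * (root_count 2 b0)%:R.
Proof.
have [||C HC] := @count_pairs_good F n.+1 n (sqr_defect p_pr).
- by rewrite n_ge2 ltnSn.
- exact: sqr_defect_mul.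
by exists C => b0 b1 b00; have := HC b0 b1 b00; rewrite (card_Fp p_pr).
Qed.

Lemma fiber_count_double_root : exists C : int, forall b0 b1 : F, b0 != 0 ->
  (fiber_count (fun x : B * B => [exists a, double_root n.+1 a (x.1 : {poly F}) &&
    ~~ ('X + a%:P %| (x.2 : {poly F}) + sqr_defect p_pr x.1 ('X + a%:P))]) b0 b1)%:R =
  C + ((p ^ n.-1)%N%:R - (p ^ n.-2)%N%:R) * (-1) ^+ n *
     ((root_count n b0)%:R - (~~ odd n)%:R * (p.-1 * n.-2./2)%N%:R * (root_count 2
       b0)%:R).
Proof.
have [|C HC] := @count_pairs_double_root F n.+1 n (sqr_defect p_pr).
  by rewrite n_ge2 ltnSn.
by exists C => b0 b1 b00; have := HC b0 b1 b00; rewrite (card_Fp p_pr).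
Qed.

End FiberCounts.

Lemma root_count_F2 (p n : nat) (p_pr : prime p) (b : {unit 'F_p}) : p = 2%N ->
  root_count n (FinRing.uval b) = 1%N.
Proof.
move=> p2; have p1 : p.-1 = 1%N by rewrite p2.
have cG := card_units p_pr; rewrite p1 in cG.
have all1 (x : {unit 'F_p}) : x = 1%g.
  have : x \in [set: {unit 'F_p}]%G by rewrite inE.
  by rewrite (card1_trivg cG) => /set1gP.
rewrite root_count_unit (card_power_fiber p_pr) p1 gcdn1.
by case: existsP => // -[]; exists 1%g; rewrite [b]all1 expg1n.
Qed.

Theorem theorem7p1 (R : realType) (n p : nat) (p_pr : prime p)
    (n_ge2 : (2 <= n)%N) (b : padic_int p_pr) (b_unit : b \is a GRing.unit)
    (mu : probability (padic_space p_pr n.-1) R) (mu_haar : is_haar mu)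
    (mu' : probability (padic_space p_pr n) R) (mu'_haar : is_haar mu') :
  let P E := density mu (fixed_poly n b) (V_fixed n b) E in
  let P' E := density mu' (monic_poly p_pr n) (V_unit p_pr n) E in
  let Pmax := P (max_set p_pr) in let Pmax' := P' (max_set p_pr) in
  let P0 := P (sqf0_set p_pr) in let P0' := P' (sqf0_set p_pr) in
  let P1 := P (sqf1_set p_pr) in let P1' := P' (sqf1_set p_pr) in
  let kap : R := ratr (getCrat (kappa n (unit_reduction b_unit))) in
  let leg : R := (legendre (reduction b))%:~R in
  [/\ odd p -> forall c : {unit 'F_p},
        kappa n c = if [exists d : {unit 'F_p}, c == (d ^+ n)%g]
                    then (gcdn n p.-1)%:R - 1 else -1,
      p = 2%N -> [/\ P1 = 0, Pmax = Pmax' & P0 = P0'],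
      odd p -> ~~ (2 %| n)%N ->
        [/\ Pmax = Pmax',
            P0 = P0' &
            P1 = P1' - (p%:R - 1) / p%:R ^+ n * kap] &
      odd p -> (2 %| n)%N ->
        [/\ Pmax = Pmax' - leg / p%:R ^+ (3 * n %/ 2 - 1),
            P0 = P0' - leg / p%:R ^+ (n - 1) &
            P1 = P1' + (p%:R - 1) / p%:R ^+ n * kap
                 - (p%:R - 1) ^+ 2 / p%:R ^+ n * (n%:R / 2 - 1) * leg]].
Proof.
move=> P P' Pmax Pmax' P0 P0' P1 P1' kap leg.
have rb : reduction b != 0 by rewrite -unit_padicE.
have pR0 : p%:R != 0 :> R by rewrite pnatr_eq0 -lt0n prime_gt0.
have kapE : kap = (root_count n (reduction b))%:R - 1 by exact: ratr_kappa.
have legE : odd p -> leg = (root_count 2 (reduction b))%:R - 1.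
  by move=> po; rewrite /leg -(root_count2 p_pr po rb) rmorphB /= rmorph1.
have diff := density_diff n_ge2 b_unit mu_haar mu'_haar.
have E0 : P0 = P0' + (- ((~~ odd n)%:R * (p ^ n.-1)%N%:R)) *
    ((root_count 2 (reduction b))%:R - 1) / (p ^ (2 * n.-1))%:R.
  have [C HC] := fiber_count_sqfree p_pr n_ge2.
  rewrite /P0 /P (diff _ _ C 0 (- ((~~ odd n)%:R * (p ^ n.-1)%N%:R)) (detects_sqf0
    (p_pr := p_pr) n_ge2)).
    by rewrite mul0r add0r rmorphN rmorphM /= !rmorph_nat.
  by move=> b0 b1 /HC ->; rewrite mul0r addr0 mulNr.
have Emax : Pmax = Pmax' + (- ((~~ odd n)%:R * (p ^ (n.-1 - n./2))%N%:R)) *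
    ((root_count 2 (reduction b))%:R - 1) / (p ^ (2 * n.-1))%:R.
  have [C HC] := fiber_count_maximal p_pr n_ge2.
  rewrite /Pmax /P (diff _ _ C 0 (- ((~~ odd n)%:R * (p ^ (n.-1 - n./2))%N%:R))
    (detects_max (p_pr := p_pr) n_ge2)).
    by rewrite mul0r add0r rmorphN rmorphM /= !rmorph_nat.
  by move=> b0 b1 /HC ->; rewrite mul0r addr0 mulNr.
(* Divided by [p ^ (2 * n.-1)], this is the factor [(p - 1) / p ^ n] of the statement up to the sign
   [(-1) ^+ n], which separates the cases of odd and even [n]. *)
pose K : int := ((p ^ n.-1)%N%:R - (p ^ n.-2)%N%:R) * (-1) ^+ n.
have E1 : odd p -> P1 = P1' + K%:~R * (((root_count n (reduction b))%:R - 1) -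
    (~~ odd n)%:R * (p.-1 * n.-2./2)%N%:R * ((root_count 2 (reduction b))%:R - 1))
       / (p ^ (2 * n.-1))%:R.
  move=> po; have [C HC] := fiber_count_double_root p_pr n_ge2.
  pose w : int := (~~ odd n)%:R * (p.-1 * n.-2./2)%N%:R.
  rewrite /P1 /P (diff _ _ C K (- (K * w)) (detects_sqf1 (p_pr := p_pr) n_ge2)).
    have -> : (- (K * w))%:~R = - (K%:~R * ((~~ odd n)%:R * (p.-1 * n.-2./2)%N%:R)) :> R.
      by rewrite rmorphN !rmorphM /= !rmorph_nat.
    by congr (_ + _ / _); ring.
  by move=> b0 b1 b00; rewrite po (HC b0 b1 b00) -/K /w; ring.
split.
- by move=> _ c; exact: kappa_formula.
- move=> p2.
  (* The unit group of the field with two elements is trivial, so all centred root counts vanish. *)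
  have r1 j : (root_count j (reduction b))%:R - 1 = 0 :> R.
    by rewrite (root_count_F2 j p_pr (unit_reduction b_unit) p2) subrr.
  split; last by rewrite E0 r1 mulr0 mul0r addr0.
    rewrite /P1 /P (density_fixed n_ge2 b_unit mu_haar (detects_sqf1 (p_pr := p_pr)
      n_ge2)).
    rewrite [fiber_count _ _ _](_ : _ = 0%N) ?mul0r //.
    have po : odd p = false by rewrite p2.
    by apply: eq_card0 => x; rewrite !inE po /= !andbF.
  by rewrite Emax r1 mulr0 mul0r addr0.
all: move=> po; rewrite dvdn2 ?negbK => on.
(* Apart from the exponents special to maximality, all powers of [p] are written in terms of [x = p]
   and [y = p ^ (n - 2)], which leaves identities for [field]. *)
all: pose x : R := p%:R; pose y : R := x ^+ n.-2.
all: have n1 : n.-1 = n.-2.+1 by rewrite prednK // -ltnS prednK // ltnW.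
all: have xn : x ^+ n = y * x ^+ 2 by rewrite -exprD addn2 -n1 prednK // ltnW.
all: have xn1 : x ^+ n.-1 = y * x by rewrite n1 exprSr.
all: have y0 : y != 0 by rewrite expf_neq0.
all: have KE : K%:~R = y * (x - 1) * (-1) ^+ n.
1,3: by rewrite /K rmorphM rmorphB rmorph_sign /= !rmorph_nat !natrX xn1 -/y; ring.
all: have qE : (p ^ (2 * n.-1))%:R = (y * x) ^+ 2 :> R.
1,3: by rewrite natrX mulnC exprM xn1.
- rewrite Emax E0 (E1 po) kapE KE qE on /= -[p%:R]/x xn -signr_odd on expr1.
  rewrite !mul0r oppr0 !mul0r !addr0; split=> //.
  by congr (_ + _); field; rewrite pR0 y0.
(* For even [n], [n.-2./2] is the [n / 2 - 1] of the statement. *)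
- have n2 : n = (n.-2./2.+1).*2 by move: on n_ge2; lia.
  have nR : n%:R = 2 * (n.-2./2)%:R + 2 :> R.
    by rewrite {1}n2 -muln2 natrM -natr1; ring.
  (* Origin of the exponent [3 * n / 2 - 1]: it is [2 * (n - 1)] from the measure minus
     [n - 1 - n / 2] from the weight of the divisors of degree [n / 2]. *)
  have vE : x ^+ (n.-1 - n./2) * x ^+ (3 * n %/ 2 - 1) = (y * x) ^+ 2.
    by rewrite -xn1 -exprM -exprD; congr (_ ^+ _); move: on n_ge2; lia.
  have pm : p.-1%:R = x - 1 by rewrite -subn1 natrB // prime_gt0.
  have v0 : x ^+ (3 * n %/ 2 - 1) != 0 by rewrite expf_neq0.
  rewrite Emax E0 (E1 po) kapE (legE po) KE qE -signr_odd (negbTE on) expr0.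
  rewrite !natrX -[p%:R]/x xn [(n - 1)%N]subn1 !xn1 !mul1r natrM pm nR.
  move: (_ - 1) (_ - 1) ((n.-2./2)%:R) => k k2 h; split.
  - have u0 : x ^+ (n.-1 - n./2) != 0 by rewrite expf_neq0.
    rewrite -vE; move: (x ^+ (n.-1 - n./2)) (x ^+ (3 * n %/ 2 - 1)) u0 v0 => u v u0 v0.
    by field; rewrite u0 v0.
  - by field; rewrite pR0 y0.
  - by field; rewrite pR0 y0.
Qed.
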